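(* Let $p$ be an odd prime, $\ell\ge1$, $B$ a non-degenerate symmetric bilinear form on $V=\mathbb{F}_p^{2\ell}$ and $\tau=\pm p^{-\ell}$. Then $\mathcal{C}=\mathcal{TY}(V,\chi_B,\tau)$ admits a fibration if, and only if, $\bar{\nu}(s)\ge d(s)$ for all simple objects $s\in\mathcal{C}$.
   Context: A fibration of a fusion category $\mathcal{C}$ is a $\mathbb{C}$-linear, faithful and exact monoidal functor $\mathcal{C}\to\mathrm{Vect}_{\mathbb{C}}$ to finite-dimensional vector spaces. For a bilinear form $B:V\times V\to\mathbb{F}_p$, $\chi_B$ is the symmetric bicharacter $\chi_B(a,b)=\exp(2\pi i\,B(a,b)/p)$ of the additive group $V$. Tambara-Yamagami categories: let $A$ be a finite abelian group, $\chi:A\times A\to\mathbb{C}^\times$ a non-degenerate symmetric bicharacter and $\tau\in\mathbb{R}$ with $\tau^2=|A|^{-1}$. $\mathcal{TY}(A,\chi,\tau)$ is the skeletal $\mathbb{C}$-linear semisimple (fusion) category with simple objects $A\sqcup\{m\}$, $\mathrm{Hom}(s,s')=\mathbb{C}$ if $s=s'$ and $0$ otherwise for simple $s,s'$, tensor product $a\otimes b=ab$, $a\otimes m=m=m\otimes a$, $m\otimes m=\bigoplus_{x\in A}x$ ($a,b\in A$), strict unit object $\mathbf{1}=e\in A$, and associativity $\Phi_{a,m,b}=\chi(a,b)\,\mathrm{id}_m$, $\Phi_{m,a,m}=(\chi(a,x)\delta_{x,y}\,\mathrm{id}_x)_{x,y}:\bigoplus_{x}x\to\bigoplus_{y}y$,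 $\Phi_{m,m,m}=(\tau\chi(x,y)^{-1}\mathrm{id}_m)_{x,y}:\bigoplus_{x\in A}m\to\bigoplus_{y\in A}m$, all other $\Phi_{s,t,u}$ on simple objects being identities. Duals: $a^*=a^{-1}$ with identity $\mathrm{ev},\mathrm{db}$; $m^*=m$ with $\mathrm{ev}_m=\tau^{-1}\pi$, $\mathrm{db}_m=\iota$, where $\pi:m\otimes m\to\mathbf{1}$ and $\iota:\mathbf{1}\to m\otimes m$ are the canonical projection and embedding, $\pi\iota=\mathrm{id}$. It is always given the canonical spherical pivotal structure $j_a=\mathrm{id}_a$ ($a\in A$), $j_m=\operatorname{sgn}(\tau)\,\mathrm{id}_m$, for which the pivotal dimensions are $d(a)=1$ and $d(m)=\sqrt{|A|}$. Frobenius-Schur indicators: in a pivotal category $\mathcal{C}$ with associativity $\Phi$, let $X^{\otimes n}$ be the $n$-fold tensor power with rightmost parentheses and $\Phi^{(n)}:X^{\otimes(n-1)}\otimes X\to X^{\otimes n}$ the unique coherence isomorphism. Define $E_X^{(n)}$ on $\mathcal{C}(\mathbf{1},X^{\otimes n})$ by sending $f$ to $$\mathbf{1}\xrightarrow{\mathrm{db}}X^*\otimes X^{**}\xrightarrow{(X^*\otimes f)\otimes X^{**}}(X^*\otimes X^{\otimes n})\otimes X^{**}\xrightarrow{\Phi^{-1}\otimes j^{-1}}((X^*\otimes X)\otimes X^{\otimes(n-1)})\otimes X\xrightarrow{(\mathrm{ev}\otimes X^{\otimes(n-1)})\otimes X}X^{\otimes(n-1)}\otimes X\xrightarrow{\Phi^{(n)}}X^{\otimes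 n},$$ and $\nu_n(X)=\operatorname{Tr}(E_X^{(n)})$. $\operatorname{FSexp}(\mathcal{C})$ is the least positive integer $n$ with $\nu_n(X)=d(X)$ for all $X\in\mathcal{C}$ (known to be finite for spherical fusion categories). The total indicator is $\bar{\nu}(X)=\sum_{n=1}^{\operatorname{FSexp}(\mathcal{C})}\nu_n(X)$. *)

(* Defs.v *)
From mathcomp Require Export all_boot all_order all_algebra.
From mathcomp Require Export all_classical all_reals all_analysis.
From mathcomp Require Export complex.

Set Implicit Arguments.
Unset Strict Implicit.
Unset Printing Implicit Defensive.

Import Order.TTheory GRing.Theory Num.Theory.

Local Open Scope ring_scope.
Local Open Scope complex_scope.

(* The structure carried by a K-linear pivotal monoidal category.  The axioms
   (pentagon, zigzag, ...) are not fields: indicators and fibrations are defined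
   from the structure alone.  Composition is diagrammatic, [assoc] goes from
   (X ⊗ Y) ⊗ Z to X ⊗ (Y ⊗ Z), and duals are left duals,
   ev : X^* ⊗ X -> 1 and db : 1 -> X ⊗ X^*. *)
Record pivotal_structure (K : fieldType) := PivotalStructure {
  obj :> Type;
  hom : obj -> obj -> vectType K;
  idm : forall X, hom X X;
  comp : forall X Y Z, hom X Y -> hom Y Z -> hom X Z;
  unit_obj : obj;
  tens : obj -> obj -> obj;
  tensm : forall X X' Y Y',
    hom X X' -> hom Y Y' -> hom (tens X Y) (tens X' Y');
  assoc : forall X Y Z, hom (tens (tens X Y) Z) (tens X (tens Y Z));
  assoc_inv : forall X Y Z, hom (tens X (tens Y Z)) (tens (tens X Y) Z);
  lunit : forall X, hom (tens unit_obj X) X;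
  runit : forall X, hom (tens X unit_obj) X;
  runit_inv : forall X, hom X (tens X unit_obj);
  dual : obj -> obj;
  ev : forall X, hom (tens (dual X) X) unit_obj;
  db : forall X, hom unit_obj (tens X (dual X));
  piv : forall X, hom X (dual (dual X));
  piv_inv : forall X, hom (dual (dual X)) X
}.

Arguments idm {K _} X.
Arguments unit_obj {K _}.
Arguments assoc {K _} X Y Z.
Arguments assoc_inv {K _} X Y Z.
Arguments lunit {K _} X.
Arguments runit {K _} X.
Arguments runit_inv {K _} X.
Arguments ev {K _} X.
Arguments db {K _} X.
Arguments piv {K _} X.
Arguments piv_inv {K _} X.

Declare Scope cat_scope.
Delimit Scope cat_scope with cat.
Notation "f >>> g" := (comp f g) (at level 50, left associativity) : cat_scope.
Notation "X ⊗ Y" := (tens X Y) (at level 40, left associativity) : cat_scope.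
Notation "f <⊗> g" := (tensm f g) (at level 40, left associativity) : cat_scope.
Local Open Scope cat_scope.

Section Indicators.
Variables (K : fieldType) (C : pivotal_structure K).
Implicit Types (X Y Z : C) (n : nat).

Definition trace (V : vectType K) (f : V -> V) : K :=
  \sum_(i < \dim {:V}) coord (vbasis {:V}) i (f (vbasis {:V})`_i).

(* The scalar by which an endomorphism of the simple unit object acts. *)
Definition unit_scalar (f : hom (@unit_obj K C) unit_obj) : K :=
  coord [tuple idm (@unit_obj K C)] ord0 f.

Definition pivotal_dim X : K :=
  unit_scalar (db X >>> (piv X <⊗> idm (dual X)) >>> ev (dual X)).

(* Rightmost parentheses: X^n = X ⊗ (X ⊗ ( ... (X ⊗ 1))); the innermost
   unit is immaterial as the unit is strict. *)
Fixpoint tpow X n : C := if n is n'.+1 then X ⊗ tpow X n' else unit_obj.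

(* [tpow_assoc X n] is the coherence isomorphism Phi^(n+1). *)
Fixpoint tpow_assoc X n : hom (tpow X n ⊗ X) (tpow X n.+1) :=
  match n return hom (tpow X n ⊗ X) (tpow X n.+1) with
  | 0 => lunit X >>> runit_inv X
  | n'.+1 => assoc X (tpow X n') X >>> (idm X <⊗> tpow_assoc X n')
  end.

(* [FS_operator X n] is the endomorphism E_X^(n+1). *)
Definition FS_operator X n (f : hom unit_obj (tpow X n.+1)) :
    hom unit_obj (tpow X n.+1) :=
  db (dual X)
  >>> ((runit_inv (dual X) >>> (idm (dual X) <⊗> f)) <⊗> idm (dual (dual X)))
  >>> (assoc_inv (dual X) X (tpow X n) <⊗> piv_inv X)
  >>> (((ev X <⊗> idm (tpow X n)) >>> lunit (tpow X n)) <⊗> idm X)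
  >>> tpow_assoc X n.

(* Only meaningful for n > 0. *)
Definition FS_indicator n X : K :=
  if n is n'.+1 then trace (@FS_operator X n') else 0.

Definition FS_period n : Prop :=
  (0 < n)%N /\ forall X, FS_indicator n X = pivotal_dim X.

(* The default value 0 is only reached if no positive integer qualifies. *)
Definition FSexp : nat :=
  xget 0%N [set n | FS_period n /\ forall k, FS_period k -> (n <= k)%N].

Definition total_indicator X : K :=
  \sum_(1 <= n < FSexp.+1) FS_indicator n X.

End Indicators.

Section Fibrations.
Variables (K : fieldType) (C : pivotal_structure K).

Definition is_kernel (X Y Z : C) (f : hom X Y) (g : hom Y Z) : Prop :=
  f >>> g = 0 /\
  forall W (h : hom W Y), h >>> g = 0 -> exists! k : hom W X, k >>> f = h.

Definition is_cokernel (X Y Z : C) (f : hom X Y) (g : hom Y Z) : Prop :=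
  f >>> g = 0 /\
  forall W (h : hom Y W), f >>> h = 0 -> exists! k : hom Z W, g >>> k = h.

Definition short_exact (X Y Z : C) (f : hom X Y) (g : hom Y Z) : Prop :=
  is_kernel f g /\ is_cokernel f g.

Definition vect_short_exact (U V W : vectType K)
    (f : 'Hom(U, V)) (g : 'Hom(V, W)) : Prop :=
  [/\ lker f = 0%VS, limg f = lker g & limg g = fullv].

(* The monoidal constraint F X ⊗ F Y -> F (X ⊗ Y) is given, through the
   universal property of the tensor product of vector spaces, as a bilinear map;
   it is invertible iff products of basis vectors form a basis.  Likewise the
   isomorphism from the ground field to F 1 is given by the image of 1. *)
Record fibration := Fibration {
  fobj : C -> vectType K;
  fmap : forall X Y : C, {linear hom X Y -> 'Hom(fobj X, fobj Y)};
  fmap_id : forall X, fmap X X (idm X) = \1%VF;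
  fmap_comp : forall X Y Z (f : hom X Y) (g : hom Y Z),
    fmap X Z (f >>> g) = (fmap Y Z g \o fmap X Y f)%VF;
  fmap_faithful : forall X Y, injective (fmap X Y);
  fmap_exact : forall X Y Z (f : hom X Y) (g : hom Y Z),
    short_exact f g -> vect_short_exact (fmap X Y f) (fmap Y Z g);
  ftens : forall X Y, {bilinear fobj X -> fobj Y -> fobj (X ⊗ Y)};
  ftens_iso : forall X Y,
    basis_of fullv
      [seq ftens X Y u v | u <- vbasis {:fobj X}, v <- vbasis {:fobj Y}];
  ftens_natural : forall X X' Y Y' (f : hom X X') (g : hom Y Y') u v,
    fmap _ _ (f <⊗> g) (ftens X Y u v) = ftens X' Y' (fmap _ _ f u) (fmap _ _ g v);
  funit : fobj unit_obj;
  funit_iso : basis_of fullv [:: funit];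
  fassoc : forall X Y Z u v w,
    fmap _ _ (assoc X Y Z) (ftens (X ⊗ Y) Z (ftens X Y u v) w) =
    ftens X (Y ⊗ Z) u (ftens Y Z v w);
  flunit : forall X v, fmap _ _ (lunit X) (ftens unit_obj X funit v) = v;
  frunit : forall X v, fmap _ _ (runit X) (ftens X unit_obj v funit) = v
}.

Definition admits_fibration : Prop := inhabited fibration.

End Fibrations.

Section TambaraYamagami.
Variables (R : realType) (A : finZmodType).
Variables (chi : A -> A -> R[i]) (tau : R).

(* The label [Some a] is the simple object a, [None] is m; the group A is
   written additively. *)
Definition ty_label : finType := option A.
Implicit Types s t u v x y : ty_label.

(* Whether v is a summand of the (multiplicity-free) product of s and t. *)
Definition ty_fusion s t v : bool :=
  match s, t, v with
  | Some a, Some b, Some c => c == a + b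
  | Some _, None, None | None, Some _, None | None, None, Some _ => true
  | _, _, _ => false
  end.

Definition ty_dual_label s : ty_label := omap -%R s.

(* An object is a direct sum of simple objects, given by its multiplicities, so
   isomorphic objects are equal; [summand X] enumerates the simple summands. *)
Definition ty_obj := ty_label -> nat.
Definition ty_simple s : ty_obj := fun t => (t == s) : nat.
Definition summand (X : ty_obj) : finType := {s : ty_label & 'I_(X s)}.
Implicit Types X Y Z : ty_obj.

(* Morphisms are matrices indexed by the summands of source and target, with
   entries only between summands of the same label. *)
Definition ty_hom X Y : vectType R[i] :=
  {ffun {p : summand X * summand Y | tag p.1 == tag p.2} -> R[i]^o}.

Definition entry X Y (f : ty_hom X Y) (i : summand X) (j : summand Y) : R[i] :=
  oapp (fun p => f p : R[i]) 0 (insub (i, j)).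

Definition of_entries X Y (f : summand X -> summand Y -> R[i]) : ty_hom X Y :=
  [ffun p => f (val p).1 (val p).2].

Definition ty_id X : ty_hom X X := of_entries (fun i j => (i == j)%:R).

Definition ty_comp X Y Z (f : ty_hom X Y) (g : ty_hom Y Z) : ty_hom X Z :=
  of_entries (fun i k => \sum_j entry f i j * entry g j k).

Definition ty_unit : ty_obj := ty_simple (Some 0).

(* The summands of X ⊗ Y with label v correspond to the pairs of a summand of
   X and a summand of Y whose product contains v. *)
Definition tens_summands X Y v : {set summand X * summand Y} :=
  [set p | ty_fusion (tag p.1) (tag p.2) v].
Definition ty_tens X Y : ty_obj := fun v => #|tens_summands X Y v|.

Definition factors X Y (i : summand (ty_tens X Y)) : summand X * summand Y :=
  enum_val (tagged i : 'I_#|tens_summands X Y (tag i)|).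

Definition ty_tensm X X' Y Y' (f : ty_hom X X') (g : ty_hom Y Y') :
    ty_hom (ty_tens X Y) (ty_tens X' Y') :=
  of_entries (fun i j =>
    entry f (factors i).1 (factors j).1 * entry g (factors i).2 (factors j).2).

(* The component of Phi_{s,t,u} from the summand v of x ⊗ u, x in s ⊗ t, to
   the summand v of s ⊗ y, y in t ⊗ u; if no clause applies this is 1. *)
Definition ty_assoc_coef s t u v x y : R[i] :=
  match s, t, u with
  | Some a, None, Some b => chi a b
  | None, Some a, None => if v is Some c then chi a c else 1
  | None, None, None =>
      if (x, y) is (Some a, Some b) then tau%:C * (chi a b)^-1 else 1
  | _, _, _ => 1
  end.

(* Same for the inverse; the matrices (tau chi(x,y)^-1)_{x,y} and
   (tau chi(x,y))_{x,y} are mutually inverse because tau^2 = 1/|A|. *)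
Definition ty_assoc_inv_coef s t u v x y : R[i] :=
  match s, t, u with
  | Some a, None, Some b => (chi a b)^-1
  | None, Some a, None => if v is Some c then (chi a c)^-1 else 1
  | None, None, None =>
      if (x, y) is (Some a, Some b) then tau%:C * chi a b else 1
  | _, _, _ => 1
  end.

(* i is a summand of (X ⊗ Y) ⊗ Z and j of X ⊗ (Y ⊗ Z); the component
   between them vanishes unless both come from the same summands of X, Y, Z. *)
Definition assoc_entry (c : ty_label -> ty_label -> ty_label -> ty_label ->
    ty_label -> ty_label -> R[i]) X Y Z
    (i : summand (ty_tens (ty_tens X Y) Z))
    (j : summand (ty_tens X (ty_tens Y Z))) : R[i] :=
  let: (ixy, iz) := factors i in
  let: (ix, iy) := factors ixy in
  let: (jx, jyz) := factors j in
  let: (jy, jz) := factors jyz in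
  if [&& ix == jx, iy == jy & iz == jz]
  then c (tag ix) (tag iy) (tag iz) (tag i) (tag ixy) (tag jyz) else 0.

Definition ty_assoc X Y Z :
    ty_hom (ty_tens (ty_tens X Y) Z) (ty_tens X (ty_tens Y Z)) :=
  of_entries (assoc_entry ty_assoc_coef (Z := Z)).

Definition ty_assoc_inv X Y Z :
    ty_hom (ty_tens X (ty_tens Y Z)) (ty_tens (ty_tens X Y) Z) :=
  of_entries (fun j i => assoc_entry ty_assoc_inv_coef i j).

(* 1 ⊗ X and X ⊗ 1 are equal to X as multiplicity functions, but not by
   conversion: these are the identities of X, written across that equality. *)
Definition ty_lunit X : ty_hom (ty_tens ty_unit X) X :=
  of_entries (fun i j => ((factors i).2 == j)%:R).
Definition ty_runit X : ty_hom (ty_tens X ty_unit) X :=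
  of_entries (fun i j => ((factors i).1 == j)%:R).
Definition ty_runit_inv X : ty_hom X (ty_tens X ty_unit) :=
  of_entries (fun j i => ((factors i).1 == j)%:R).

Definition ty_dual X : ty_obj := fun s => X (ty_dual_label s).

(* The summand of X of which i is the dual. *)
Definition undual X (i : summand (ty_dual X)) : summand X :=
  @Tagged ty_label (ty_dual_label (tag i)) (fun s => 'I_(X s)) (tagged i).

Definition ty_ev X : ty_hom (ty_tens (ty_dual X) X) ty_unit :=
  of_entries (fun i _ =>
    if undual (factors i).1 == (factors i).2
    then (if tag (factors i).2 is Some _ then 1 else (tau%:C)^-1) else 0).

Definition ty_db X : ty_hom ty_unit (ty_tens X (ty_dual X)) :=
  of_entries (fun _ i => ((factors i).1 == undual (factors i).2)%:R).

(* sgn(tau)^-1 = sgn(tau), so the same coefficients serve for the inverse. *)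
Definition ty_piv_coef s : R[i] := if s is Some _ then 1 else (Num.sg tau)%:C.

Definition ty_piv X : ty_hom X (ty_dual (ty_dual X)) :=
  of_entries (fun i j => (i == undual (undual j))%:R * ty_piv_coef (tag i)).
Definition ty_piv_inv X : ty_hom (ty_dual (ty_dual X)) X :=
  of_entries (fun j i => (i == undual (undual j))%:R * ty_piv_coef (tag i)).

Definition TY : pivotal_structure R[i] :=
  PivotalStructure ty_id ty_comp ty_tensm ty_assoc ty_assoc_inv
    ty_lunit ty_runit ty_runit_inv ty_ev ty_db ty_piv ty_piv_inv.

End TambaraYamagami.

Definition expi (R : realType) (t : R) : R[i] := cos t +i* sin t.

(* chi_B(a,b) = exp(2 pi i B(a,b) / p), B(a,b) being represented in [0,p). *)
Definition chi_form (R : realType) (p : nat) (V : Type) (B : V -> V -> 'F_p)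
    (a b : V) : R[i] :=
  expi (2 * pi * (B a b : nat)%:R / p%:R : R).

(* Main.v *)
(* Both conditions are equivalent to tau > 0 together with the Gauss sum of B being d = p^l, i.e. to B
   being hyperbolic.  Write eps for sgn(tau) times the normalized Gauss sum, a sign since dim V is even.
   Then nu_n(m) = 0 for odd n, nu_(2k)(m) = eps^k d if p | k, and up to a sign eps^k it is the normalized
   Gauss sum otherwise; so FSexp is 2p if eps = 1 and 4p if eps = -1, and the total indicator of m is
   (p - 1) G + d (G the normalized Gauss sum) or 0, respectively.
   From a fibration, left and right multiplication by a on the fibre of m give matrices L_a, R_a, and
   S_a = R_a^-1 L_a satisfies S_a S_b = chi(a,b) S_(a+b) and tau \sum_a S_a = 1; diagonalizing the
   representation a |-> chi(a,a)^(1/2) S_a evaluates the Gauss sum.  Conversely, a decomposition of V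
   into two Lagrangian subspaces makes the functions on one of them the fibre of m. *)
From HB Require Import structures.
Require Import Defs.
From mathcomp Require Import ring lra zify.

Import Order.TTheory GRing.Theory Num.Theory.
Local Open Scope ring_scope.
Local Open Scope complex_scope.

Set Implicit Arguments.
Unset Strict Implicit.
Unset Printing Implicit Defensive.

(** * Gauss sums of quadratic forms over finite fields *)

(** The oddness of p enters three times. It makes 2 invertible in F_p, so that chi(a,a) has the even
    square root h(a) = exp(2 pi i 2^-1 B(a,a)/p), a quadratic refinement of chi; in terms of h the
    recursion for the indicators of m becomes a convolution, diagonal after a Fourier transform. It
    makes the dimension of the fibre of m odd, and only then do determinants turn a relation N = c
    N^T, c^2 = 1, for the pairing N on that fibre into c = 1, which gives the sign of tau. Finally,
    a fibration determines the Gauss sum only up to a value of h, a p-th root of unity; the Gauss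
    sum is known to be d or -d, and -1 is not a p-th root of unity. The evenness of dim V makes the
    Gauss sums of all t B with t != 0 equal, so scalings and conjugations of the form can be
    ignored. One Gauss sum then determines the number of isotropic vectors, and Lagrangian subspaces
    arise by splitting off hyperbolic planes. *)

Lemma sum_shift (G : finZmodType) (K : nmodType) (f : G -> K) a : \sum_x f (x + a) = \sum_x f x.
Proof. by rewrite [RHS](reindex_inj (addIr a)). Qed.

Lemma sum_nontrivial_char (G : finZmodType) (K : idomainType) (e : G -> K) :
  {morph e : x y / x + y >-> x * y} -> (exists x, e x != 1) -> \sum_x e x = 0.
Proof.
move=> eD [y ey]; have /eqP := sum_shift e y; under eq_bigr do rewrite eD.
rewrite -mulr_suml -subr_eq0 -{2}[\sum_x e x]mulr1 -mulrBr mulf_eq0 subr_eq0.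
by rewrite (negPf ey) orbF => /eqP.
Qed.

Section GaussSums.
Variables (F : finFieldType) (K : numFieldType) (e : F -> K).
Hypothesis e0 : e 0 = 1.
Hypothesis eD : {morph e : x y / x + y >-> x * y}.
Hypothesis e_nontrivial : exists x, e x != 1.
Hypothesis two_neq0 : (2 : F) != 0.

Lemma sum_char_scale c : \sum_t e (t * c) = if c == 0 then #|F|%:R else 0.
Proof.
case: eqP => [->|/eqP c0].
  under eq_bigr do rewrite mulr0 e0.
  by rewrite sumr_const.
transitivity (\sum_x e x); last exact: sum_nontrivial_char.
by rewrite [RHS](reindex_inj (mulIf c0)).
Qed.

Definition gauss t : K := \sum_x e (t * x ^+ 2).

Definition is_square (t : F) : bool := [exists s, t == s ^+ 2].

Lemma gauss_square t c : t != 0 -> is_square t -> gauss (t * c) = gauss c.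
Proof.
move=> t0 /existsP[s /eqP ts].
have s0 : s != 0 by apply: contra t0; rewrite ts => /eqP->; rewrite expr0n.
rewrite /gauss [RHS](reindex_inj (mulfI s0)).
by apply: eq_bigr => x _; rewrite ts exprMn; congr (e _); ring.
Qed.

Definition sqrts (t y : F) : {set F} := [set x | t * x ^+ 2 == y].

Lemma card_sqrts (t y : F) : t != 0 -> (#|sqrts t y| <= 2)%N.
Proof.
move=> t0; have [->|[x0]] := set_0Vmem (sqrts t y); first by rewrite cards0.
rewrite inE => /eqP x0y.
apply: leq_trans (_ : #|[set x0; - x0]| <= 2)%N; last by rewrite cards2; case: eqP.
apply: subset_leq_card; apply/fintype.subsetP => x; rewrite !inE -x0y.
by rewrite (inj_eq (mulfI t0)) eqf_sqr.
Qed.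

Lemma sum_card_sqrts (t : F) : (\sum_y #|sqrts t y| = #|F|)%N.
Proof.
under eq_bigr do rewrite -sum1_card.
rewrite (exchange_big_dep predT) //= -sum1_card; apply: eq_bigr => x _.
by rewrite (big_pred1 (t * x ^+ 2)%R) // => z; rewrite !inE eq_sym.
Qed.

(** No nonzero y is both a square and t times a square, so each of these sums is at most 2. Their
    total over all y is 2 |F|, which forces equality everywhere. *)
Lemma card_sqrts_nonsquare (t y : F) : t != 0 -> ~~ is_square t ->
  (#|sqrts 1%R y| + #|sqrts t y| = 2)%N.
Proof.
move=> t0 nt; pose f z := (#|sqrts 1%R z| + #|sqrts t z|)%N.
have le2 z : (f z <= 2)%N.
  have [z0|z0] := eqVneq z 0.
    have sqrts0 (u : F) : u != 0 -> #|sqrts u z| = 1%N.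
      move=> u0; rewrite z0 (_ : sqrts u 0 = [set 0]) ?cards1 //.
      by apply/setP => x; rewrite !inE mulf_eq0 (negPf u0) expf_eq0.
    by rewrite /f !sqrts0 ?oner_neq0.
  have [e1|[x0]] := set_0Vmem (sqrts 1 z).
    by rewrite /f e1 cards0 card_sqrts.
  have [e1|[x1]] := set_0Vmem (sqrts t z).
    by rewrite /f e1 cards0 addn0 card_sqrts ?oner_neq0.
  rewrite !inE mul1r => /eqP x1z /eqP x0z.
  case/negP: nt; apply/existsP; exists (x0 / x1); apply/eqP.
  have x10 : x1 != 0 by apply: contra z0 => /eqP x10; rewrite -x1z x10 expr0n mulr0.
  by rewrite expr_div_n x0z -x1z mulfK // expf_neq0.
have sumf : (\sum_z f z = \sum_(z : F) 2)%N.
  by rewrite big_split /= !sum_card_sqrts sum_nat_const muln2 addnn.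
have := leqif_sum (fun z (_ : true) => leqif_eq (le2 z)).
by move=> /= [_]; rewrite sumf eqxx => /esym/forallP/(_ y)/eqP.
Qed.

Lemma gauss_sqrts t c :
  gauss (t * c) = \sum_y #|sqrts t y|%:R * e (y * c).
Proof.
rewrite /gauss (partition_big (fun x => t * x ^+ 2) predT) //=.
apply: eq_bigr => y _; rewrite mulr_natl -sumr_const.
apply: eq_big => [x|x /eqP <-]; first by rewrite inE.
by congr (e _); ring.
Qed.

(** Squares and t times squares together cover every element of F exactly twice, so the two Gauss
    sums add up to twice the sum of a nontrivial character. *)
Lemma gauss_nonsquare t c : c != 0 -> t != 0 -> ~~ is_square t ->
  gauss (t * c) = - gauss c.
Proof.
move=> c0 t0 nt; apply/eqP; rewrite -addr_eq0 -[X in _ + gauss X]mul1r.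
rewrite !gauss_sqrts -big_split /=.
under eq_bigr => y _ do rewrite -mulrDl -natrD addnC card_sqrts_nonsquare //.
by rewrite -mulr_sumr sum_char_scale (negPf c0) mulr0.
Qed.

(** The quadratic character for t != 0; at 0 its value is 1, not 0. *)
Definition quad_sign t : K := if is_square t then 1 else -1.

Lemma quad_sign_sqr t : quad_sign t ^+ 2 = 1.
Proof. by rewrite /quad_sign; case: ifP; rewrite ?sqrrN expr1n. Qed.

Lemma gaussM t c : t != 0 -> c != 0 -> gauss (t * c) = quad_sign t * gauss c.
Proof.
move=> t0 c0; rewrite /quad_sign; case: ifP => st; first by rewrite mul1r gauss_square.
by rewrite mulN1r gauss_nonsquare ?st.
Qed.

(** After the shift of y by x the exponent is -c y^2 - 2 c x y, linear in x, so the sum over x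
    leaves only y = 0. *)
Lemma gauss_opp c : c != 0 -> gauss c * gauss (- c) = #|F|%:R.
Proof.
move=> c0; rewrite /gauss mulr_suml.
under eq_bigr => x _.
  rewrite mulr_sumr -(sum_shift _ x); under eq_bigr => y _.
    rewrite -eD (_ : _ + _ = (- c * y ^+ 2) + x * (- c * 2 * y)); last by ring.
    rewrite eD; over.
  over.
rewrite exchange_big /=; under eq_bigr do rewrite -mulr_sumr sum_char_scale.
rewrite (bigD1 0) //= big1 ?addr0; last first.
  by move=> y y0; rewrite !mulf_eq0 oppr_eq0 (negPf c0) (negPf two_neq0) (negPf y0) mulr0.
by rewrite !mulr0 eqxx expr0n mulr0 e0 mul1r.
Qed.

Lemma gauss_sqr c : c != 0 -> gauss c ^+ 2 = quad_sign (-1) * #|F|%:R.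
Proof.
move=> c0; have := gauss_opp c0; rewrite -(mulN1r c) gaussM ?oppr_eq0 ?oner_neq0 // => <-.
by rewrite -[LHS]mul1r -(quad_sign_sqr (-1)); ring.
Qed.

Definition quad n (M : 'M[F]_n) (x : 'rV[F]_n) : F := (x *m M *m x^T) 0 0.

Definition gauss_form n (M : 'M[F]_n) (t : F) : K := \sum_x e (t * quad M x).

Lemma exists_kermx_basis m n k (A : 'M[F]_(m, n)) : (m - \rank A = k)%N ->
  exists2 N : 'M[F]_(k, m), row_free N & N *m A = 0.
Proof.
rewrite -mxrank_ker => <-; exists (row_base (kermx A)); first exact: row_base_free.
by apply/sub_kermxP; rewrite eq_row_base.
Qed.

(** The rows of [N] span the orthogonal complement of those of [U]. As the form is non-degenerate on
    the rows of [U], both together form a basis in which the form is block diagonal, and the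
    character turns the orthogonal sum into a product. *)
Lemma gauss_form_split k n (M : 'M[F]_(k + n)) (U : 'M[F]_(k, k + n)) :
    M^T = M -> M \in unitmx -> U *m M *m U^T \in unitmx ->
  exists N : 'M[F]_(n, k + n), [/\ N *m M *m U^T = 0, N *m M *m N^T \in unitmx &
    forall t, gauss_form M t =
      gauss_form (U *m M *m U^T) t * gauss_form (N *m M *m N^T) t].
Proof.
move=> symM unitM unitU.
have rU : \rank (M *m U^T) = k.
  apply/eqP; rewrite eqn_leq rank_leq_col /= -[X in (X <= _)%N](mxrank_unit unitU).
  by rewrite -mulmxA mxrankM_maxr.
have [|N freeN] := @exists_kermx_basis _ _ n (M *m U^T); first by rewrite rU addKn.
rewrite mulmxA => NU.
have UN : U *m M *m N^T = 0 by apply: trmx_inj; rewrite !trmx_mul trmxK symM mulmxA NU trmx0.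
pose P := col_mx U N.
have PMP : P *m M *m P^T = block_mx (U *m M *m U^T) 0 0 (N *m M *m N^T).
  by rewrite mul_col_mx tr_col_mx mul_col_row NU UN.
have unitP : P \in unitmx.
  rewrite -row_free_unit -kermx_eq0; apply/rowV0P => v /sub_kermxP.
  rewrite -[v]hsubmxK mul_row_col => vP0.
  have v1 : lsubmx v = 0.
    apply: (can_inj (mulmxK unitU)); rewrite mul0mx !mulmxA.
    have /(congr1 (mulmx^~ (M *m U^T))) := vP0.
    by rewrite mulmxDl mul0mx -!mulmxA (mulmxA N) NU mulmx0 addr0.
  move: vP0; rewrite v1 mul0mx add0r -(mul0mx _ N) => /(row_free_inj freeN)->.
  by rewrite mul0mx row_mx0.
have unitN : N *m M *m N^T \in unitmx.
  have : P *m M *m P^T \in unitmx by rewrite !unitmx_mul unitP unitM unitmx_tr.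
  by rewrite PMP unitmxE det_ublock unitrM => /andP[_]; rewrite -unitmxE.
exists N; split=> // t.
rewrite /gauss_form mulr_suml.
under [RHS]eq_bigr do rewrite mulr_sumr.
rewrite pair_big /= (reindex (fun xy : 'rV_k * 'rV_n => row_mx xy.1 xy.2 *m P)) /=.
  apply: eq_bigr => -[x y] _ /=; rewrite -eD -mulrDr; congr (e (_ * _)).
  rewrite /quad trmx_mul (_ : _ *m _ = row_mx x y *m (P *m M *m P^T) *m (row_mx x y)^T);
    last by rewrite !mulmxA.
  rewrite PMP.
  rewrite mul_row_block !mulmx0 add0r addr0 tr_row_mx mul_row_col mxE.
  by rewrite !mulmxA.
exists (fun z => (lsubmx (z *m invmx P), rsubmx (z *m invmx P))) => [[x y] _|z _] /=.
  by rewrite mulmxK // row_mxKl row_mxKr.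
by rewrite hsubmxK mulmxKV.
Qed.

Lemma quadD n (M : 'M[F]_n) x y : M^T = M ->
  quad M (x + y) = quad M x + quad M y + 2 * (x *m M *m y^T) 0 0.
Proof.
move=> symM; have -> : 2 * (x *m M *m y^T) 0 0 =
    (x *m M *m y^T) 0 0 + (y *m M *m x^T) 0 0.
  have -> : (y *m M *m x^T) 0 0 = (y *m M *m x^T)^T 0 0 by rewrite [RHS]mxE.
  by rewrite !trmx_mul trmxK symM mulmxA; ring.
rewrite /quad linearD /= mulmxDl !mulmxDr !mulmxDl !mxE; ring.
Qed.

Lemma quad_eq0 n (M : 'M[F]_n) : M^T = M -> (forall x, quad M x = 0) -> M = 0.
Proof.
move=> symM M0; apply/matrixP => i j; rewrite mxE.
have := quadD (delta_mx 0 i) (delta_mx 0 j) symM; rewrite !M0 !addr0 add0r => /esym/eqP.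
by rewrite mulf_eq0 (negPf two_neq0) -rowE trmx_delta -colE !mxE => /eqP.
Qed.

Lemma gauss_form_scalar (M : 'M[F]_1) t : gauss_form M t = gauss (t * M 0 0).
Proof.
rewrite /gauss_form /gauss (reindex (fun a : F => a%:M : 'rV_1)) /=.
  apply: eq_bigr => a _; congr (e _).
  by rewrite /quad mul_scalar_mx tr_scalar_mx mul_mx_scalar !mxE; ring.
exists (fun x : 'rV_1 => x 0 0) => [a _|x _]; first by rewrite mxE eqxx.
by rewrite -mx11_scalar.
Qed.

Lemma gauss_form_dim0 (M : 'M[F]_0) t : gauss_form M t = 1.
Proof.
rewrite /gauss_form (big_pred1 0) => [|x]; last by rewrite [x]thinmx0 /= eqxx.
by rewrite /quad mul0mx mul0mx mxE mulr0 e0.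
Qed.

(** Diagonalization: a non-isotropic vector is split off repeatedly, and each contributes a
    one-variable Gauss sum. *)
Lemma gauss_formP n (M : 'M[F]_n) t : M^T = M -> M \in unitmx -> t != 0 ->
  gauss_form M t = quad_sign t ^+ n * gauss_form M 1 /\
  gauss_form M t ^+ 2 = (quad_sign (-1) * #|F|%:R) ^+ n.
Proof.
elim: n M => [|n IHn] M symM unitM t0; first by rewrite !gauss_form_dim0 !expr1n mulr1.
have [x Mx] : exists x, quad M x != 0.
  apply/existsP; apply: contraLR unitM; rewrite negb_exists => /forallP M0.
  rewrite (quad_eq0 symM) ?unitmxE ?det0 ?unitr0 // => x.
  by apply/eqP; rewrite -[_ == _]negbK M0.
have unitx : x *m M *m x^T \in unitmx.
  by rewrite [X in X \in _]mx11_scalar unitmxE det_scalar1 unitfE.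
have [N [_ unitN MN]] := @gauss_form_split 1 n M x symM unitM unitx.
have symN : (N *m M *m N^T)^T = N *m M *m N^T by rewrite !trmx_mul trmxK symM mulmxA.
have [IH1 IH2] := IHn _ symN unitN t0.
rewrite !MN !gauss_form_scalar; split.
  by rewrite IH1 gaussM // mul1r exprS; ring.
by rewrite exprMn IH2 gauss_sqr ?mulf_neq0 // -exprS.
Qed.

Lemma gauss_form_even l n (M : 'M[F]_n) t : n = (2 * l)%N ->
    M^T = M -> M \in unitmx -> t != 0 ->
  gauss_form M t = gauss_form M 1 /\ gauss_form M t ^+ 2 = (#|F|%:R ^+ l) ^+ 2.
Proof.
move=> nE symM unitM t0; have [E1 E2] := gauss_formP symM unitM t0.
have sq u : quad_sign u ^+ n = 1 by rewrite nE exprM quad_sign_sqr expr1n.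
by split; [rewrite E1 sq mul1r | rewrite E2 exprMn sq mul1r -exprM mulnC -nE].
Qed.

Lemma sum_gauss_form n (M : 'M[F]_n) :
  \sum_t gauss_form M t = #|F|%:R * #|[pred x | quad M x == 0]|%:R.
Proof.
rewrite /gauss_form exchange_big /=; under eq_bigr do rewrite sum_char_scale.
by rewrite -big_mkcond /= sumr_const mulr_natr.
Qed.

(* Otherwise the sum of gauss_form M t over all t would be #|F|, less than its term at t = 0. *)
Lemma exists_isotropic l n (M : 'M[F]_n) : n = (2 * l)%N ->
  M^T = M -> M \in unitmx -> (0 < l)%N ->
  gauss_form M 1 = #|F|%:R ^+ l -> exists2 x, x != 0 & quad M x = 0.
Proof.
move=> nE symM unitM l0 M1.
case: (pickP [pred x | (x != 0) && (quad M x == 0)]) => [x /andP[x0 /eqP Mx]|no].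
  by exists x.
have q1 : 1 < #|F|%:R :> K by rewrite ltr1n; apply/card_gt1P; exists 0, 1; rewrite ?inE // eq_sym oner_neq0.
have := sum_gauss_form M.
rewrite (eq_card (_ : [pred x | quad M x == 0] =i pred1 0)) => [|x]; last first.
  have := no x; rewrite !inE; case: eqP => //= -> _.
  by rewrite /quad !mul0mx mxE eqxx.
rewrite card1 mulr1 (bigD1 0) //=.
have -> : gauss_form M 0 = #|F|%:R ^+ n.
  rewrite /gauss_form; under eq_bigr do rewrite mul0r e0.
  by rewrite sumr_const card_mx mul1n natrX.
rewrite (eq_bigr (fun=> #|F|%:R ^+ l)) => [|t t0]; last first.
  by have [-> _] := gauss_form_even nE symM unitM t0.
rewrite sumr_const cardC1 => eqF.
have : #|F|%:R < #|F|%:R ^+ n + #|F|%:R ^+ l *+ #|F|.-1 :> K.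
  apply: lt_le_trans (_ : #|F|%:R ^+ n <= _); last first.
    by rewrite lerDl mulrn_wge0 // exprn_ge0.
  by rewrite -[X in X < _]expr1 ltr_eXn2l // nE; case: (l) l0 => // l' _; rewrite mulnS.
by rewrite eqF ltxx.
Qed.

(** The form is 2ab in the coordinates a and b; the sum over b vanishes unless a = 0. *)
Lemma gauss_form_hyperbolic_plane (M : 'M[F]_2) :
  M = \matrix_(i, j) (i != j)%:R -> gauss_form M 1 = #|F|%:R.
Proof.
move=> ->; rewrite /gauss_form (reindex (fun ab : F * F => \row_i (if i == 0 then ab.1 else ab.2))) /=.
  rewrite -(pair_big predT predT (fun a b => e (1 * quad _ (\row_i (if i == 0 then a else b))))) /=.
  under eq_bigr => a _.
    under eq_bigr => b _.
      rewrite (_ : 1 * _ = b * (2 * a)); last first.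
        rewrite /quad !mxE !big_ord_recl !big_ord0 !mxE !big_ord_recl !big_ord0 !mxE /=.
        by ring.
      over.
    rewrite sum_char_scale mulf_eq0 (negPf two_neq0) /=; over.
  by rewrite -big_mkcond big_pred1_eq.
exists (fun x : 'rV_2 => (x 0 0, x 0 1)) => [[a b] _|x _]; first by rewrite !mxE.
apply/rowP => i; rewrite !mxE; case: (i =P 0) => [->|] //.
by case: i => [[|[|//]] Hi] // i0; [case: i0; apply/val_inj | congr (x _ _); apply/val_inj].
Qed.

Lemma mx11_eq0 (A : 'M[F]_1) : A 0 0 = 0 -> A = 0.
Proof. by move=> A0; rewrite [A]mx11_scalar A0 raddf0. Qed.

Lemma half_double (c : F) : c / 2 + c / 2 = c.
Proof. by field. Qed.

Lemma exists_hyperbolic_pair n (M : 'M[F]_n) x : M^T = M -> M \in unitmx ->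
  x != 0 -> quad M x = 0 ->
  exists y, [/\ x *m M *m x^T = 0, y *m M *m y^T = 0, x *m M *m y^T = 1 &
    y *m M *m x^T = 1].
Proof.
move=> symM unitM x0 Mx.
have [j xj] : exists j, (x *m M) 0 j != 0.
  apply/existsP; apply: contraNT x0; rewrite negb_exists => /forallP xM0.
  rewrite -(mulmxK unitM x) (_ : x *m M = 0) ?mul0mx //; apply/rowP => j.
  by rewrite [RHS]mxE; apply/eqP; rewrite -[_ == _]negbK xM0.
pose z : 'rV_n := ((x *m M) 0 j)^-1 *: delta_mx 0 j.
have xz : (x *m M *m z^T) 0 0 = 1.
  by rewrite linearZ /= -scalemxAr [LHS]mxE trmx_delta -colE [X in _ * X]mxE mulVf.
move: z xz => z xz.
have xMx : x *m M *m x^T = 0 by apply: mx11_eq0.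
(* Since x is isotropic and pairs to 1 with z, subtracting c x lowers the value of the form at z by
   2c. *)
pose y := z - (quad M z / 2) *: x.
have xy : x *m M *m y^T = 1.
  rewrite /y linearB /= mulmxBr linearZ /= -scalemxAr xMx scaler0 subr0.
  by rewrite [LHS]mx11_scalar xz.
have yx : y *m M *m x^T = 1.
  by apply: trmx_inj; rewrite !trmx_mul trmxK symM mulmxA xy trmx1.
have xMz : x *m M *m z^T = 1 by rewrite [LHS]mx11_scalar xz.
exists y; split=> //.
have -> : y *m M *m y^T = y *m M *m z^T - (quad M z / 2) *: 1.
  by rewrite -yx scalemxAr -mulmxBr; congr (_ *m _); rewrite /y linearB linearZ.
rewrite {1}/y mulmxBl mulmxBl -!scalemxAl xMz -addrA -opprD -scalerDl.
by rewrite half_double [z *m M *m z^T]mx11_scalar scalemx1 subrr.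
Qed.

(** Induction on hyperbolic planes: an isotropic vector spans one with a suitable partner. The plane
    contributes a factor |F| to the Gauss sum, so the complement satisfies the same hypothesis with
    l lowered by 1. *)
Lemma exists_hyperbolic_basis l n (M : 'M[F]_n) : n = (2 * l)%N ->
    M^T = M -> M \in unitmx -> gauss_form M 1 = #|F|%:R ^+ l ->
  exists X Y : 'M[F]_(l, n),
    [/\ X *m M *m X^T = 0, Y *m M *m Y^T = 0 & X *m M *m Y^T = 1%:M].
Proof.
elim: l n M => [|l IHl] n M.
  by move=> _ _ _ _; exists 0, 0; split; apply/matrixP => -[].
move=> nE symM unitM M1.
have [x x0 Mx] := exists_isotropic nE symM unitM isT M1.
have [y [xx yy xy yx]] := exists_hyperbolic_pair symM unitM x0 Mx.
move: nE; rewrite mulnS => nE.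
(* The dimension has to be literally a sum for the splitting lemma, hence the elimination of the
   equation. *)
case: _ / (esym nE) M symM unitM M1 x y x0 Mx xx yy xy yx => {nE n} M symM unitM M1 x y.
move=> x0 Mx xx yy xy yx.
pose U : 'M[F]_(1 + 1, 2 + 2 * l) := col_mx x y.
have UMU : U *m M *m U^T = block_mx 0 1 1 0.
  by rewrite mul_col_mx tr_col_mx mul_col_row xx xy yx yy.
have UE : U *m M *m U^T = \matrix_(i, j) (i != j)%:R.
  rewrite UMU; apply/matrixP => i j; rewrite !mxE.
  have -> : (i != j) = (nat_of_ord i != nat_of_ord j) by [].
  by case: splitP => i' ->; rewrite !mxE; case: splitP => j' ->; rewrite !mxE
    ?(ord1 i') ?(ord1 j').
have unitU : U *m M *m U^T \in unitmx.
  have : block_mx 0 1 1 0 *m block_mx 0 1 1 0 = 1%:M :> 'M[F]_(1 + 1).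
    by rewrite mulmx_block !mul0mx !mulmx0 !mul1mx !addr0 !add0r -scalar_mx_block.
  by rewrite UMU => /mulmx1_unit[].
have [N [NU unitN MN]] := @gauss_form_split 2 (2 * l) M U symM unitM unitU.
have symN : (N *m M *m N^T)^T = N *m M *m N^T by rewrite !trmx_mul trmxK symM mulmxA.
have q0 : #|F|%:R != 0 :> K.
  by rewrite pnatr_eq0 -lt0n; apply/card_gt0P; exists 0.
have N1 : gauss_form (N *m M *m N^T) 1 = #|F|%:R ^+ l.
  apply: (mulfI q0); rewrite -exprS -M1 (MN 1); congr (_ * _).
  by rewrite (gauss_form_hyperbolic_plane UE).
have [X [Y [XX YY XY]]] := IHl _ _ erefl symN unitN N1.
have [xN yN] : x *m M *m N^T = 0 /\ y *m M *m N^T = 0.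
  have : U *m M *m N^T = 0 by apply: trmx_inj; rewrite !trmx_mul trmxK symM mulmxA NU trmx0.
  by rewrite !mul_col_mx -[0]vsubmxK => /eq_col_mx[-> ->]; rewrite !linear0.
have [Nx Ny] : N *m M *m x^T = 0 /\ N *m M *m y^T = 0.
  by split; apply: trmx_inj; rewrite !trmx_mul trmxK symM mulmxA ?xN ?yN trmx0.
have E (A B : 'M[F]_(l, 2 * l)) : A *m N *m M *m (B *m N)^T = A *m (N *m M *m N^T) *m B^T.
  by rewrite trmx_mul !mulmxA.
exists (col_mx x (X *m N) : 'M[F]_(1 + l, _)), (col_mx y (Y *m N) : 'M[F]_(1 + l, _)).
have z1 (u : 'rV_(2 + 2 * l)) (A : 'M[F]_(l, 2 * l)) : u *m M *m N^T = 0 ->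
    u *m M *m (A *m N)^T = 0.
  by rewrite trmx_mul mulmxA => ->; rewrite mul0mx.
have z2 (u : 'rV_(2 + 2 * l)) (A : 'M[F]_(l, 2 * l)) : N *m M *m u^T = 0 ->
    A *m N *m M *m u^T = 0.
  by rewrite -!mulmxA => ->; rewrite mulmx0.
have B (u u' : 'rV[F]_(2 + 2 * l)) (A A' : 'M[F]_(l, 2 + 2 * l)) :
    col_mx u A *m M *m (col_mx u' A')^T =
    block_mx (u *m M *m u'^T) (u *m M *m A'^T) (A *m M *m u'^T) (A *m M *m A'^T).
  by rewrite mul_col_mx tr_col_mx mul_col_row.
split; apply: (etrans (B _ _ _ _)); rewrite E ?z1 ?z2 //.
- by rewrite xx XX block_mx0.
- by rewrite yy YY block_mx0.
- by rewrite xy XY -scalar_mx_block.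
Qed.

End GaussSums.

(** * Entries of morphisms *)

Arguments ty_fusion {A} s t v : simpl never.

Section Entries.
Variables (R : realType) (A : finZmodType).
Implicit Types (X Y Z : ty_obj A) (s t u v : ty_label A).
Local Notation hom := (ty_hom R).

Lemma entry_of_entries X Y (f : summand X -> summand Y -> R[i]) i j :
  entry (of_entries f) i j = if tag i == tag j then f i j else 0.
Proof.
rewrite /entry; case: insubP => [p /= -> pE|/= /negPf->] //=.
by rewrite ffunE /= [val p]pE.
Qed.

Lemma entry_tag X Y (f : hom X Y) i j : tag i != tag j -> entry f i j = 0.
Proof. by move=> ij; rewrite /entry insubF //=; apply: negPf. Qed.

Lemma hom_eqP X Y (f g : hom X Y) : (forall i j, entry f i j = entry g i j) -> f = g.
Proof.
move=> fg; apply/ffunP => -[[i j] ij]; have := fg i j.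
by rewrite /entry (insubT (fun p => tag p.1 == tag p.2) ij).
Qed.

Lemma entry_id X i j : entry (ty_id R X) i j = (i == j)%:R.
Proof.
by rewrite entry_of_entries; case: (i =P j) => [->|_]; rewrite ?eqxx ?if_same.
Qed.

Lemma entryD X Y (f g : hom X Y) i j : entry (f + g) i j = entry f i j + entry g i j.
Proof. by rewrite /entry; case: insubP => [p _ _|_] /=; rewrite ?ffunE ?addr0. Qed.

Lemma entryZ X Y (a : R[i]) (f : hom X Y) i j : entry (a *: f) i j = a * entry f i j.
Proof. by rewrite /entry; case: insubP => [p _ _|_] /=; rewrite ?ffunE ?mulr0. Qed.

Lemma entry0 X Y i j : entry (0 : hom X Y) i j = 0.
Proof. by rewrite /entry; case: insubP => [p _ _|_] /=; rewrite ?ffunE. Qed.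

Lemma entry_comp X Y Z (f : hom X Y) (g : hom Y Z) i k :
  entry (ty_comp f g) i k = \sum_j entry f i j * entry g j k.
Proof.
rewrite entry_of_entries; case: ifP => // /negbT ik.
apply/esym/big1 => j _; case: (eqVneq (tag i) (tag j)) => [ij|ij].
  by rewrite [entry g _ _]entry_tag ?mulr0 -?ij.
by rewrite entry_tag ?mul0r.
Qed.

Lemma factors_fusion X Y (k : summand (ty_tens X Y)) :
  ty_fusion (tag (factors k).1) (tag (factors k).2) (tag k).
Proof.
by case: k => v k; have := enum_valP k; rewrite inE.
Qed.

Lemma factors_inj X Y (k k' : summand (ty_tens X Y)) :
  tag k = tag k' -> factors k = factors k' -> k = k'.
Proof.
case: k k' => v k [v' k'] /= vv; case: _ / vv k' => k'.
by rewrite /factors /= => /enum_val_inj->.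
Qed.

Lemma eq_tens X Y (k k' : summand (ty_tens X Y)) :
  (k == k') = (tag k == tag k') && (factors k == factors k').
Proof.
apply/eqP/andP => [->|[/eqP tk /eqP fk]]; first by rewrite !eqxx.
exact: factors_inj.
Qed.

Lemma sum_summand X (M : nmodType) (F : summand X -> M) :
  \sum_i F i = \sum_s \sum_(k < X s) F (Tagged (fun s => 'I_(X s)) k).
Proof. by rewrite sig_big_dep /=; apply: eq_bigr => -[]. Qed.

(** A summand of a product is determined by its label and its two factors. Composites through tensor
    products are computed with this equation; at each use the summand is spelled out as a function
    of label and factors because unification cannot find it. *)
Lemma sum_tens X Y (M : nmodType) (F : ty_label A -> summand X * summand Y -> M) :
  \sum_(k : summand (ty_tens X Y)) F (tag k) (factors k) =
  \sum_i \sum_j \sum_(v | ty_fusion (tag i) (tag j) v) F v (i, j).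
Proof.
rewrite sum_summand.
under eq_bigr => v _.
  rewrite -(@big_enum_val _ _ _ _ (mem (tens_summands X Y v)) (F v)) /=.
  rewrite (eq_bigl (fun p : summand X * summand Y => ty_fusion (tag p.1) (tag p.2) v));
    last by move=> p; rewrite inE.
  over.
rewrite (exchange_big_dep predT) //= pair_big /=.
by apply: eq_bigr => -[i j].
Qed.

Lemma entry_tensm X X' Y Y' (f : hom X X') (g : hom Y Y') i j :
  entry (ty_tensm f g) i j = (tag i == tag j)%:R *
    (entry f (factors i).1 (factors j).1 * entry g (factors i).2 (factors j).2).
Proof. by rewrite entry_of_entries; case: eqP; rewrite ?mul1r ?mul0r. Qed.

Lemma sum_only (I : finType) (F : I -> R[i]) i :
  (forall j, j != i -> F j = 0) -> \sum_j F j = F i.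
Proof. by move=> F0; rewrite (bigD1 i) //= big1 ?addr0 // => j /F0. Qed.

Lemma sum_option (F : ty_label A -> R[i]) : \sum_z F z = F None + \sum_a F (Some a).
Proof.
rewrite (bigD1 None) //=; congr (_ + _).
by rewrite (reindex_omap Some id) => [|[]] //=; apply: eq_bigl => a; rewrite eqxx.
Qed.

Lemma sum_fusion1 (P : pred (ty_label A)) (F : ty_label A -> R[i]) v :
  (forall u, u != v -> F u = 0) -> \sum_(u | P u) F u = (P v)%:R * F v.
Proof.
move=> F0; rewrite big_mkcond (@sum_only _ _ v) => [|u /F0->]; last by rewrite if_same.
by case: (P v); rewrite ?mul1r ?mul0r.
Qed.

Lemma simple_gt0 s : (0 < ty_simple s s)%N.
Proof. by rewrite /ty_simple eqxx. Qed.

Definition simple_summand s : summand (ty_simple s) :=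
  Tagged (fun t => 'I_(ty_simple s t)) (Ordinal (simple_gt0 s)).

Lemma simple_summandP s (i : summand (ty_simple s)) : i = simple_summand s.
Proof.
case: i => t k; have ts : t = s.
  by apply/eqP; move: (ltn_ord k); rewrite {2}/ty_simple; case: eqP.
subst t; congr existT; apply/val_inj.
by case: k => -[|k] //=; rewrite /ty_simple eqxx.
Qed.

Lemma tag_simple s (i : summand (ty_simple s)) : tag i = s.
Proof. by rewrite (simple_summandP i). Qed.

Lemma sum_simple s (F : summand (ty_simple s) -> R[i]) :
  \sum_i F i = F (simple_summand s).
Proof. by apply: sum_only => i; rewrite (simple_summandP i) eqxx. Qed.

Lemma fusion0r s v : ty_fusion s (Some 0) v = (v == s).
Proof. by case: s v => [a|] [c|] //=; rewrite /ty_fusion addr0. Qed.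

Lemma fusion0l s v : ty_fusion (Some 0) s v = (v == s).
Proof. by case: s v => [a|] [c|] //=; rewrite /ty_fusion add0r. Qed.

Lemma dual_labelK : involutive (@ty_dual_label A).
Proof. by case=> [a|] //=; rewrite opprK. Qed.

Lemma fusion_dual s t : ty_fusion s t (Some 0) = (s == ty_dual_label t).
Proof.
case: s t => [a|] [b|] //=.
by rewrite /ty_fusion eq_sym addr_eq0.
Qed.

Lemma tag_undual X (i : summand (ty_dual X)) : tag (undual i) = ty_dual_label (tag i).
Proof. by []. Qed.

Lemma Tagged_cast_ord X s t (e : s = t) (k : 'I_(X s)) :
  Tagged (fun s => 'I_(X s)) (cast_ord (congr1 X e) k) = Tagged (fun s => 'I_(X s)) k.
Proof. by case: _ / e; rewrite cast_ord_id. Qed.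

(** The inverse of [undual]. Double dual labels agree with labels only up to a proved equality,
    hence the cast of the ordinal. *)
Definition codual X (i : summand X) : summand (ty_dual X) :=
  @Tagged _ (ty_dual_label (tag i)) (fun s => 'I_(ty_dual X s))
    (cast_ord (congr1 X (esym (dual_labelK (tag i)))) (tagged i)).

Lemma codualK X : cancel (@codual X) (@undual A X).
Proof. by case=> s k; rewrite /undual /codual /= Tagged_cast_ord. Qed.

Lemma undualK X : cancel (@undual A X) (@codual X).
Proof.
move=> i; have := codualK (undual i).
move: (codual _) (esym (dual_labelK (tag i))) => j _ {}; case: i j => s k [t k'].
rewrite /undual /= => E; have /(can_inj dual_labelK) st : ty_dual_label t = ty_dual_label s.
  by have /(congr1 tag) := E.
by subst t; rewrite (eq_from_Tagged E).
Qed.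

(** The intermediate summand must carry the label of the source; whenever the labels of the factors
    agree as well, this label does occur in their product. *)
Lemma ty_tensm_comp X X' X'' Y Y' Y'' (f : hom X X') (f' : hom X' X'')
    (g : hom Y Y') (g' : hom Y' Y'') :
  ty_comp (ty_tensm f g) (ty_tensm f' g') = ty_tensm (ty_comp f f') (ty_comp g g').
Proof.
apply: hom_eqP => i k; rewrite entry_comp.
under eq_bigr do rewrite !entry_tensm.
apply: etrans.
  apply: (sum_tens (fun v p => (tag i == v)%:R *
    (entry f (factors i).1 p.1 * entry g (factors i).2 p.2) * ((v == tag k)%:R *
    (entry f' p.1 (factors k).1 * entry g' p.2 (factors k).2)))).
rewrite entry_tensm !entry_comp mulr_suml mulr_sumr; apply: eq_bigr => j1 _.
rewrite !mulr_sumr; apply: eq_bigr => j2 _ /=.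
rewrite (@sum_fusion1 _ _ (tag i)) => [|u /negPf ui]; last first.
  by rewrite eq_sym ui !mul0r.
rewrite eqxx mul1r.
case: (eqVneq (tag (factors i).1) (tag j1)) => [e1|e1]; last first.
  by rewrite (entry_tag _ e1) !(mul0r, mulr0).
case: (eqVneq (tag (factors i).2) (tag j2)) => [e2|e2]; last first.
  by rewrite (entry_tag g e2) !(mul0r, mulr0).
by rewrite -e1 -e2 factors_fusion mul1r; ring.
Qed.

End Entries.

(** * Indicators as sums over labels *)

Section Trace.
Variables (K : fieldType) (T : finType).
Local Notation V := ({ffun T -> K^o} : vectType K).

(** The trace is defined with an unspecified basis. Exchanging the two sums leaves, for each
    coordinate t, the expansion of [g t] in that basis evaluated at t. *)
Lemma trace_ffun (f : V -> V) (m : T -> T -> K) :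
  (forall v s, f v s = \sum_t (v t : K) * m t s) -> trace f = \sum_t m t t.
Proof.
move=> fm; pose g t : V := [ffun s => m t s].
have fg v : f v = \sum_t (v t : K) *: g t.
  apply/ffunP => s; rewrite fm sum_ffunE; apply: eq_bigr => t _.
  by rewrite !ffunE.
rewrite /trace; under eq_bigr => i _.
  rewrite fg linear_sum /=; under eq_bigr do rewrite linearZ /=.
  over.
rewrite exchange_big /=; apply: eq_bigr => t _.
have := coord_vbasis (memvf (g t)) => /ffunP/(_ t); rewrite sum_ffunE ffunE => ->.
by apply: eq_bigr => i _; rewrite !ffunE; exact: mulrC.
Qed.

End Trace.

Section Operator.
Variables (R : realType) (A : finZmodType) (chi : A -> A -> R[i]) (tau : R).
Local Notation C := (TY chi tau).
Implicit Types (X Y Z : ty_obj A) (s t u v : ty_label A).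
Local Notation homTY := (ty_hom R).

(** The unit has a single summand, so the coordinates of a morphism out of it are indexed by the
    summands of the target with label 0. *)
Lemma trace_unit_hom Y (E : homTY (@ty_unit A) Y -> homTY (@ty_unit A) Y)
    (M : summand Y -> summand Y -> R[i]) :
    (forall f o k, entry (E f) o k = (tag k == Some 0)%:R * \sum_j entry f o j * M j k) ->
  trace E = \sum_(k | tag k == Some 0) M k k.
Proof.
move=> EM; pose o := simple_summand (Some (0 : A)).
have oP (p : {p : summand (@ty_unit A) * summand Y | tag p.1 == tag p.2}) :
    (val p).1 = o by apply: simple_summandP.
have tagp (p : {p : summand (@ty_unit A) * summand Y | tag p.1 == tag p.2}) :
    tag (val p).2 == Some 0 by have := valP p; rewrite oP eq_sym.
have pairP (j : summand Y) (oj : tag (o, j).1 == tag (o, j).2)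
    (p : {p : summand (@ty_unit A) * summand Y | tag p.1 == tag p.2}) :
    ((val p).2 == j) = (p == Sub (o, j) oj).
  apply/eqP/eqP => [jp|->] //; apply: val_inj.
  by rewrite [LHS]surjective_pairing oP jp.
rewrite (@trace_ffun _ _ E (fun p q => M (val p).2 (val q).2)); last first.
  move=> v q; have := EM v o (val q).2; rewrite tagp mul1r.
  rewrite /entry -{1}(oP q) -surjective_pairing valK /= => ->.
  transitivity (\sum_(j | tag j == Some 0) entry v o j * M j (val q).2).
    rewrite [RHS]big_mkcond; apply: eq_bigr => j _; case: ifP => // /negbT jo.
    by rewrite -/(entry v o j) entry_tag ?mul0r // eq_sym.
  rewrite [RHS](partition_big (fun p => (val p).2) (fun j => tag j == Some 0)) /=;
    last by move=> p _; apply: tagp.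
  apply: eq_bigr => j j0.
  have oj : tag (o, j).1 == tag (o, j).2 by rewrite /= eq_sym.
  rewrite (big_pred1 (Sub (o, j) oj)) => [|p]; last exact: pairP.
  by rewrite /= /entry (insubT (fun p => tag p.1 == tag p.2) oj).
rewrite (partition_big (fun p => (val p).2) (fun j => tag j == Some 0)) /=;
  last by move=> p _; apply: tagp.
apply: eq_bigr => j j0.
have oj : tag (o, j).1 == tag (o, j).2 by rewrite /= eq_sym.
by rewrite (big_pred1 (Sub (o, j) oj)) // => p; apply: pairP.
Qed.

Local Notation o0 := (simple_summand (Some (0 : A))).

Lemma entry_runit_inv X i r :
  entry (ty_runit_inv R X) i r = (tag i == tag r)%:R * ((factors r).1 == i)%:R.
Proof. by rewrite entry_of_entries; case: eqP; rewrite ?mul1r ?mul0r. Qed.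

Lemma entry_runit X r i :
  entry (ty_runit R X) r i = (tag r == tag i)%:R * ((factors r).1 == i)%:R.
Proof. by rewrite entry_of_entries; case: eqP; rewrite ?mul1r ?mul0r. Qed.

Lemma entry_lunit X r i :
  entry (ty_lunit R X) r i = (tag r == tag i)%:R * ((factors r).2 == i)%:R.
Proof. by rewrite entry_of_entries; case: eqP; rewrite ?mul1r ?mul0r. Qed.

Lemma entry_ty_assoc X Y Z i j : entry (ty_assoc chi tau X Y Z) i j =
  (tag i == tag j)%:R * assoc_entry (ty_assoc_coef chi tau) i j.
Proof. by rewrite entry_of_entries; case: eqP; rewrite ?mul1r ?mul0r. Qed.

Lemma entry_ty_assoc_inv X Y Z i j : entry (ty_assoc_inv chi tau X Y Z) j i =
  (tag i == tag j)%:R * assoc_entry (ty_assoc_inv_coef chi tau) i j.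
Proof. by rewrite entry_of_entries eq_sym; case: eqP; rewrite ?mul1r ?mul0r. Qed.

Lemma assoc_entryE (c : ty_label A -> ty_label A -> ty_label A -> ty_label A ->
    ty_label A -> ty_label A -> R[i]) X Y Z (i : summand (ty_tens (ty_tens X Y) Z)) j :
  assoc_entry c i j =
  ((factors (factors i).1).1 == (factors j).1)%:R *
  (((factors (factors i).1).2 == (factors (factors j).2).1)%:R *
   ((factors i).2 == (factors (factors j).2).2)%:R) *
  c (tag (factors (factors i).1).1) (tag (factors (factors i).1).2)
    (tag (factors i).2) (tag i) (tag (factors i).1) (tag (factors j).2).
Proof.
rewrite /assoc_entry.
case: (factors i) => ixy iz /=; case: (factors ixy) => ix iy /=.
case: (factors j) => jx jyz /=; case: (factors jyz) => jy jz /=.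
by do !case: eqP => _; rewrite /= ?mul1r ?mul0r ?mulr0 ?mul0r.
Qed.

Lemma entry_unit_tensor X Y (f : homTY (@ty_unit A) Y) i (s : summand (ty_tens X Y)) :
  entry (ty_comp (ty_runit_inv R X) (ty_tensm (ty_id R X) f)) i s =
  (tag i == tag s)%:R * ((i == (factors s).1)%:R * entry f o0 (factors s).2).
Proof.
rewrite entry_comp.
under eq_bigr do rewrite entry_runit_inv entry_tensm entry_id.
apply: etrans.
  apply: (sum_tens (fun v p => (tag i == v)%:R * (p.1 == i)%:R *
    ((v == tag s)%:R * ((p.1 == (factors s).1)%:R * entry f p.2 (factors s).2)))).
rewrite (@sum_only _ _ _ i) => [|j /negPf ji]; last first.
  by rewrite big1 // => ? _; rewrite big1 // => ? _; rewrite /= ji mulr0 mul0r.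
rewrite sum_simple /= (@sum_fusion1 _ _ _ _ (tag i)) => [|u /negPf ui]; last first.
  by rewrite eq_sym ui !mul0r.
by rewrite fusion0r !eqxx !mul1r.
Qed.

(* [FS_operator] contracted on its dual legs, as a map from the dual of X to Z. *)
Definition FS_core X Z (f : homTY (@ty_unit A) (ty_tens X Z)) : homTY (ty_dual X) Z :=
  ty_comp (ty_comp (ty_comp (ty_runit_inv R (ty_dual X)) (ty_tensm (ty_id R (ty_dual X)) f))
    (ty_assoc_inv chi tau (ty_dual X) X Z))
  (ty_comp (ty_tensm (ty_ev tau X) (ty_id R Z)) (ty_lunit R Z)).

Definition ev_coef s : R[i] := if s is Some _ then 1 else (tau%:C)^-1.

Lemma entry_ev_lunit X Z w z :
  entry (ty_comp (ty_tensm (ty_ev tau X) (ty_id R Z)) (ty_lunit R Z)) w z =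
  (tag w == tag z)%:R * ((tag (factors w).1 == Some 0)%:R *
  ((undual (factors (factors w).1).1 == (factors (factors w).1).2)%:R *
   ev_coef (tag (factors (factors w).1).2)) * ((factors w).2 == z)%:R).
Proof.
rewrite entry_comp.
have evE (h : summand (ty_tens (ty_dual X) X)) o : entry (ty_ev tau X) h o =
   (tag h == Some 0)%:R * ((undual (factors h).1 == (factors h).2)%:R *
   ev_coef (tag (factors h).2)).
  rewrite entry_of_entries tag_simple /ev_coef.
  by case: eqP; rewrite ?mul1r ?mul0r //; case: eqP; rewrite ?mul1r ?mul0r.
under eq_bigr do rewrite entry_lunit entry_tensm entry_id evE.
apply: etrans.
  apply: (sum_tens (fun v p => (tag w == v)%:R *
  ((tag (factors w).1 == Some 0)%:R *
   ((undual (factors (factors w).1).1 == (factors (factors w).1).2)%:R *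
    ev_coef (tag (factors (factors w).1).2)) * ((factors w).2 == p.2)%:R) *
  ((v == tag z)%:R * (p.2 == z)%:R))).
rewrite sum_simple (@sum_only _ _ _ z) => [|j /negPf jz]; last first.
  by rewrite big1 // => ? _; rewrite /= jz !mulr0.
rewrite /= (@sum_fusion1 _ _ _ _ (tag z)) => [|u /negPf ui]; last first.
  by rewrite ui mul0r mulr0.
by rewrite fusion0l !eqxx !mul1r !mulr1.
Qed.

Lemma entry_FS_core_head X Z (f : homTY (@ty_unit A) (ty_tens X Z)) i w :
  entry (ty_comp (ty_comp (ty_runit_inv R (ty_dual X)) (ty_tensm (ty_id R (ty_dual X)) f))
    (ty_assoc_inv chi tau (ty_dual X) X Z)) i w =
  (tag w == tag i)%:R * (((factors (factors w).1).1 == i)%:R *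
  ty_assoc_inv_coef chi tau (tag i) (tag (factors (factors w).1).2) (tag (factors w).2)
     (tag i) (tag (factors w).1) (Some 0)) *
  \sum_k entry f o0 k * (factors k == ((factors (factors w).1).2, (factors w).2))%:R.
Proof.
rewrite entry_comp.
under eq_bigr do rewrite entry_unit_tensor entry_ty_assoc_inv assoc_entryE.
apply: etrans.
  apply: (sum_tens (fun v p => (tag i == v)%:R * ((i == p.1)%:R * entry f o0 p.2) *
    ((tag w == v)%:R *
  (((factors (factors w).1).1 == p.1)%:R *
   (((factors (factors w).1).2 == (factors p.2).1)%:R *
    ((factors w).2 == (factors p.2).2)%:R) *
   ty_assoc_inv_coef chi tau (tag (factors (factors w).1).1)
     (tag (factors (factors w).1).2) (tag (factors w).2) (tag w)
     (tag (factors w).1) (tag p.2))))).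
rewrite (@sum_only _ _ _ i) => [|j /negPf ji]; last first.
  by rewrite big1 // => ? _; rewrite big1 // => ? _; rewrite /= [i == _]eq_sym ji mul0r mulr0 mul0r.
rewrite mulr_sumr; apply: eq_bigr => k _.
rewrite (@sum_fusion1 _ _ _ _ (tag i)) /= => [|u /negPf ui]; last first.
  by rewrite eq_sym ui !mul0r.
case: (eqVneq (tag o0) (tag k)) => [<-|k0]; last first.
  by rewrite (entry_tag f k0) !(mulr0, mul0r).
rewrite /= fusion0r !eqxx !mul1r.
rewrite (surjective_pairing (factors k)) xpair_eqE [(factors k).1 == _]eq_sym [(factors k).2 == _]eq_sym.
case: (eqVneq (tag w) (tag i)) => [->|]; last by rewrite !(mulr0, mul0r).
case: (eqVneq (factors (factors w).1).1 i) => [->|]; last by rewrite !(mulr0, mul0r).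
by rewrite -mulnb natrM; ring.
Qed.

(** The evaluation admits only the trivial channel between the dual leg and X, and picks out the
    summand of X dual to i; this fixes all labels in the associator coefficient. *)
Lemma entry_FS_core X Z (f : homTY (@ty_unit A) (ty_tens X Z)) i z :
  entry (FS_core f) i z = (tag i == tag z)%:R *
   (ev_coef (ty_dual_label (tag i)) * ty_assoc_inv_coef chi tau (tag i)
     (ty_dual_label (tag i)) (tag i) (tag i) (Some 0) (Some 0)) *
   \sum_k entry f o0 k * (factors k == (undual i, z))%:R.
Proof.
rewrite /FS_core entry_comp.
under eq_bigr do rewrite entry_FS_core_head entry_ev_lunit.
apply: etrans.
  apply: (sum_tens (fun v p => (v == tag i)%:R *
  (((factors p.1).1 == i)%:R *
   ty_assoc_inv_coef chi tau (tag i) (tag (factors p.1).2)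
     (tag p.2) (tag i) (tag p.1) (Some 0)) *
  (\sum_k
      entry f o0 k *
      (factors k == ((factors p.1).2, p.2))%:R) *
  ((v == tag z)%:R *
   ((tag p.1 == Some 0)%:R *
    ((undual (factors p.1).1 == (factors p.1).2)%:R *
     ev_coef (tag (factors p.1).2)) *
    (p.2 == z)%:R)))).
under eq_bigr => w1 _.
  rewrite (@sum_only _ _ _ z) => [|j /negPf jz]; last first.
    by rewrite big1 // => ? _; rewrite /= jz !mulr0.
  rewrite (@sum_fusion1 _ _ _ _ (tag z)) /= => [|u /negPf ui]; last first.
    by rewrite ui mul0r mulr0.
  over.
rewrite /=; apply: etrans.
  apply: (sum_tens (fun v p => (ty_fusion v (tag z) (tag z))%:R *
  ((tag z == tag i)%:R *
   ((p.1 == i)%:R *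
    ty_assoc_inv_coef chi tau (tag i) (tag p.2) (tag z)
      (tag i) v (Some 0)) *
   (\sum_k entry f o0 k * (factors k == (p.2, z))%:R) *
   ((tag z == tag z)%:R *
    ((v == Some 0)%:R *
     ((undual p.1 == p.2)%:R *
      ev_coef (tag p.2)) * (z == z)%:R))))).
rewrite (@sum_only _ _ _ i) => [|j /negPf ji]; last first.
  by rewrite big1 // => ? _; rewrite big1 // => ? _; rewrite /= ji !(mul0r, mulr0).
rewrite (@sum_only _ _ _ (undual i)) => [|j /negPf ji]; last first.
  by rewrite big1 // => ? _; rewrite /= [_ == j]eq_sym ji !(mul0r, mulr0).
rewrite (@sum_fusion1 _ _ _ _ (Some 0)) /= => [|u /negPf ui]; last first.
  by rewrite ui !(mul0r, mulr0).
rewrite fusion_dual dual_labelK fusion0l !eqxx !mul1r [tag z == _]eq_sym.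
case: (eqVneq (tag i) (tag z)) => [->|]; last by rewrite !mul0r.
by rewrite !(mul1r, mulr1); ring.
Qed.

(** The scalar acquired by a summand of label s when it is moved from the first to the last factor:
    evaluation, inverse associator at the trivial channel, inverse pivotal structure. *)
Definition FS_coef s : R[i] := ev_coef s * ty_assoc_inv_coef chi tau (ty_dual_label s)
  s (ty_dual_label s) (ty_dual_label s) (Some 0) (Some 0) * ty_piv_coef tau s.

(** Up to the final rebracketing the indicator operator is a cyclic rotation: the component at (x,
    z) becomes the component at (z, x), times the scalar of x. *)
Lemma entry_FS_rotate X Z (f : homTY (@ty_unit A) (ty_tens X Z)) (q : summand (ty_tens Z X)) :
  entry (ty_comp (ty_db R (ty_dual X)) (ty_tensm (FS_core f) (ty_piv_inv tau X))) o0 q =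
  (tag q == Some 0)%:R * FS_coef (tag (factors q).2) *
  \sum_k entry f o0 k * (factors k == ((factors q).2, (factors q).1))%:R.
Proof.
rewrite entry_comp.
have dbE (p : summand (ty_tens (ty_dual X) (ty_dual (ty_dual X)))) :
    entry (ty_db R (ty_dual X)) o0 p =
    (tag p == Some 0)%:R * ((factors p).1 == undual (factors p).2)%:R.
  by rewrite entry_of_entries eq_sym; case: eqP; rewrite ?mul1r ?mul0r.
have pivE j i : entry (ty_piv_inv tau X) j i =
    (j == codual (codual i))%:R * ty_piv_coef tau (tag i).
  rewrite entry_of_entries -(can_eq (@undualK A _)) -(can_eq (@undualK A X)) codualK codualK.
  rewrite [undual (undual j) == i]eq_sym.
  case: (i =P undual (undual j)) => [->|_]; last by rewrite !mul0r if_same.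
  by rewrite !tag_undual dual_labelK eqxx !mul1r.
under eq_bigr do rewrite dbE entry_tensm pivE.
apply: etrans.
  apply: (sum_tens (fun v p => (v == Some 0)%:R *
  (p.1 == undual p.2)%:R *
  ((v == tag q)%:R *
   (entry (FS_core f) p.1 (factors q).1 *
    ((p.2 == codual (codual (factors q).2))%:R *
     ty_piv_coef tau (tag (factors q).2)))))).
rewrite exchange_big (@sum_only _ _ _ (codual (codual (factors q).2))) /=; last first.
  move=> j /negPf ji; rewrite big1 // => ? _; rewrite big1 // => ? _.
  by rewrite /= ji !(mul0r, mulr0).
rewrite (@sum_only _ _ _ (codual (factors q).2)) => [|j /negPf ji]; last first.
  by rewrite big1 // => ? _; rewrite /= codualK ji !(mul0r, mulr0).
rewrite (@sum_fusion1 _ _ _ _ (Some 0)) /= => [|u /negPf ui]; last first.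
  by rewrite ui !(mul0r, mulr0).
rewrite fusion_dual codualK !eqxx !mul1r dual_labelK eqxx mul1r [Some 0 == _]eq_sym.
case: (eqVneq (tag q) (Some 0)) => [q0|]; last by rewrite !mul0r.
have := factors_fusion q; rewrite q0 fusion_dual => /eqP tq.
rewrite entry_FS_core codualK /= dual_labelK -tq eqxx !mul1r /FS_coef -tq.
by ring.
Qed.

Lemma ty_compA X Y Z W (f : homTY X Y) (g : homTY Y Z) (h : homTY Z W) :
  ty_comp f (ty_comp g h) = ty_comp (ty_comp f g) h.
Proof.
apply: hom_eqP => i k; rewrite !entry_comp.
under eq_bigr do rewrite entry_comp mulr_sumr.
under [RHS]eq_bigr do rewrite entry_comp mulr_suml.
by rewrite exchange_big; do 2![apply: eq_bigr => ? _]; rewrite mulrA.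
Qed.

Lemma ty_comp1f X Y (f : homTY X Y) : ty_comp (ty_id R X) f = f.
Proof.
apply: hom_eqP => i k; rewrite entry_comp (@sum_only _ _ _ i) => [|j /negPf ji].
  by rewrite entry_id eqxx mul1r.
by rewrite entry_id eq_sym ji mul0r.
Qed.

Lemma ty_compf1 X Y (f : homTY X Y) : ty_comp f (ty_id R Y) = f.
Proof.
apply: hom_eqP => i k; rewrite entry_comp (@sum_only _ _ _ k) => [|j /negPf ji].
  by rewrite entry_id eqxx mulr1.
by rewrite entry_id ji mulr0.
Qed.

Local Notation T X n := (@tpow_assoc _ C X n).

Lemma FS_operatorE X n (f : homTY (@ty_unit A) (ty_tens X (@tpow _ C X n))) :
  @FS_operator _ C X n f =
  ty_comp (ty_comp (ty_db R (ty_dual X)) (ty_tensm (FS_core f) (ty_piv_inv tau X))) (T X n).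
Proof.
rewrite /FS_operator /=; congr ty_comp.
by rewrite -!ty_compA !ty_tensm_comp ty_comp1f ty_compf1 /FS_core -!ty_compA.
Qed.

Lemma entry_FS_operator X n f (k : summand (@tpow _ C X n.+1)) :
  entry (@FS_operator _ C X n f) o0 k = (tag k == Some 0)%:R *
    \sum_j entry f o0 j * \sum_(q : summand (ty_tens (@tpow _ C X n) X))
      (tag q == Some 0)%:R * (factors j == ((factors q).2, (factors q).1))%:R *
      FS_coef (tag (factors q).2) * entry (T X n) q k.
Proof.
rewrite FS_operatorE entry_comp; under eq_bigr do rewrite entry_FS_rotate.
case: (eqVneq (tag k) (Some 0)) => [k0|k0]; last first.
  rewrite mul0r big1 // => q _; case: (eqVneq (tag q) (Some 0)) => [q0|]; last by rewrite !mul0r.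
  by rewrite (entry_tag (T X n)) ?mulr0 // q0 eq_sym.
under [in RHS]eq_bigr do rewrite mulr_sumr.
rewrite mul1r [RHS]exchange_big /=; apply: eq_bigr => q _.
by rewrite mulr_sumr mulr_suml; apply: eq_bigr => j _; ring.
Qed.

Lemma FS_indicatorE X n : @FS_indicator _ C n.+1 X =
  \sum_(q : summand (ty_tens (@tpow _ C X n) X)) \sum_(k : summand (@tpow _ C X n.+1))
    (tag q == Some 0)%:R * (tag k == Some 0)%:R * (factors k == ((factors q).2, (factors q).1))%:R *
      FS_coef (tag (factors q).2) * entry (T X n) q k.
Proof.
rewrite /FS_indicator.
rewrite (trace_unit_hom (Y := @tpow _ C X n.+1) (M := fun j k =>
  \sum_(q : summand (ty_tens (@tpow _ C X n) X))
      (tag q == Some 0)%:R * (factors j == ((factors q).2, (factors q).1))%:R *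
      FS_coef (tag (factors q).2) * entry (T X n) q k)); last first.
  by move=> f o k; rewrite (simple_summandP o) entry_FS_operator.
rewrite big_mkcond [RHS]exchange_big /=; apply: eq_bigr => k _.
case: ifP => _; last by rewrite big1 // => q _; rewrite mulr0 !mul0r.
by apply: eq_bigr => q _; rewrite mulr1.
Qed.

Lemma entry_tpow_assoc0 X q k :
  entry (T X 0) q k = (tag q == tag k)%:R * ((factors q).2 == (factors k).1)%:R.
Proof.
rewrite /= entry_comp; under eq_bigr do rewrite entry_lunit entry_runit_inv.
rewrite (@sum_only _ _ _ (factors q).2) => [|j /negPf ji]; last first.
  by rewrite [_ == j]eq_sym ji mulr0 mul0r.
have := factors_fusion q; rewrite tag_simple fusion0l => /eqP <-.
by rewrite !eqxx !mul1r [_ == (factors q).2]eq_sym.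
Qed.

Lemma entry_tpow_assocS X n q k :
  entry (T X n.+1) q k = \sum_(r : summand (ty_tens (@tpow _ C X n) X))
    (tag q == tag k)%:R * ((factors (factors q).1).1 == (factors k).1)%:R *
    (((factors (factors q).1).2 == (factors r).1)%:R * ((factors q).2 == (factors r).2)%:R) *
    (ty_fusion (tag (factors k).1) (tag r) (tag q))%:R *
    ty_assoc_coef chi tau (tag (factors (factors q).1).1) (tag (factors (factors q).1).2)
      (tag (factors q).2) (tag q) (tag (factors q).1) (tag r) *
    entry (T X n) r (factors k).2.
Proof.
rewrite [T X n.+1]/= entry_comp.
under eq_bigr do rewrite entry_ty_assoc assoc_entryE entry_tensm entry_id.
apply: etrans.
  apply: (sum_tens (fun v p => (tag q == v)%:R *
  (((factors (factors q).1).1 == p.1)%:R *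
   (((factors (factors q).1).2 == (factors p.2).1)%:R *
    ((factors q).2 == (factors p.2).2)%:R) *
   ty_assoc_coef chi tau (tag (factors (factors q).1).1)
     (tag (factors (factors q).1).2) (tag (factors q).2)
     (tag q) (tag (factors q).1) (tag p.2)) *
  ((v == tag k)%:R *
   ((p.1 == (factors k).1)%:R * entry (T X n) p.2 (factors k).2)))).
rewrite (@sum_only _ _ _ (factors k).1) => [|j /negPf ji]; last first.
  by rewrite big1 // => ? _; rewrite big1 // => ? _; rewrite /= ji !(mul0r, mulr0).
apply: eq_bigr => r _.
rewrite (@sum_fusion1 _ _ _ _ (tag q)) /= => [|u /negPf ui]; last first.
  by rewrite eq_sym ui !mul0r.
by rewrite !eqxx !mul1r; ring.
Qed.

(** Rebracketing followed by rotation, traced over the words in which the rotated letter is x. The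
    indicator has total label v = 0; general v is needed because the recursion passes to inner
    powers, whose label w then becomes the total one. *)
Definition FS_loop X n x v w : R[i] :=
  \sum_(q : summand (ty_tens (@tpow _ C X n) X)) \sum_(k : summand (@tpow _ C X n.+1))
    (tag q == v)%:R * (tag k == v)%:R * (factors k == (x, (factors q).1))%:R *
    ((factors q).2 == x)%:R * (tag (factors q).1 == w)%:R * entry (T X n) q k.

Arguments FS_loop X n x v w : clear implicits.

(* The part of the partial trace of Phi^(n+1) with total label v in which the power X^n carries the
   label w, for a single summand of X with label s: Phi^(n+1) has to match a word in the summands of X
   with its cyclic rotation, so only constant words contribute. *)
Fixpoint FS_label n s v w : R[i] :=
  if n is n'.+1 then (ty_fusion s w v)%:R * (ty_fusion w s v)%:R *
    \sum_l ty_assoc_coef chi tau s l s v w w * FS_label n' s w l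
  else (w == Some 0)%:R * (v == s)%:R.

(** One step of the rebracketing exposes one more letter, which the trace identifies with x. What
    remains is a loop on the next smaller power with total label w, weighted by one associator
    coefficient. *)
Lemma FS_loop_label X n x v w : FS_loop X n x v w = FS_label n (tag x) v w.
Proof.
elim: n v w => [|n IHn] v w.
  rewrite /FS_loop /=; under eq_bigr do under eq_bigr do rewrite entry_tpow_assoc0.
  apply: etrans.
    apply: (sum_tens (fun u p => \sum_(k : summand (@tpow _ C X 1))
     (u == v)%:R * (tag k == v)%:R * (factors k == (x, p.1))%:R * (p.2 == x)%:R * (tag p.1 == w)%:R *
     ((u == tag k)%:R * (p.2 == (factors k).1)%:R))).
  rewrite sum_simple (@sum_only _ _ _ x) => [|j /negPf ji]; last first.
    by rewrite big1 // => ? _; rewrite big1 // => ? _; rewrite /= ji !(mul0r, mulr0).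
  rewrite (@sum_fusion1 _ _ _ _ v) /= => [|u /negPf ui]; last first.
    by rewrite big1 // => ? _; rewrite ui !mul0r.
  rewrite fusion0l !eqxx.
  apply: etrans.
    apply: (congr1 (fun z => _ * z)).
    apply: (sum_tens (fun u p => true%:R * (u == v)%:R * (p == (x, o0))%:R *
     true%:R * (Some 0 == w)%:R * ((v == u)%:R * (x == p.1)%:R))).
  rewrite (@sum_only _ _ _ x) => [|j /negPf ji]; last first.
    by rewrite big1 // => ? _; rewrite big1 // => ? _; rewrite xpair_eqE /= ji !(mul0r, mulr0).
  rewrite sum_simple (@sum_fusion1 _ _ _ _ v) /= => [|u /negPf ui]; last first.
    by rewrite ui !(mul0r, mulr0).
  rewrite fusion0r !eqxx !mul1r !mulr1 [Some 0 == w]eq_sym.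
  by case: (v == tag x); rewrite ?mulr0 ?mulr1 ?mul1r ?mul0r.
rewrite /FS_loop; under eq_bigr do under eq_bigr do rewrite entry_tpow_assocS.
apply: etrans.
  apply: (sum_tens (fun u p => \sum_(k : summand (@tpow _ C X n.+2))
    (u == v)%:R * (tag k == v)%:R * (factors k == (x, p.1))%:R *
    (p.2 == x)%:R * (tag p.1 == w)%:R *
     (\sum_(r : summand (ty_tens (@tpow _ C X n) X))
    (u == tag k)%:R * ((factors p.1).1 == (factors k).1)%:R *
    (((factors p.1).2 == (factors r).1)%:R * (p.2 == (factors r).2)%:R) *
    (ty_fusion (tag (factors k).1) (tag r) u)%:R *
    ty_assoc_coef chi tau (tag (factors p.1).1) (tag (factors p.1).2)
      (tag p.2) u (tag p.1) (tag r) *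
    entry (T X n) r (factors k).2))).
under eq_bigr => q1 _.
  rewrite (@sum_only _ _ _ x) => [|j /negPf ji]; last first.
    by rewrite big1 // => ? _; rewrite big1 // => ? _; rewrite /= ji !(mul0r, mulr0).
  rewrite (@sum_fusion1 _ _ _ _ v) /= => [|u /negPf ui]; last first.
    by rewrite big1 // => ? _; rewrite ui !mul0r.
  rewrite [X in _ * X](_ : _ = (ty_fusion (tag x) w v)%:R * ((tag q1 == w)%:R *
     \sum_(r : summand (ty_tens (@tpow _ C X n) X)) ((factors q1).1 == x)%:R *
    (((factors q1).2 == (factors r).1)%:R * (x == (factors r).2)%:R) *
    (ty_fusion (tag x) (tag r) v)%:R *
    ty_assoc_coef chi tau (tag (factors q1).1) (tag (factors q1).2)
      (tag x) v (tag q1) (tag r) * entry (T X n) r q1)); last first.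
    apply: etrans.
      apply: (sum_tens (fun u p => (v == v)%:R * (u == v)%:R * (p == (x, q1))%:R *
      (x == x)%:R * (tag q1 == w)%:R *
      (\sum_(r : summand (ty_tens (@tpow _ C X n) X))
      (v == u)%:R * ((factors q1).1 == p.1)%:R *
      (((factors q1).2 == (factors r).1)%:R * (x == (factors r).2)%:R) *
      (ty_fusion (tag p.1) (tag r) v)%:R *
      ty_assoc_coef chi tau (tag (factors q1).1) (tag (factors q1).2)
        (tag x) v (tag q1) (tag r) *
      entry (T X n) r p.2))).
    rewrite (@sum_only _ _ _ x) => [|j /negPf ji]; last first.
      by rewrite big1 // => ? _; rewrite big1 // => ? _; rewrite xpair_eqE /= ji !(mul0r, mulr0).
    rewrite (@sum_only _ _ _ q1) => [|j /negPf ji]; last first.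
      by rewrite big1 // => ? _; rewrite xpair_eqE /= ji andbF !(mul0r, mulr0).
    rewrite (@sum_fusion1 _ _ _ _ v) /= => [|u /negPf ui]; last first.
      by rewrite ui !(mul0r, mulr0).
    rewrite !eqxx !mul1r.
    case: (eqVneq (tag q1) w) => [->|_]; last by rewrite !mul0r !mulr0.
    rewrite !mul1r; congr (_ * _); apply: eq_bigr => r _; by rewrite !mul1r.
  over.
rewrite /= -/(FS_loop X n x w) !mulr_sumr.
under [RHS]eq_bigr do rewrite -IHn /FS_loop !mulr_sumr.
rewrite [RHS]exchange_big /=.
under [RHS]eq_bigr do under eq_bigr do rewrite !mulr_sumr.
under [RHS]eq_bigr do rewrite exchange_big.
rewrite [RHS]exchange_big /=; apply: eq_bigr => q1 _.
rewrite !mulr_sumr; apply: eq_bigr => r _.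
rewrite (@sum_only _ _ _ (tag (factors r).1)) => [|l /negPf li]; last first.
  by rewrite [_ == l]eq_sym li !(mul0r, mulr0).
rewrite eqxx mulr1.
case: (eqVneq (tag q1) w) => [qw|_]; last by rewrite !(mul0r, mulr0).
case: (eqVneq (tag r) w) => [rw|rw]; last first.
  by rewrite (entry_tag (T X n)) ?qw // !(mul0r, mulr0).
rewrite rw qw [x == (factors r).2]eq_sym [in RHS](surjective_pairing (factors q1)) xpair_eqE.
case: (eqVneq (factors q1).1 x) => [->|_]; last by rewrite !(mul0r, mulr0).
case: (eqVneq (factors q1).2 (factors r).1) => [->|_]; last by rewrite !(mul0r, mulr0).
case: (ty_fusion (tag x) w v); last by rewrite !(mul0r, mulr0).
by rewrite /= !(mul1r, mulr1); ring.
Qed.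

Lemma FS_indicator_sum X n : @FS_indicator _ C n.+1 X =
  \sum_(x : summand X) FS_coef (tag x) * \sum_w FS_label n (tag x) (Some 0) w.
Proof.
rewrite FS_indicatorE.
under [RHS]eq_bigr do under eq_bigr do rewrite -FS_loop_label /FS_loop.
under [RHS]eq_bigr => x _.
  rewrite exchange_big /= mulr_sumr; under eq_bigr => q _.
    rewrite exchange_big /= mulr_sumr; under eq_bigr => k _.
      rewrite (@sum_only _ _ _ (tag (factors q).1)) => [|l /negPf li]; last first.
        by rewrite [_ == l]eq_sym li !(mul0r, mulr0).
      over.
    over.
  over.
rewrite [RHS]exchange_big /=; apply: eq_bigr => q _.
rewrite [RHS]exchange_big /=; apply: eq_bigr => k _.
rewrite (@sum_only _ _ _ (factors q).2) => [|x /negPf xi]; last first.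
  by rewrite [_ == x]eq_sym xi !(mul0r, mulr0).
by rewrite !eqxx !mulr1; ring.
Qed.

End Operator.

(** * Pivotal dimensions as sums over summands *)

Section PivotalDimension.
Variables (R : realType) (A : finZmodType) (chi : A -> A -> R[i]) (tau : R).
Local Notation C := (TY chi tau).
Implicit Types (X Y Z : ty_obj A) (s t u v : ty_label A).
Local Notation homTY := (ty_hom R).
Local Notation o0 := (simple_summand (Some (0 : A))).

Lemma unit_scalarE (f : homTY (@ty_unit A) (@ty_unit A)) :
  @unit_scalar _ C f = entry f o0 o0.
Proof.
rewrite /unit_scalar /=.
have -> : f = entry f o0 o0 *: ty_id R (@ty_unit A).
  apply: hom_eqP => i j; rewrite (simple_summandP i) (simple_summandP j).
  by rewrite entryZ entry_id eqxx mulr1.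
have free1 : free [tuple ty_id R (@ty_unit A)].
  rewrite seq1_free; apply/eqP => /(congr1 (fun f => entry f o0 o0)).
  by rewrite entry0 entry_id eqxx => /eqP; rewrite oner_eq0.
rewrite linearZ /= entryZ entry_id; congr (_ * _).
by apply: etrans (coord_free ord0 ord0 free1) _; rewrite !eqxx.
Qed.

Lemma pivotal_dim_sum X : @pivotal_dim _ C X =
  \sum_(x : summand X) ev_coef tau (tag x) * ty_piv_coef tau (tag x).
Proof.
rewrite /pivotal_dim unit_scalarE /= entry_comp.
have dbE (p : summand (ty_tens X (ty_dual X))) :
    entry (ty_db R X) o0 p =
    (tag p == Some 0)%:R * ((factors p).1 == undual (factors p).2)%:R.
  by rewrite entry_of_entries eq_sym; case: eqP; rewrite ?mul1r ?mul0r.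
have evE (h : summand (ty_tens (ty_dual (ty_dual X)) (ty_dual X))) :
   entry (ty_ev tau (ty_dual X)) h o0 =
   (tag h == Some 0)%:R * ((undual (factors h).1 == (factors h).2)%:R *
   ev_coef tau (tag (factors h).2)).
  rewrite entry_of_entries /ev_coef.
  by case: eqP; rewrite ?mul1r ?mul0r //; case: eqP; rewrite ?mul1r ?mul0r.
have pivE i (j : summand (ty_dual (ty_dual X))) : entry (ty_piv tau X) i j =
    (i == undual (undual j))%:R * ty_piv_coef tau (tag i).
  rewrite entry_of_entries.
  case: (i =P undual (undual j)) => [->|_]; last by rewrite !mul0r if_same.
  by rewrite !tag_undual dual_labelK eqxx.
have E r : entry (ty_comp (ty_db R X) (ty_tensm (ty_piv tau X) (ty_id R (ty_dual X)))) o0 r =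
    (tag r == Some 0)%:R * entry (ty_piv tau X) (undual (factors r).2) (factors r).1.
  rewrite entry_comp; under eq_bigr do rewrite dbE entry_tensm entry_id.
  apply: etrans.
    apply: (sum_tens (fun u p => (u == Some 0)%:R * (p.1 == undual p.2)%:R *
      ((u == tag r)%:R * (entry (ty_piv tau X) p.1 (factors r).1 * (p.2 == (factors r).2)%:R)))).
  rewrite exchange_big (@sum_only _ _ _ (factors r).2) /= => [|j /negPf ji]; last first.
    by rewrite big1 // => ? _; rewrite big1 // => ? _; rewrite ji !mulr0.
  rewrite (@sum_only _ _ _ (undual (factors r).2)) => [|j /negPf ji]; last first.
    by rewrite big1 // => ? _; rewrite /= ji mulr0 mul0r.
  rewrite (@sum_fusion1 _ _ _ _ (Some 0)) => [|u /negPf ui]; last first.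
    by rewrite ui !mul0r.
  by rewrite fusion_dual tag_undual !eqxx [Some 0 == _]eq_sym !mul1r mulr1.
apply: etrans.
  apply: eq_bigr => r _; apply: congr2 (E r) (evE r).
under eq_bigr do rewrite pivE.
apply: etrans.
  apply: (sum_tens (fun u p => (u == Some 0)%:R *
  ((undual p.2 == undual (undual p.1))%:R * ty_piv_coef tau (tag (undual p.2))) *
  ((u == Some 0)%:R * ((undual p.1 == p.2)%:R * ev_coef tau (tag p.2))))).
(* The evaluation runs over the summands of the double dual, which are the double duals of those of
   X. *)
rewrite (reindex (fun x : summand X => codual (codual x))) /=; last first.
  exists (fun y => undual (undual y)) => [y|y] _; first by rewrite !codualK.
  by rewrite !undualK.
apply: eq_bigr => x _.
rewrite (@sum_only _ _ _ (codual x)) => [|j /negPf ji]; last first.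
  by rewrite big1 // => ? _; rewrite codualK [_ == j]eq_sym ji !(mul0r, mulr0).
rewrite (@sum_fusion1 _ _ _ _ (Some 0)) => [|u /negPf ui]; last first.
  by rewrite ui !mul0r.
rewrite /= fusion_dual !codualK !eqxx dual_labelK !mul1r mulrC.
by case: (tag x).
Qed.
End PivotalDimension.

(** * Indicators of the simple objects *)

Section Evaluation.
Variables (R : realType) (A : finZmodType) (chi : A -> A -> R[i]) (tau : R).
Local Notation C := (TY chi tau).
(** A quadratic refinement of [chi]: an even function whose failure to be a character is exactly
    [chi]. *)
Variable h : A -> R[i].
Hypothesis h0 : h 0 = 1.
Hypothesis h_neq0 : forall a, h a != 0.
Hypothesis hN : forall a, h (- a) = h a.
Hypothesis hD : forall a b, h (a + b) = h a * h b * chi a b.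
Hypothesis chiD : forall a b c, chi a (b + c) = chi a b * chi a c.
Hypothesis chi_orth : forall a, \sum_b chi a b = if a == 0 then #|A|%:R else 0.
Hypothesis tau_neq0 : tau != 0.

Let gauss_bar := \sum_c (h c)^-1.

Lemma chiC a b : chi a b = chi b a.
Proof.
have := hD a b; rewrite addrC hD [h b * h a]mulrC.
by move/(mulfI (mulf_neq0 (h_neq0 a) (h_neq0 b))).
Qed.

Lemma chi0r a : chi a 0 = 1.
Proof.
have := hD a 0; rewrite addr0 h0 mulr1 -[LHS]mulr1.
by move/(mulfI (h_neq0 a)).
Qed.

(** Refining a + (-a) = 0 gives 1 = h(a)^2 chi(a,-a), because h is even. *)
Lemma chi_sqr a : chi a a = h a ^+ 2.
Proof.
have E : chi a a * chi a (- a) = 1 by rewrite -chiD subrr chi0r.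
have := hD a (- a); rewrite subrr h0 hN => E'.
apply: (mulIf (_ : chi a (- a) != 0)); last by rewrite E expr2 -E'.
by apply/eqP => c0; move/eqP: E; rewrite c0 mulr0 eq_sym oner_eq0.
Qed.

Lemma FS_coef_group a : FS_coef chi tau (Some a) = 1.
Proof. by rewrite /FS_coef /= !mulr1. Qed.

Lemma FS_coef_m : FS_coef chi tau None = (Num.sg tau)%:C.
Proof.
rewrite /FS_coef /= chi0r mulr1 mulVf ?mul1r //.
by rewrite -(rmorph0 (real_complex R)) (inj_eq (fmorph_inj _)).
Qed.

(** All labels are forced and all associators are trivial, so the loop only tests whether the power
    has the required label. *)
Lemma FS_label_group n a b :
  \sum_w FS_label chi tau n (Some a) (Some b) w = (b == a *+ n.+1)%:R.
Proof.
elim: n b => [|n IHn] b /=.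
  rewrite (@sum_only _ _ _ (Some 0)) => [|w /negPf ->]; last by rewrite mul0r.
  by rewrite eqxx mul1r mulr1n.
rewrite (@sum_only _ _ _ (Some (b - a))) => [|w wb]; last first.
  case: w wb => [w|] wb; last by rewrite /ty_fusion !mul0r.
  rewrite {1}/ty_fusion (_ : b == a + w = false) ?mul0r //.
  by apply: contraNF wb => /eqP->; rewrite addrC addKr.
rewrite /ty_fusion subrK [a + _]addrC subrK eqxx !mul1r.
transitivity (\sum_l FS_label chi tau n (Some a) (Some (b - a)) l).
  apply: eq_bigr => -[c|] _; first by rewrite mul1r.
  by case: n {IHn} => [|n] /=; rewrite ?{1}/ty_fusion !(mul0r, mulr0).
by rewrite IHn subr_eq -mulrSr.
Qed.

Lemma FS_indicator_group n a :
  FS_coef chi tau (Some a) * \sum_w FS_label chi tau n (Some a) (Some 0) w =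
  (a *+ n.+1 == 0)%:R.
Proof. by rewrite FS_coef_group mul1r FS_label_group eq_sym. Qed.

Lemma FS_label_mm n : FS_label chi tau n None None None = 0.
Proof. by case: n => [|n] /=; rewrite ?/ty_fusion !mul0r. Qed.

Lemma FS_label_mgg n b c : FS_label chi tau n None (Some b) (Some c) = 0.
Proof. by case: n => [|n] /=; rewrite ?/ty_fusion !(mulr0, mul0r). Qed.

(** Powers of m are alternately m itself and sums of group elements. The passage through Phi_{m,m,m}
    contributes its diagonal entry at b; the next one, through Phi_{m,a,m}, contributes a transform
    with kernel chi. *)
Lemma FS_label_mS n b : FS_label chi tau n.+1 None None (Some b) =
  tau%:C * (chi b b)^-1 * FS_label chi tau n None (Some b) None.
Proof.
rewrite /= (@sum_only _ _ _ None) => [|[c|] //]; last by rewrite FS_label_mgg mulr0.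
by rewrite !mul1r.
Qed.

Lemma FS_label_gS n b : FS_label chi tau n.+1 None (Some b) None =
  \sum_a chi a b * FS_label chi tau n None None (Some a).
Proof.
by rewrite /= !mul1r sum_option FS_label_mm mulr0 add0r.
Qed.

Lemma FS_label_m_even j b : FS_label chi tau j.*2 None (Some b) None = 0.
Proof.
elim: j b => [|j IHj] b; first by rewrite /= mul0r.
by rewrite doubleS FS_label_gS big1 // => a _; rewrite FS_label_mS IHj !mulr0.
Qed.

Lemma chi_neq0 a b : chi a b != 0.
Proof.
apply/eqP => c0; have := chi0r a; rewrite -(subrr b) chiD c0 mul0r => /eqP.
by rewrite eq_sym oner_eq0.
Qed.

(** Completing the square: replacing c by y + c turns the summand into h(c)^-1 h(y). *)
Lemma sum_gauss_shift y : \sum_c (h c)^-1 * chi c y = gauss_bar * h y.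
Proof.
rewrite /gauss_bar mulr_suml [LHS](reindex_inj (addrI y)) /=.
apply: eq_bigr => c _; rewrite [chi (y + c) y]chiC chiD hD chi_sqr.
by field; rewrite !h_neq0 chi_neq0.
Qed.

Lemma card_neq0 : #|A|%:R != 0 :> R[i].
Proof. by rewrite pnatr_eq0 -lt0n; apply/card_gt0P; exists 0. Qed.

(* In the Fourier transformed variable y, two steps multiply by tau * gauss_bar * h y. *)
Lemma FS_label_m_odd j b : FS_label chi tau j.*2.+1 None (Some b) None =
  h b * (tau%:C ^+ j * #|A|%:R^-1 * \sum_y chi b y * (gauss_bar * h y) ^+ j.+1).
Proof.
elim: j b => [|j IHj] b.
  rewrite double0 FS_label_gS (@sum_only _ _ _ 0) => [|a a0]; last first.
    by rewrite /= (_ : Some a == Some 0 = false) ?mul0r ?mulr0 //; apply: negbTE.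
  rewrite /= !eqxx !mulr1 chiC chi0r expr0 mul1r.
  (* Fourier inversion: once [gauss_bar] times h(y) is expanded, the sum over y keeps only c =
     -b. *)
  under eq_bigr do rewrite expr1 -sum_gauss_shift mulr_sumr.
  rewrite exchange_big /= (@sum_only _ _ _ (- b)) => [|c cb]; last first.
    transitivity ((h c)^-1 * \sum_y chi (c + b) y); last first.
      by rewrite chi_orth addr_eq0 (negPf cb) mulr0.
    rewrite mulr_sumr; apply: eq_bigr => y _.
    by rewrite [chi (c + b) y]chiC chiD ![chi y _]chiC; ring.
  transitivity (h b * (#|A|%:R^-1 * ((h b)^-1 * \sum_y chi 0 y))).
    by rewrite chi_orth eqxx; field; rewrite h_neq0 card_neq0.
  congr (_ * (_ * _)); rewrite mulr_sumr; apply: eq_bigr => y _.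
  by rewrite hN mulrCA [chi b y]chiC [chi (- b) y]chiC -chiD subrr [chi 0 y]chiC.
rewrite doubleS FS_label_gS.
transitivity (\sum_a h b * (tau%:C ^+ j.+1 * #|A|%:R^-1) * ((h (b - a))^-1 *
    \sum_y chi a y * (gauss_bar * h y) ^+ j.+1)).
  apply: eq_bigr => a _; rewrite FS_label_mS IHj.
  (* With this identity the kernel chi(a,b) chi(a,a)^-1, multiplied by the factor h(a) of the
     induction hypothesis, becomes h(b) / h(b - a): a convolution with h^-1. *)
  have E : h (b - a) * chi a b = h b * h a.
    by rewrite hD hN [chi a b]chiC -!mulrA -chiD addNr chi0r mulr1.
  have -> : chi a b = h b * h a / h (b - a) by rewrite -E; field.
  rewrite chi_sqr [tau%:C ^+ j.+1]exprS; move: (\sum_y _) => S.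
  by field; rewrite !h_neq0 card_neq0.
rewrite -mulr_sumr -mulrA; congr (_ * _); congr (_ * _).
rewrite (reindex_inj (addrI b)) /=.
under eq_bigr do rewrite mulr_sumr.
rewrite exchange_big; apply: eq_bigr => y _ /=.
rewrite [in RHS]exprS [in RHS]mulrA -[X in _ = _ * X * _]sum_gauss_shift.
rewrite mulr_sumr mulr_suml; apply: eq_bigr => c _.
rewrite opprD addrA subrr sub0r hN [chi (b + c) y]chiC chiD ![chi y _]chiC.
by ring.
Qed.

Lemma sum_FS_label_m n : \sum_w FS_label chi tau n None (Some 0) w =
  FS_label chi tau n None (Some 0) None.
Proof. by apply: sum_only => -[c|] // _; rewrite FS_label_mgg. Qed.

Lemma FS_indicator_m_odd j : FS_coef chi tau None *
  \sum_w FS_label chi tau j.*2 None (Some 0) w = 0.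
Proof. by rewrite sum_FS_label_m FS_label_m_even mulr0. Qed.

Lemma FS_indicator_m_even j : FS_coef chi tau None *
    \sum_w FS_label chi tau j.*2.+1 None (Some 0) w =
  (Num.sg tau)%:C * (tau%:C ^+ j * #|A|%:R^-1 * (gauss_bar ^+ j.+1 * \sum_y h y ^+ j.+1)).
Proof.
rewrite FS_coef_m sum_FS_label_m FS_label_m_odd h0 mul1r; congr (_ * _).
rewrite !mulr_sumr; apply: eq_bigr => y _.
by rewrite [chi 0 y]chiC chi0r mul1r exprMn.
Qed.

End Evaluation.

(** * The condition on total indicators *)

Section RootsOfUnity.
Variables (R : realType) (p : nat).
Hypothesis (p_prime : prime p) (p_odd : odd p).

Lemma expiD : {morph @expi R : x y / x + y >-> x * y}.
Proof.
by move=> x y; rewrite /expi cosD sinD; simpc; rewrite [X in _ +i* X = _]addrC.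
Qed.

Lemma expi0 : expi (0 : R) = 1.
Proof. by rewrite /expi cos0 sin0. Qed.

Lemma expi_muln x n : expi (x * n%:R : R) = expi x ^+ n.
Proof.
elim: n => [|n IHn]; first by rewrite mulr0 expi0.
by rewrite -natr1 mulrDr mulr1 expiD IHn exprSr.
Qed.

Definition add_char (x : 'F_p) : R[i] := expi (2 * pi * (x : nat)%:R / p%:R).

Let w : R[i] := expi (2 * pi / p%:R).

Let p_neq0 : p%:R != 0 :> R.
Proof. by rewrite pnatr_eq0 -lt0n prime_gt0. Qed.

Lemma add_charE x : add_char x = w ^+ x.
Proof. by rewrite /add_char /w -expi_muln; congr expi; ring. Qed.

Lemma expi_2pi : expi (2 * pi : R) = 1.
Proof. by rewrite /expi mulr_natl cos2pi mulr2n sinDpi sinpi oppr0. Qed.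

Lemma root_unity : w ^+ p = 1.
Proof. by rewrite /w -expi_muln divfK // expi_2pi. Qed.

Lemma add_char0 : add_char 0 = 1.
Proof. by rewrite add_charE expr0. Qed.

Lemma add_charD : {morph add_char : x y / x + y >-> x * y}.
Proof.
move=> x y; rewrite !add_charE -exprD /=.
by rewrite [X in (_ %% X)%N](Fp_cast p_prime) expr_mod // root_unity.
Qed.

Lemma add_char_nontrivial : exists x, add_char x != 1.
Proof.
have p_gt2 : (2 < p)%N by case: (p) p_prime p_odd => [|[|[|]]].
exists 1; rewrite add_charE /= modn_small ?(Fp_cast p_prime) ?prime_gt1 // expr1.
(* For p at least 3 the angle lies strictly between 0 and pi. *)
have : 0 < sin (2 * pi / p%:R : R).
  apply: sin_gt0_pi; rewrite divr_gt0 ?mulr_gt0 ?pi_gt0 ?ltr0n ?prime_gt0 //=.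
  rewrite ltr_pdivrMr ?ltr0n ?prime_gt0 // [pi * _]mulrC ltr_pM2r ?pi_gt0 //.
  by rewrite ltr_nat.
move=> s0; rewrite /w /expi eq_complex /= negb_and; apply/orP; right.
by rewrite gt_eqF.
Qed.

Lemma add_char_neq0 x : add_char x != 0.
Proof.
apply/eqP => x0; have := add_charD x (- x); rewrite subrr add_char0 x0 mul0r => /eqP.
by rewrite oner_eq0.
Qed.

Lemma add_charN x : add_char (- x) = (add_char x)^-1.
Proof.
apply: (mulfI (add_char_neq0 x)); rewrite -add_charD subrr add_char0.
by rewrite mulfV // add_char_neq0.
Qed.

Lemma add_charMn x n : add_char (x *+ n) = add_char x ^+ n.
Proof.
elim: n => [|n IHn]; first by rewrite mulr0n add_char0.
by rewrite mulrS add_charD IHn exprS.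
Qed.

Lemma Fp_natr_eq0 n : (n%:R == 0 :> 'F_p) = (p %| n)%N.
Proof. by rewrite -(dvdn_pcharf (pchar_Fp p_prime)). Qed.

Lemma Fp_two_neq0 : (2 : 'F_p) != 0.
Proof.
rewrite Fp_natr_eq0 gtnNdvd //; by case: (p) p_prime p_odd => [|[|[|]]].
Qed.

Lemma Fp_mulrn_p (x : 'F_p) : x *+ p = 0.
Proof. by rewrite -mulr_natr; apply/eqP; rewrite mulf_eq0 Fp_natr_eq0 dvdnn orbT. Qed.

Lemma add_char_exp_p x : add_char x ^+ p = 1.
Proof. by rewrite -add_charMn Fp_mulrn_p add_char0. Qed.

End RootsOfUnity.

(** * The Gram matrix of a symmetric bilinear form *)

Section SymmetricForm.
Variables (F : fieldType) (n : nat) (B : {symmetric 'rV[F]_n}).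

Definition form_mx : 'M[F]_n := \matrix_(i, j) B (delta_mx 0 i) (delta_mx 0 j).

Lemma form_mxE x y : B x y = (x *m form_mx *m y^T) 0 0.
Proof.
rewrite [x in LHS]row_sum_delta [y in LHS]row_sum_delta linear_sumlz mxE.
under eq_bigr do rewrite linear_sumr.
rewrite exchange_big /=; apply: eq_bigr => j _; rewrite mxE mulr_suml.
by apply: eq_bigr => i _; rewrite linearZl_LR linearZr_LR /= [form_mx i j]mxE [y^T j 0]mxE; ring.
Qed.

Lemma form_mx_sym : form_mx^T = form_mx.
Proof. by apply/matrixP => i j; rewrite !mxE hermC expr0 mul1r. Qed.

Lemma form_mx_unit : nondegenerate B -> form_mx \in unitmx.
Proof.
rewrite /nondegenerate => /eqP radB; rewrite -row_free_unit -kermx_eq0.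
apply/rowV0P => x /sub_kermxP xM; apply/eqP; rewrite -memv0 -radB mem_orthov_sym.
apply/subvP => y _; rewrite mem_orthov1 hermC expr0 mul1r form_mxE xM.
by rewrite mul0mx mxE.
Qed.

End SymmetricForm.

(** * Indicators, exponent and total indicators over an elementary abelian p-group *)

Section Indicators.
Variables (R : realType) (p l : nat) (p_prime : prime p) (p_odd : odd p).
Variables (l_gt0 : (0 < l)%N) (B : {symmetric 'rV['F_p]_(2 * l)}) (B_nondeg : nondegenerate B).
Variables (tau : R) (tauE : tau = p%:R ^- l \/ tau = - p%:R ^- l).
Local Notation V := ('rV['F_p]_(2 * l) : finZmodType).
Local Notation chi := (chi_form R B : V -> V -> R[i]).
Local Notation C := (TY chi tau).
Local Notation e := (@add_char R p).
Local Notation d := (p%:R ^+ l : R[i]).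

Definition gauss_sum : R[i] := gauss_form e (form_mx B) 1.

(** The inverse of 2 is taken in F_p, so this is the square root of chi(a,a) among the p-th roots of
    unity. *)
Definition half_quad (a : V) : R[i] := e (2^-1 * B a a).

Let e0 := add_char0 R p.
Let eD := add_charD R p_prime.
Let e_nontriv := add_char_nontrivial R p_prime p_odd.
Let two0 := Fp_two_neq0 p_prime p_odd.
Let symM := form_mx_sym B.
Let unitM := form_mx_unit B_nondeg.

Lemma gauss_sum_scale t : t != 0 -> gauss_form e (form_mx B) t = gauss_sum.
Proof. by move=> t0; case: (gauss_form_even e0 eD e_nontriv two0 erefl symM unitM t0). Qed.

Lemma gauss_sum_sqr : gauss_sum ^+ 2 = d ^+ 2.
Proof.
have [_ ->] := gauss_form_even e0 eD e_nontriv two0 erefl symM unitM (oner_neq0 _).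
by rewrite card_Fp.
Qed.

Lemma gauss_sumP : {G : R[i] | gauss_sum = G * d & (G == 1) || (G == -1)}.
Proof.
have d0 : d != 0 by rewrite expf_neq0 // pnatr_eq0 -lt0n prime_gt0.
exists (gauss_sum / d); first by rewrite divfK.
by rewrite -eqf_sqr expr1n expr_div_n gauss_sum_sqr divff // expf_neq0.
Qed.

Lemma quad_form x : B x x = quad (form_mx B) x.
Proof. by rewrite form_mxE. Qed.

Lemma half_quad0 : half_quad 0 = 1.
Proof. by rewrite /half_quad linear0r mulr0. Qed.

Lemma half_quad_neq0 a : half_quad a != 0.
Proof. exact: add_char_neq0. Qed.

Lemma half_quadN a : half_quad (- a) = half_quad a.
Proof. by rewrite /half_quad linearNr linearNl opprK. Qed.

Lemma half_quadD a b : half_quad (a + b) = half_quad a * half_quad b * chi a b.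
Proof.
rewrite /half_quad -[chi a b]/(e (B a b)) -!eD !quad_form quadD // -form_mxE.
by congr e; field.
Qed.

Lemma chi_form_add a b c : chi a (b + c) = chi a b * chi a c.
Proof. by rewrite -![chi _ _]/(e (B _ _)) linearDr eD. Qed.

Lemma chi_form_orth a : \sum_b chi a b = if a == 0 then #|V|%:R else 0.
Proof.
case: eqP => [->|/eqP a0].
  under eq_bigr do rewrite -[chi _ _]/(e (B _ _)) linear0l e0.
  by rewrite sumr_const.
have [b ab] : exists b, B a b != 0.
  apply/existsP; apply: contraNT a0; rewrite negb_exists => /forallP B0.
  rewrite -(mulmxK unitM a) (_ : a *m _ = 0) ?mul0mx //; apply/rowP => j.
  have := B0 (delta_mx 0 j); rewrite negbK form_mxE trmx_delta -colE [col _ _ _ _]mxE.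
  by move/eqP->; rewrite mxE.
have [x ex] := e_nontriv; apply: sum_nontrivial_char; first exact: chi_form_add.
(* The multiple of b that pairs with a to the value x, where the character is nontrivial. *)
by exists (x / B a b *: b); rewrite -[chi a _]/(e (B _ _)) linearZr_LR /= divfK.
Qed.

(** Inversion replaces the scale 1/2 by -1/2, and in even dimension no nonzero scale changes the
    Gauss sum. *)
Lemma sum_half_quadV : \sum_c (half_quad c)^-1 = gauss_sum.
Proof.
rewrite -(@gauss_sum_scale (- 2^-1)) ?oppr_eq0 ?invr_eq0 //.
by apply: eq_bigr => c _; rewrite mulNr add_charN // /half_quad quad_form.
Qed.

(** The power k is a Gauss sum at scale k/2, which is nonzero in F_p unless p divides k; in that
    case every term is 1. *)
Lemma sum_half_quadX k :
  \sum_y half_quad y ^+ k = if (p %| k)%N then d ^+ 2 else gauss_sum.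
Proof.
case: ifP => [/dvdnP[j ->]|pk].
  under eq_bigr do rewrite mulnC exprM -add_charMn // Fp_mulrn_p // e0 expr1n.
  by rewrite sumr_const card_mx card_Fp // mul1n -exprM natrX mulnC.
rewrite -(@gauss_sum_scale (k%:R * 2^-1)); last first.
  by rewrite mulf_neq0 ?invr_eq0 // Fp_natr_eq0 // pk.
by apply: eq_bigr => y _; rewrite -add_charMn // -mulrA mulr_natl /half_quad quad_form.
Qed.

(** [FS_label n] belongs to the power n + 1, hence the predecessor; only n > 0 is meaningful. *)
Definition label_indicator n (s : ty_label V) : R[i] :=
  FS_coef chi tau s * \sum_w FS_label chi tau n.-1 s (Some 0) w.

Definition label_dim (s : ty_label V) : R[i] := ev_coef tau s * ty_piv_coef tau s.

Lemma FS_indicator_labels (X : ty_obj V) n : (0 < n)%N -> @FS_indicator _ C n X =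
  \sum_(x : summand X) label_indicator n (tag x).
Proof. by case: n => // n _; rewrite FS_indicator_sum. Qed.

Lemma FS_indicator_simple s n : (0 < n)%N ->
  @FS_indicator _ C n (ty_simple s) = label_indicator n s.
Proof. by move=> n0; rewrite FS_indicator_labels // sum_simple. Qed.

Lemma pivotal_dim_simple s : @pivotal_dim _ C (ty_simple s) = label_dim s.
Proof. by rewrite pivotal_dim_sum sum_simple. Qed.

(** Indicators and dimensions are additive over summands, which reduces the condition on all objects
    to the finitely many simple ones. *)
Lemma FS_period_labels n : FS_period C n <->
  (0 < n)%N /\ forall s, label_indicator n s = label_dim s.
Proof.
split=> -[n0 H]; split=> // s.
  by rewrite -FS_indicator_simple // H pivotal_dim_simple.
by rewrite FS_indicator_labels // pivotal_dim_sum; apply: eq_bigr => x _; apply: H.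
Qed.

Let p_neq0 : p%:R != 0 :> R.
Proof. by rewrite pnatr_eq0 -lt0n prime_gt0. Qed.

Let tau_neq0 : tau != 0.
Proof. by case: tauE => ->; rewrite ?oppr_eq0 invr_eq0 expf_neq0. Qed.

Lemma tau_sg : tau = Num.sg tau / p%:R ^+ l.
Proof.
have v0 : 0 < (p%:R ^+ l)^-1 :> R by rewrite invr_gt0 exprn_gt0 // ltr0n prime_gt0.
by case: tauE => ->; rewrite ?sgrN gtr0_sg // ?mul1r // mulN1r.
Qed.

Lemma label_dim_group a : label_dim (Some a) = 1.
Proof. by rewrite /label_dim /= mulr1. Qed.

Let sg_tau : R[i] := (Num.sg tau)%:C.

Let dE : (p%:R ^+ l : R)%:C = d.
Proof. by rewrite -[LHS]/(real_complex R _) rmorphXn rmorph_nat. Qed.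

Let d_neq0 : d != 0.
Proof. by rewrite expf_neq0 // pnatr_eq0 -lt0n prime_gt0. Qed.

Lemma real_complex_tau : tau%:C = sg_tau / d.
Proof. by rewrite {1}tau_sg -dE -!/(real_complex R _) fmorph_div. Qed.

Lemma sg_tauP : (sg_tau == 1) || (sg_tau == -1).
Proof.
rewrite /sg_tau; case: sgrP tau_neq0 => // _ _; first by rewrite eqxx.
by rewrite -[(-1)%:C]/(real_complex R _) rmorphN1 eqxx orbT.
Qed.

Lemma label_dim_m : label_dim None = d.
Proof.
rewrite /label_dim /= real_complex_tau -/sg_tau.
by case/orP: sg_tauP => /eqP->; field.
Qed.

Lemma label_indicator_group n a : (0 < n)%N ->
  label_indicator n (Some a) = (a *+ n == 0)%:R.
Proof. by case: n => // n _; apply: FS_indicator_group. Qed.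

Lemma label_indicator_odd j : label_indicator j.*2.+1 None = 0.
Proof. exact: FS_indicator_m_odd. Qed.

(** The sign eps of the overview. *)
Definition m_sign : R[i] := sg_tau * (gauss_sum / d).

Lemma indicator_scalar (K : fieldType) (s G D S : K) j : D != 0 ->
  s * ((s / D) ^+ j * (D ^+ 2)^-1 * (G ^+ j.+1 * S)) = (s * (G / D)) ^+ j.+1 * (S / D).
Proof.
move=> D0; rewrite !exprMn !exprVn ![_ ^+ j.+1]exprS.
by field; rewrite ?expf_neq0 ?D0.
Qed.

Lemma label_indicator_even j : label_indicator j.*2.+2 None =
  m_sign ^+ j.+1 * (if (p %| j.+1)%N then d else gauss_sum / d).
Proof.
rewrite /label_indicator /= (FS_indicator_m_even half_quad0 half_quad_neq0 half_quadN
  half_quadD chi_form_add chi_form_orth tau_neq0).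
rewrite sum_half_quadV sum_half_quadX real_complex_tau card_mx card_Fp // mul1n.
rewrite natrX [(2 * l)%N]mulnC exprM indicator_scalar //; congr (_ * _).
by case: ifP => _ //; rewrite expr2 mulfK.
Qed.

Lemma sum_label_indicator_m N : \sum_(1 <= n < N.*2.+1) label_indicator n None =
  \sum_(j < N) m_sign ^+ j.+1 * (if (p %| j.+1)%N then d else gauss_sum / d).
Proof.
elim: N => [|N IHN]; first by rewrite big_ord0 big_geq.
rewrite big_ord_recr /= -IHN doubleS big_nat_recr // big_nat_recr //=.
by rewrite label_indicator_odd addr0 label_indicator_even.
Qed.

Lemma group_mulrn_p (a : V) : a *+ p = 0.
Proof. by apply/matrixP => i j; rewrite mulmxnE Fp_mulrn_p // mxE. Qed.

Lemma label_indicator_group_period n : (0 < n)%N ->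
  (forall a, label_indicator n (Some a) = label_dim (Some a)) <-> (p %| n)%N.
Proof.
move=> n0; split=> [H|/dvdnP[k nE] a]; last first.
  by rewrite label_indicator_group // label_dim_group nE [(k * p)%N]mulnC mulrnA group_mulrn_p mul0rn eqxx.
(* The all-ones vector has order p, since l > 0 provides a coordinate. *)
have := H (const_mx 1); rewrite label_indicator_group // label_dim_group.
case: eqP => [E _|_ /esym/eqP]; last by rewrite oner_eq0.
have i0 : 'I_(2 * l) by exists 0%N; rewrite muln_gt0.
have /matrixP/(_ 0 i0) := E; rewrite mulmxnE !mxE => /eqP.
by rewrite Fp_natr_eq0.
Qed.

Lemma m_signP : (m_sign == 1) || (m_sign == -1).
Proof.
have /orP[/eqP s1|/eqP s1] := sg_tauP; rewrite /m_sign s1; have [G -> /orP[]] := gauss_sumP;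
  by rewrite mulfK // => /eqP->; rewrite ?mul1r ?mulN1r ?opprK ?eqxx ?orbT.
Qed.

Definition period : nat := if m_sign == 1 then p.*2 else p.*2.*2.

Lemma coprime2p : coprime 2 p.
Proof. by rewrite coprime2n. Qed.

(** Group elements require p to divide n, and m requires n to be even because odd indicators vanish
    while d does not. For n = 2cp the indicator of m is eps^(cp) d, and eps^(cp) = eps^c as p is
    odd; so eps = -1 forces c to be even. *)
Lemma FS_periodP n : FS_period C n <-> (0 < n)%N && (period %| n)%N.
Proof.
rewrite FS_period_labels; split=> [[n0 H]|/andP[n0 Nn]].
  rewrite n0 /=.
  have pn : (p %| n)%N by apply/(label_indicator_group_period n0) => a; apply: H.
  have := H None; rewrite label_dim_m.
  have [n_odd|n_even] := boolP (odd n).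
    rewrite -(odd_double_half n) n_odd add1n label_indicator_odd => /esym/eqP.
    by rewrite (negPf d_neq0).
  have [j nE] : exists j, n = j.*2.+2.
    exists n./2.-1; rewrite -doubleS prednK; first by rewrite -[LHS]odd_double_half (negPf n_even).
    by rewrite half_gt0; case: (n) n0 n_even => [|[|]].
  subst n; have pk : (p %| j.+1)%N.
    by move: pn; rewrite -doubleS -muln2 Gauss_dvdl // coprime_sym coprime2p.
  rewrite label_indicator_even pk -[RHS]mul1r => /(mulIf d_neq0).
  have /dvdnP[c kc] := pk; rewrite -doubleS kc /period.
  have /orP[/eqP->|/eqP sN] := m_signP.
    by rewrite eqxx -!muln2 -mulnA dvdn_mull.
  rewrite sN [(c * p)%N]mulnC exprM -[_ ^+ p]signr_odd p_odd expr1 -signr_odd.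
  have -> : (-1 == 1 :> R[i]) = false by rewrite eqNr oner_eq0.
  case: (boolP (odd c)) => [_ /eqP|c_even _]; first by rewrite eqNr oner_eq0.
  rewrite -[c]odd_double_half (negPf c_even) add0n -!muln2 -!mulnA.
  by rewrite dvdn_pmul2l ?prime_gt0 // dvdn_mull.
split=> // s.
have pn : (p %| n)%N.
  apply: dvdn_trans Nn; rewrite /period; case: ifP => _; rewrite -!muln2 -?mulnA;
  exact: dvdn_mulr.
case: s => [a|]; first exact: (iffRL (label_indicator_group_period n0) pn).
have [c nE ck] : exists2 c, n = (p * c).*2 & m_sign ^+ c = 1.
  case/dvdnP: Nn => c ->; rewrite /period.
  have /orP[/eqP->|/eqP sN] := m_signP.
    by exists c; rewrite ?expr1n // eqxx -doubleMr [(c * p)%N]mulnC.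
  have -> : (m_sign == 1 :> R[i]) = false by rewrite sN eqNr oner_eq0.
  exists c.*2; last by rewrite sN -signr_odd odd_double.
  by rewrite -!doubleMr [(c * p)%N]mulnC.
have c0 : (0 < p * c)%N by rewrite -double_gt0 -nE.
rewrite nE -(prednK c0) doubleS label_indicator_even label_dim_m prednK //.
by rewrite dvdn_mulr // mulnC exprM ck expr1n mul1r.
Qed.

Lemma period_gt0 : (0 < period)%N.
Proof. by rewrite /period; case: ifP => _; rewrite ?double_gt0 prime_gt0. Qed.

Lemma FSexpE : FSexp C = period.
Proof.
have P : FS_period C period by apply/FS_periodP; rewrite period_gt0 dvdnn.
have min_period k : FS_period C k -> (period <= k)%N.
  by move/FS_periodP => /andP[k0 /dvdn_leq]; apply.
have [F1 F2] : [set n | FS_period C n /\ forall k, FS_period C k -> (n <= k)%N]%classic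
    (FSexp C) by apply: xgetPex; exists period.
by apply/eqP; rewrite eqn_leq F2 // min_period.
Qed.

Lemma total_indicator_simple s : @total_indicator _ C (ty_simple s) =
  \sum_(1 <= n < period.+1) label_indicator n s.
Proof.
rewrite /total_indicator FSexpE big_nat_cond [RHS]big_nat_cond.
apply: eq_bigr => n; rewrite andbT => /andP[n0 _]; exact: FS_indicator_simple.
Qed.

(** The last term of the sum already equals the dimension, and the others are 0 or 1. *)
Lemma total_indicator_group a :
  @pivotal_dim _ C (ty_simple (Some a)) <= @total_indicator _ C (ty_simple (Some a)).
Proof.
rewrite pivotal_dim_simple total_indicator_simple label_dim_group.
rewrite big_nat_recr ?period_gt0 //=.
have [P0 /FS_period_labels[_ H]] : (0 < period)%N /\ FS_period C period.
  by split; [exact: period_gt0 | apply/FS_periodP; rewrite period_gt0 dvdnn].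
rewrite H label_dim_group lerDr big_nat_cond sumr_ge0 // => n.
by rewrite andbT => /andP[n0 _]; rewrite label_indicator_group // ler0n.
Qed.

Lemma sum_ord_last n (F : nat -> R[i]) : (0 < n)%N ->
  \sum_(j < n) F j = \sum_(j < n.-1) F j + F n.-1.
Proof. by case: n => // n _; rewrite big_ord_recr. Qed.

Lemma total_indicator_m : @total_indicator _ C (ty_simple None) =
  if m_sign == 1 then (p.-1)%:R * (gauss_sum / d) + d else 0.
Proof.
rewrite total_indicator_simple /period; case: ifP => [/eqP s1|/eqP s1].
  rewrite sum_label_indicator_m (sum_ord_last (fun j => m_sign ^+ j.+1 *
    (if (p %| j.+1)%N then d else gauss_sum / d))) ?prime_gt0 //.
  rewrite prednK ?prime_gt0 // dvdnn s1 expr1n mul1r; congr (_ + _).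
  transitivity (\sum_(j < p.-1) gauss_sum / d); last by rewrite sumr_const card_ord mulr_natl.
  apply: eq_bigr => j _.
  rewrite expr1n mul1r gtnNdvd //.
  by have := ltn_ord j; lia.
have sN : m_sign = -1 by case/orP: m_signP => /eqP.
(* The range has length p + p. Passing from j to p + j preserves divisibility by p and reverses the
   sign, p being odd, so the two halves cancel term by term. *)
rewrite sum_label_indicator_m -addnn big_split_ord /= -big_split big1 //= => j _.
rewrite sN -addnS dvdn_addr ?dvdnn // exprD -[_ ^+ p]signr_odd p_odd expr1.
by rewrite mulN1r mulNr addrN.
Qed.

(** For m the inequality fails when eps = -1, as the total is 0 < d, and when G = -1, as it is d -
    (p - 1). In the remaining case eps = G = 1, hence sgn(tau) = 1. *)
Lemma indicator_criterion :
  (forall s, @pivotal_dim _ C (ty_simple s) <= @total_indicator _ C (ty_simple s)) <->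
  0 < tau /\ gauss_sum = d.
Proof.
split=> [/(_ None)|[tau0 G1]].
  rewrite pivotal_dim_simple label_dim_m total_indicator_m.
  case: ifP => [/eqP s1|_]; last first.
    by rewrite lt_geF // exprn_gt0 // ltr0n prime_gt0.
  have [G GE /orP[]/eqP G1] := gauss_sumP; last first.
    rewrite GE mulfK // G1 mulrN1 lerDr oppr_ge0 lern0.
    by case: (p) p_prime => [|[|]].
  move=> _; split; last by rewrite GE G1 mul1r.
  move: s1; rewrite /m_sign GE mulfK // G1 mulr1 /sg_tau; case: sgrP => // _.
    by move/eqP; rewrite eq_sym oner_eq0.
  by move/eqP; rewrite -[(-1)%:C]/(real_complex R _) rmorphN1 eqNr oner_eq0.
case=> [a|]; first exact: total_indicator_group.
rewrite pivotal_dim_simple label_dim_m total_indicator_m /m_sign G1 divff // mulr1.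
by rewrite /sg_tau gtr0_sg // eqxx lerDr mulr1 ler0n.
Qed.

End Indicators.

(** * The Gauss sum of a category with a fibration *)

Lemma expr_odd_sqr1 (K : pzRingType) (s : K) n : s ^+ 2 = 1 -> odd n -> s ^+ n = s.
Proof.
move=> s2 n_odd; rewrite -(odd_double_half n) n_odd exprD expr1 -mul2n exprM s2.
by rewrite expr1n mulr1.
Qed.

(** * Matrix identities on the fibre of m *)

Section MatrixModel.
Variables (R : realType) (A : finZmodType) (chi : A -> A -> R[i]) (tau : R[i]).
Variable h : A -> R[i].
Hypothesis h0 : h 0 = 1.
Hypothesis h_neq0 : forall a, h a != 0.
Hypothesis hN : forall a, h (- a) = h a.
Hypothesis hD : forall a b, h (a + b) = h a * h b * chi a b.
Hypothesis chiD : forall a b c, chi a (b + c) = chi a b * chi a c.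
Hypothesis chi_orth : forall a, \sum_b chi a b = if a == 0 then #|A|%:R else 0.
Hypothesis tau_sqr : tau ^+ 2 * #|A|%:R = 1.

(* On the fibre of m, L a and M a are the left and right multiplication by a, and N is the pairing
   m ⊗ m -> 1; psi is the multiplication of the fibres of the group elements.  Matrices act on rows. *)
Variables (n : nat) (L M : A -> 'M[R[i]]_n) (N : 'M[R[i]]_n) (psi : A -> A -> R[i]).
Hypothesis n_gt0 : (0 < n)%N.
Hypothesis L_unit : forall a, L a \in unitmx.
Hypothesis M_unit : forall a, M a \in unitmx.
Hypothesis N_unit : N \in unitmx.
Hypothesis mulLL : forall a b, L b *m L a = psi a b *: L (a + b).
Hypothesis mulMM : forall a b, M a *m M b = psi a b *: M (a + b).
Hypothesis mulML : forall a b, M b *m L a = chi a b *: (L a *m M b).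
Hypothesis adjoint : forall a, N *m (L a)^T = M a *m N.
Hypothesis mmm_assoc : forall i j k l,
  N j k * (i == l)%:R = tau * \sum_a (invmx (L a) *m N) i j * L a k l.

Let unitmx_neq0 (P : 'M[R[i]]_n) : P \in unitmx -> P != 0.
Proof.
by move: n_gt0 P; case: (n) => // n' _ P uP; apply: contraTneq uP => ->; rewrite unitmxE det0 unitr0.
Qed.

(** Contraction of i with l in [mmm_assoc]: each L_a meets its inverse, so every a contributes the
    same entry of N^T. *)
Lemma pairing_tr : n%:R *: N = (tau * #|A|%:R) *: N^T.
Proof.
apply/matrixP => j k; rewrite !mxE.
transitivity (\sum_i N j k * (i == i :> 'I_n)%:R).
  under eq_bigr do rewrite eqxx mulr1.
  by rewrite sumr_const card_ord mulr_natl.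
under eq_bigr do rewrite mmm_assoc.
rewrite -mulr_sumr exchange_big /= -mulrA; congr (_ * _).
rewrite mulr_natl -sumr_const; apply: eq_bigr => a _.
rewrite -[N k j]/((N) k j) -[N in RHS](mulKVmx (L_unit a)) mxE.
by apply: eq_bigr => i _; rewrite mulrC.
Qed.

(** Applying [pairing_tr] twice gives n^2 N = (tau |A|)^2 N, and tau^2 |A| = 1. *)
Lemma dim_sqr : (n ^ 2)%N = #|A|.
Proof.
have E := pairing_tr; have /(congr1 trmx) := E.
rewrite !linearZ /= trmxK => ET.
have : (n%:R * n%:R - tau * #|A|%:R * (tau * #|A|%:R)) *: N = 0.
  rewrite scalerBl -[(n%:R * _) *: N]scalerA E scalerA [n%:R * _]mulrC -scalerA ET.
  by rewrite scalerA subrr.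
move/eqP; rewrite scaler_eq0 (negPf (unitmx_neq0 N_unit)) orbF subr_eq0 => /eqP nn.
have : (n ^ 2)%:R = #|A|%:R :> R[i].
  rewrite natrX expr2 nn; have -> : tau * #|A|%:R * (tau * #|A|%:R) =
    tau ^+ 2 * #|A|%:R * #|A|%:R by ring.
  by rewrite tau_sqr mul1r.
by move/eqP; rewrite eqr_nat => /eqP.
Qed.

Hypothesis n_odd : odd n.

(** Now N = (tau n) N^T, so determinants give (tau n)^n = 1. Together with (tau n)^2 = 1 and n odd
    this leaves only tau n = 1. *)
Lemma tau_dim : tau * n%:R = 1.
Proof.
have n0 : n%:R != 0 :> R[i] by rewrite pnatr_eq0 -lt0n.
have E : N = (tau * n%:R) *: N^T.
  apply: (scalerI n0); rewrite pairing_tr -dim_sqr natrX scalerA; congr (_ *: _); ring.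
have : \det N = (tau * n%:R) ^+ n * \det N by rewrite {1}E detZ det_tr.
have d0 : \det N != 0 by rewrite -unitfE -unitmxE.
rewrite -{1}[\det N]mul1r => /(mulIf d0) E1.
apply: etrans (esym E1); apply/esym/expr_odd_sqr1 => //.
by rewrite exprMn -natrX dim_sqr tau_sqr.
Qed.

Lemma pairing_symmetric : N^T = N.
Proof.
have n0 : n%:R != 0 :> R[i] by rewrite pnatr_eq0 -lt0n.
apply: (scalerI n0); rewrite pairing_tr -dim_sqr natrX; congr (_ *: _).
by rewrite expr2 mulrA tau_dim mul1r.
Qed.

Definition twist a := invmx (M a) *m L a.

(** Adjointness together with the symmetry of N turns L_a^-1 N into the transpose of M_a^-1
    N-conjugated to the other side; cancelling N from [mmm_assoc] then leaves the products M_a^-1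
    L_a. *)
Lemma sum_twist : tau *: \sum_a twist a = 1%:M.
Proof.
have LN a : invmx (L a) *m N = N *m (invmx (M a))^T.
  have /(congr1 trmx) := adjoint a; rewrite !trmx_mul !trmxK pairing_symmetric => E.
  rewrite trmx_inv -[N in LHS](mulmxK (_ : (M a)^T \in unitmx)) ?unitmx_tr //.
  by rewrite -E mulmxA mulKmx.
have key h' j k l : N j k * (invmx N) h' l =
    tau * \sum_a (invmx (M a)) j h' * L a k l.
  transitivity (\sum_i invmx N h' i * (N j k * (i == l)%:R)).
    rewrite (@sum_only _ _ _ l) => [|i /negPf il]; last by rewrite il !mulr0.
    by rewrite eqxx mulr1 mulrC.
  under eq_bigr do rewrite mmm_assoc mulrCA mulr_sumr.
  rewrite -mulr_sumr exchange_big /=; congr (_ * _); apply: eq_bigr => a _.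
  under eq_bigr do rewrite mulrA.
  rewrite -mulr_suml; congr (_ * _).
  transitivity ((invmx N *m (invmx (L a) *m N)) h' j); first by rewrite mxE.
  by rewrite LN mulKmx // mxE.
apply/matrixP => j l; rewrite -(mulmxV N_unit) !mxE summxE.
under [RHS]eq_bigr do rewrite key.
rewrite -mulr_sumr exchange_big; congr (_ * _).
by apply: eq_bigr => a _; rewrite mxE.
Qed.

(** Moving L_a past M_b^-1 produces chi(a,b). Left and right multiplications compose with the same
    scalars psi, which cancel in the quotient. *)
Lemma twistM a b : twist a *m twist b = chi a b *: twist (a + b).
Proof.
have psi_neq0 c c' : psi c c' != 0.
  apply/eqP => p0; have : L c' *m L c \in unitmx by rewrite unitmx_mul !L_unit.
  by move/unitmx_neq0; rewrite mulLL p0 scale0r eqxx.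
have ML : L a *m invmx (M b) = chi a b *: (invmx (M b) *m L a).
  apply: (can_inj (mulKmx (M_unit b))); apply: (can_inj (mulmxK (M_unit b))).
  by rewrite -scalemxAr mulKVmx // -scalemxAl mulmxA mulmxKV // mulML.
rewrite /twist -!mulmxA [L a *m _]mulmxA ML -scalemxAl -scalemxAr; congr (_ *: _).
rewrite -mulmxA mulLL addrC; apply: (can_inj (mulKmx (M_unit a))).
apply: (can_inj (mulKmx (M_unit b))).
rewrite (mulKVmx (M_unit a)) (mulKVmx (M_unit b)) [RHS]mulmxA mulMM [b + a]addrC.
by rewrite -scalemxAl (mulKVmx (M_unit _)).
Qed.

Lemma twist0 : twist 0 = 1%:M.
Proof.
have u : twist 0 \in unitmx by rewrite unitmx_mul unitmx_inv M_unit L_unit.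
apply: (can_inj (mulKmx u)); rewrite twistM addr0 mulmx1.
by rewrite (chi0r h0 h_neq0 hD) scale1r.
Qed.

Let rep a := h a *: twist a.

Lemma repM a b : rep a *m rep b = rep (a + b).
Proof.
by rewrite /rep -scalemxAl -scalemxAr twistM !scalerA hD.
Qed.

(* rep is a representation of A; the sum of all twists multiplies its isotypic component E c by a Gauss sum. *)
Lemma exists_gauss_bar : exists c, (\sum_a (h a)^-1) * h c = n%:R.
Proof.
pose E c := \sum_a chi a c *: rep a.
have sumE : \sum_c E c = #|A|%:R *: 1%:M.
  rewrite /E exchange_big /=; under eq_bigr do rewrite -scaler_suml chi_orth.
  rewrite (bigD1 0) //= eqxx big1 ?addr0 => [|a /negPf->]; last by rewrite scale0r.
  by rewrite /rep h0 twist0 scale1r.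
(* The [E c] add up to |A| times the identity, so they cannot all vanish. *)
have [c Ec] : exists c, E c != 0.
  apply/existsP; apply: contraT; rewrite negb_exists => /forallP E0.
  move: sumE; rewrite big1 => [/esym/eqP|c _]; last by apply/eqP/negPn/E0.
  rewrite scaler_eq0 (negPf (card_neq0 _ _)) /=.
  by have /unitmx_neq0/negPf-> := unitmx1 R[i] n.
exists c.
have repE a : rep a *m E c = chi a (- c) *: E c.
  rewrite /E mulmx_sumr scaler_sumr (reindex_inj (addIr (- a))) /=.
  apply: eq_bigr => b _; rewrite -scalemxAr repM [a + _]addrC subrK scalerA; congr (_ *: _).
  have := chiC h_neq0 hD; move=> sym.
  rewrite [chi (b - a) c]sym [chi a (- c)]sym chiD.
  rewrite [chi b c]sym mulrC; congr (_ * _).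
  apply: (mulfI (chi_neq0 h0 h_neq0 hD chiD c a)).
  rewrite -chiD subrr (chi0r h0 h_neq0 hD) [chi c a]sym [chi (- c) a]sym -chiD subrr.
  by rewrite (chi0r h0 h_neq0 hD).
have sum_twistE : \sum_a twist a = n%:R *: 1%:M.
  by rewrite -sum_twist scalerA [n%:R * _]mulrC tau_dim scale1r.
(* Each twist is h(a)^-1 times [rep a], hence acts on [E c] by h(a)^-1 chi(a,-c); summing over a
   completes the square. The same sum of twists is the scalar n. *)
have : (\sum_a twist a) *m E c = ((\sum_a (h a)^-1) * h c) *: E c.
  rewrite -(hN c) -(sum_gauss_shift h0 h_neq0 hN hD chiD).
  rewrite mulmx_suml scaler_suml; apply: eq_bigr => a _.
  by rewrite -scalerA -repE scalemxAl scalerA mulVf // scale1r.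
rewrite sum_twistE -scalemxAl mul1mx => /eqP.
by rewrite -subr_eq0 -scalerBl scaler_eq0 (negPf Ec) orbF subr_eq0 => /eqP.
Qed.

End MatrixModel.

(** * Projections and embeddings for products of simple objects *)

Section SimpleProjections.
Variables (R : realType) (A : finZmodType) (chi : A -> A -> R[i]) (tau : R).
Implicit Types (s t u v x y : ty_label A).
Local Notation hom := (ty_hom R).
Local Notation simple := (@ty_simple A).

(** Entries between different labels are discarded, so the constant 1 is the projection onto the
    summand v, and 0 if there is none. *)
Definition ty_proj s t v : hom (ty_tens (simple s) (simple t)) (simple v) :=
  of_entries (fun _ _ => 1).
Definition ty_inj s t v : hom (simple v) (ty_tens (simple s) (simple t)) :=
  of_entries (fun _ _ => 1).

Lemma entry_proj s t v q o : entry (ty_proj s t v) q o = (tag q == v)%:R.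
Proof. by rewrite entry_of_entries tag_simple; case: eqP. Qed.

Lemma entry_inj s t v o q : entry (ty_inj s t v) o q = (tag q == v)%:R.
Proof. by rewrite entry_of_entries tag_simple eq_sym; case: eqP. Qed.

Lemma entry_sum (X Y : ty_obj A) (I : finType) (f : I -> hom X Y) i j :
  entry (\sum_k f k) i j = \sum_k entry (f k) i j.
Proof. by apply: (big_morph (fun f => entry f i j)) => [g h|]; rewrite ?entryD ?entry0. Qed.

Lemma simple_eq s (i j : summand (simple s)) : (i == j) = true.
Proof. by rewrite (simple_summandP i) (simple_summandP j) eqxx. Qed.

Lemma sum_tens_simple s t (F : ty_label A -> R[i]) :
  \sum_(q : summand (ty_tens (simple s) (simple t))) F (tag q) =
  \sum_(v | ty_fusion s t v) F v.
Proof.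
by rewrite (sum_tens (fun v _ => F v)) !sum_simple.
Qed.

(** A summand of (s ⊗ t) ⊗ u with label v is determined by the label x of its inner product, so both
    sides consist of one associator coefficient per x. *)
Lemma proj_assoc s t u v y : ty_fusion t u y -> ty_fusion s y v ->
  ty_comp (ty_comp (ty_assoc chi tau (simple s) (simple t) (simple u))
    (ty_tensm (ty_id R (simple s)) (ty_proj t u y))) (ty_proj s y v) =
  \sum_x ty_assoc_coef chi tau s t u v x y *:
    ty_comp (ty_tensm (ty_proj s t x) (ty_id R (simple u))) (ty_proj x u v).
Proof.
move=> fy fv; apply: hom_eqP => q o.
transitivity ((tag q == v)%:R * ty_assoc_coef chi tau s t u v (tag (factors q).1) y).
  rewrite entry_comp.
  under eq_bigr => k _.
    rewrite entry_comp entry_proj mulr_suml.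
    under eq_bigr do rewrite entry_tensm entry_id entry_proj simple_eq entry_ty_assoc
       assoc_entryE !simple_eq !tag_simple.
    over.
  rewrite exchange_big /=.
  under eq_bigr => r _.
    under eq_bigr do rewrite -mulrA -[X in _ * X]mulrA.
    rewrite -mulr_sumr.
    rewrite (@sum_tens_simple _ _ (fun w => (tag r == w)%:R *
      (true%:R * (tag (factors r).2 == y)%:R * (w == v)%:R))).
    rewrite (@sum_fusion1 _ _ _ _ v) => [|w /negPf wv]; last by rewrite wv !mulr0.
    over.
  rewrite fv /=.
  apply: etrans.
    apply: (sum_tens (fun w p => (tag q == w)%:R * (true%:R * (true%:R * true%:R) *
       ty_assoc_coef chi tau s t u (tag q) (tag (factors q).1) (tag p.2)) *
      (true%:R * ((w == v)%:R * (true%:R * (tag p.2 == y)%:R * (v == v)%:R))))).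
  rewrite sum_simple /=.
  under eq_bigr => r _.
    rewrite (@sum_fusion1 _ _ _ _ v) => [|w /negPf wv]; last by rewrite wv !(mul0r, mulr0).
    over.
  rewrite (@sum_tens_simple _ _ (fun w => (ty_fusion s w v)%:R *
      ((tag q == v)%:R * (true%:R * (true%:R * true%:R) *
       ty_assoc_coef chi tau s t u (tag q) (tag (factors q).1) w) *
      (true%:R * ((v == v)%:R * (true%:R * (w == y)%:R * (v == v)%:R)))))).
  rewrite (@sum_fusion1 _ _ _ _ y) => [|w /negPf wv]; last by rewrite wv !(mul0r, mulr0).
  rewrite fy fv !eqxx !(mul1r, mulr1).
  by case: eqP => [->|]; rewrite ?mul0r.
rewrite entry_sum (@sum_only _ _ _ (tag (factors q).1)) => [|x xq]; last first.
  rewrite entryZ entry_comp big1 ?mulr0 // => k _.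
  by rewrite entry_tensm entry_proj [_ == x]eq_sym (negPf xq) mul0r mulr0 mul0r.
rewrite entryZ entry_comp mulrC; congr (_ * _).
under eq_bigr do rewrite entry_tensm entry_proj entry_proj eqxx entry_id simple_eq.
rewrite (@sum_tens_simple _ _ (fun w => (tag q == w)%:R * (true%:R * true%:R) * (w == v)%:R)).
rewrite (@sum_fusion1 _ _ _ _ v) => [|w /negPf wv]; last by rewrite wv mulr0.
rewrite eqxx !(mulr1, mul1r); case: (eqVneq (tag q) v) => [<-|]; last by rewrite mulr0.
by have := factors_fusion q; rewrite !tag_simple => ->; rewrite mulr1.
Qed.

Lemma inj_proj s t v : ty_fusion s t v -> ty_comp (ty_inj s t v) (ty_proj s t v) = ty_id R (simple v).
Proof.
move=> fv; apply: hom_eqP => i j; rewrite entry_comp entry_id simple_eq.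
under eq_bigr do rewrite entry_inj entry_proj.
rewrite (@sum_tens_simple _ _ (fun w => (w == v)%:R * (w == v)%:R)).
rewrite (@sum_fusion1 _ _ _ _ v) => [|w /negPf wv]; last by rewrite wv mulr0.
by rewrite fv eqxx !mulr1.
Qed.

Lemma inj_proj_neq s t v w : v != w -> ty_comp (ty_inj s t v) (ty_proj s t w) = 0.
Proof.
move=> vw; apply: hom_eqP => i j; rewrite entry_comp entry0 big1 // => q _.
rewrite entry_inj entry_proj; case: eqP => [->|]; last by rewrite mul0r.
by rewrite (negPf vw) mulr0.
Qed.

Lemma tens_simple_eq s t (q q' : summand (ty_tens (simple s) (simple t))) :
  (q == q') = (tag q == tag q').
Proof.
by rewrite eq_tens (surjective_pairing (factors q)) (surjective_pairing (factors q'))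
  xpair_eqE !simple_eq !andbT.
Qed.

Lemma proj_inj_single s t v : (forall w, ty_fusion s t w = (w == v)) ->
  ty_comp (ty_proj s t v) (ty_inj s t v) = ty_id R (ty_tens (simple s) (simple t)).
Proof.
move=> fv; apply: hom_eqP => q q'; rewrite entry_comp entry_id sum_simple.
have tagv (p : summand (ty_tens (simple s) (simple t))) : tag p == v.
  by rewrite -fv; have := factors_fusion p; rewrite !tag_simple.
by rewrite entry_proj entry_inj tens_simple_eq (eqP (tagv q)) (eqP (tagv q')) !eqxx mulr1.
Qed.

Lemma lunit_proj s : ty_lunit R (simple s) = ty_proj (Some 0) s s.
Proof.
by apply: hom_eqP => q i; rewrite entry_lunit entry_proj simple_eq mulr1 tag_simple.
Qed.

Lemma runit_proj s : ty_runit R (simple s) = ty_proj s (Some 0) s.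
Proof.
by apply: hom_eqP => q i; rewrite entry_runit entry_proj simple_eq mulr1 tag_simple.
Qed.

End SimpleProjections.

Lemma dim_cancel (K : fieldType) (U W : vectType K) (f : 'Hom(U, W)) (g : W -> U) :
  cancel f g -> cancel g f -> \dim {:U} = \dim {:W}.
Proof.
move=> fg gf; have kerf : lker f == 0%VS by apply/lker0P; apply: can_inj fg.
have -> : {:W}%VS = limg f.
  by apply/vspaceP => w; rewrite memvf; apply/esym/memv_imgP; exists (g w); rewrite ?memvf.
by rewrite limg_dim_eq // (eqP kerf) capv0.
Qed.

(** * Structure constants of a fibration *)

Section FibreData.
Variables (R : realType) (A : finZmodType) (chi : A -> A -> R[i]) (tau : R).
Local Notation C := (TY chi tau).
Variable F : fibration C.
Implicit Types (s t u v x y : ty_label A).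
Local Notation K := R[i].
Local Notation hom := (ty_hom R).
Local Notation simple := (@ty_simple A).
Local Notation Ff s := (@fobj _ C F (simple s)).
Local Notation Fm X Y f := (@fmap _ C F X Y f).
Local Notation Ft X Y := (@ftens _ C F X Y).

Lemma fmap_comp_apply (X Y Z : ty_obj A) (f : hom X Y) (g : hom Y Z) w :
  Fm X Z (ty_comp f g) w = Fm Y Z g (Fm X Y f w).
Proof. by rewrite (@fmap_comp _ C F X Y Z f g) comp_lfunE. Qed.

Lemma fmap_id_apply (X : ty_obj A) w : Fm X X (ty_id R X) w = w.
Proof. by rewrite (@fmap_id _ C F X) id_lfunE. Qed.

(** The component in the fibre of v of a product of vectors. A fibration thus yields a
    multiplication graded by labels, associative up to the coefficients of Phi. *)
Definition fmul s t v (a : Ff s) (b : Ff t) : Ff v :=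
  Fm _ _ (ty_proj R s t v) (Ft _ _ a b).

Lemma fmulDl s t v b : {morph (fun a => @fmul s t v a b) : a a' / a + a'}.
Proof. by move=> a a'; rewrite /fmul linearDl linearD. Qed.

Lemma fmulDr s t v a : {morph (@fmul s t v a) : b b' / b + b'}.
Proof. by move=> b b'; rewrite /fmul linearDr linearD. Qed.

Lemma fmulZl s t v c a b : @fmul s t v (c *: a) b = c *: fmul v a b.
Proof. by rewrite /fmul linearZl_LR linearZ. Qed.

Lemma fmulZr s t v c a b : @fmul s t v a (c *: b) = c *: fmul v a b.
Proof. by rewrite /fmul linearZr_LR linearZ. Qed.

Lemma fmul_suml s t v (I : finType) (f : I -> Ff s) b :
  @fmul s t v (\sum_k f k) b = \sum_k fmul v (f k) b.
Proof. by rewrite /fmul linear_sumlz linear_sum. Qed.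

Lemma fmul_sumr s t v (I : finType) a (f : I -> Ff t) :
  @fmul s t v a (\sum_k f k) = \sum_k fmul v a (f k).
Proof. by rewrite /fmul linear_sumr linear_sum. Qed.

Lemma fmulA s t u v y a b c : ty_fusion t u y -> ty_fusion s y v ->
  @fmul s y v a (@fmul t u y b c) =
  \sum_x ty_assoc_coef chi tau s t u v x y *: @fmul x u v (@fmul s t x a b) c.
Proof.
move=> fy fv; rewrite /fmul -{1}(fmap_id_apply a).
rewrite -(@ftens_natural _ C F) -fmap_comp_apply.
rewrite -(@fassoc _ C F) -fmap_comp_apply ty_compA proj_assoc //.
rewrite linear_sum sum_lfunE; apply: eq_bigr => x _.
rewrite linearZ scale_lfunE; congr (_ *: _).
by rewrite fmap_comp_apply (@ftens_natural _ C F) fmap_id_apply.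
Qed.

Local Notation f1 := (@funit _ C F : Ff (Some 0)).

Lemma fmul1r s a : @fmul (Some 0) s s f1 a = a.
Proof. by rewrite /fmul -lunit_proj (@flunit _ C F). Qed.

Lemma fmulr1 s a : @fmul s (Some 0) s a f1 = a.
Proof. by rewrite /fmul -runit_proj (@frunit _ C F). Qed.

(** Extends a vanishing statement from pure tensors to the whole fibre of the product. *)
Lemma ftens_span (X Y : ty_obj A) (f : @fobj _ C F (ty_tens X Y) -> K) :
  (forall c z z', f (c *: z + z') = c * f z + f z') ->
  (forall a b, f (Ft X Y a b) = 0) -> forall z, f z = 0.
Proof.
move=> f_lin f0 z; have /andP[/eqP span _] := @ftens_iso _ C F X Y.
pose B := in_tuple [seq Ft X Y a b | a <- vbasis fullv, b <- vbasis fullv].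
have f00 : f 0 = 0.
  have := f_lin 0 0 0; rewrite scale0r addr0 mul0r add0r => /eqP.
  by have := f_lin 1 0 0; rewrite scale1r addr0 mul1r -{1}[f 0]addr0 => /addrI <-.
have : z \in <<B>>%VS by rewrite span memvf.
move/coord_span->; apply: (big_ind (fun z => f z = 0)) => // [z1 z2 E1 E2|i _].
  by rewrite -[z1]scale1r f_lin E1 E2 mulr0 addr0.
have /allpairsP[[a b] [_ _ ->]] := mem_nth 0 (ltn_ord i).
by rewrite -[_ *: _]addr0 f_lin f0 f00 mulr0 addr0.
Qed.

Lemma dim_ftens (X Y : ty_obj A) : \dim {:@fobj _ C F (ty_tens X Y)} =
  (\dim {:@fobj _ C F X} * \dim {:@fobj _ C F Y})%N.
Proof.
have /andP[/eqP span free] := @ftens_iso _ C F X Y.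
rewrite -[in LHS]span (eqP free) size_allpairs.
by rewrite !size_tuple.
Qed.

Lemma dim_unit : \dim {:Ff (Some 0)} = 1%N.
Proof.
have /andP[/eqP span free] := @funit_iso _ C F.
by rewrite -[in LHS]span (eqP free).
Qed.

(** The product of a and -a is the unit, so the dimensions of the two fibres multiply to 1. *)
Lemma dim_group a : \dim {:Ff (Some a)} = 1%N.
Proof.
have fus w : ty_fusion (Some a) (Some (- a)) w = (w == Some 0).
  by case: w => [c|] //=; rewrite /ty_fusion subrr.
pose p := Fm _ _ (ty_proj R (Some a) (Some (- a)) (Some 0)).
pose q := Fm _ _ (ty_inj R (Some a) (Some (- a)) (Some 0)).
have pq z : q (p z) = z by rewrite -fmap_comp_apply proj_inj_single // fmap_id_apply.
have qp z : p (q z) = z.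
  by rewrite -fmap_comp_apply inj_proj ?fmap_id_apply // fus.
have : \dim {:@fobj _ C F (ty_tens (simple (Some a)) (simple (Some (- a))))} = 1%N.
  by rewrite (dim_cancel pq qp) dim_unit.
by rewrite dim_ftens => /eqP; rewrite muln_eq1 => /andP[/eqP].
Qed.

Hypothesis chi0 : forall a, chi a 0 = 1.
Hypothesis tau_neq0 : tau%:C != 0.

Lemma fmul_nofusion s t v a b : ty_fusion s t v = false -> @fmul s t v a b = 0.
Proof.
move=> nf; rewrite /fmul (_ : ty_proj R s t v = 0) ?linear0 ?zero_lfunE //.
apply: hom_eqP => q o; rewrite entry_proj entry0.
by have := factors_fusion q; rewrite !tag_simple; case: eqP => // ->; rewrite nf.
Qed.

(** An arbitrary basis vector of a line. For a = 0 it is only a multiple of the unit vector, which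
    is why the scalar [gunit] accompanies the formulas below. *)
Definition gvec a : Ff (Some a) := (vbasis {:Ff (Some a)})`_0.
Definition gcoord a (z : Ff (Some a)) : K :=
  coord (vbasis {:Ff (Some a)}) (cast_ord (esym (dim_group a)) ord0) z.

Lemma gcoordK a z : gcoord z *: gvec a = z.
Proof.
rewrite [RHS](coord_vbasis (memvf z)) (bigD1 (cast_ord (esym (dim_group a)) ord0)) //=.
rewrite big1 ?addr0 // => i /negP[]; apply/eqP/val_inj => /=.
by case: i => i /=; rewrite dim_group ltnS leqn0 => /eqP.
Qed.

Lemma gcoord_lin a c (z z' : Ff (Some a)) : gcoord (c *: z + z') = c * gcoord z + gcoord z'.
Proof. by rewrite /gcoord linearP. Qed.

Lemma gvec_mem a : gvec a \in vbasis {:Ff (Some a)}.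
Proof. by rewrite mem_nth // size_tuple dim_group. Qed.

Lemma gvec_neq0 a : gvec a != 0.
Proof. exact: free_not0 (basis_free (vbasisP _)) (gvec_mem a). Qed.

Lemma gcoordZ a c : gcoord (c *: gvec a) = c.
Proof.
have /eqP := gcoordK (c *: gvec a); rewrite -subr_eq0 -scalerBl scaler_eq0.
by rewrite (negPf (gvec_neq0 a)) orbF subr_eq0 => /eqP.
Qed.

Lemma gcoord_gvec a : gcoord (gvec a) = 1.
Proof. by rewrite -[gvec a]scale1r gcoordZ. Qed.

Definition gunit := gcoord f1.

Lemma funit_neq0 : f1 != 0.
Proof.
have /andP[_ free1] := @funit_iso _ C F.
by apply: (free_not0 free1); rewrite inE.
Qed.

Lemma gunit_neq0 : gunit != 0.
Proof.
by apply: contra funit_neq0 => /eqP E; rewrite -(gcoordK f1) -/gunit E scale0r.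
Qed.

Lemma gvec0E : gvec 0 = gunit^-1 *: f1.
Proof. by rewrite -(gcoordK f1) scalerA mulVf ?gunit_neq0 // scale1r. Qed.

Definition gpsi a b : K := gcoord (fmul (Some (a + b)) (gvec a) (gvec b)).

Lemma fmul_gvec a b : fmul (Some (a + b)) (gvec a) (gvec b) = gpsi a b *: gvec (a + b).
Proof. by rewrite gcoordK. Qed.

(** The product of the basis vectors belongs to a basis of the fibre of a ⊗ b, and the projection of
    this one-summand product is invertible. *)
Lemma gpsi_neq0 a b : gpsi a b != 0.
Proof.
have fus w : ty_fusion (Some a) (Some b) w = (w == Some (a + b)) by case: w.
apply/eqP => p0; have := fmul_gvec a b; rewrite p0 scale0r /fmul.
move/(congr1 (Fm _ _ (ty_inj R (Some a) (Some b) (Some (a + b))))).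
rewrite -fmap_comp_apply proj_inj_single // fmap_id_apply linear0 => /eqP.
apply/negP; have := basis_free (@ftens_iso _ C F (simple (Some a)) (simple (Some b))).
by move/free_not0; apply; apply: allpairs_f; apply: gvec_mem.
Qed.

Local Notation n := (\dim {:Ff None}).
Local Notation mvec i := (vbasis {:Ff None})`_i.
Local Notation mcoord j z := (coord (vbasis {:Ff None}) j z : K).

Lemma mcoordK z : z = \sum_(j < n) mcoord j z *: mvec j.
Proof. exact: coord_vbasis (memvf z). Qed.

Lemma mcoord_mvec (i j : 'I_n) : mcoord j (mvec i) = (i == j)%:R.
Proof. by rewrite coord_free ?(basis_free (vbasisP _)) // eq_sym. Qed.

Definition Lmx a : 'M[K]_n := \matrix_(i, j) mcoord j (fmul None (gvec a) (mvec i)).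
Definition Rmx a : 'M[K]_n := \matrix_(i, j) mcoord j (fmul None (mvec i) (gvec a)).
Definition Nmx a : 'M[K]_n := \matrix_(i, j) gcoord (fmul (Some a) (mvec i) (mvec j)).

Lemma fmul_Lmx a (i : 'I_n) : fmul None (gvec a) (mvec i) = \sum_j Lmx a i j *: mvec j.
Proof. by rewrite [LHS]mcoordK; apply: eq_bigr => j _; rewrite mxE. Qed.

Lemma fmul_Rmx a (i : 'I_n) : fmul None (mvec i) (gvec a) = \sum_j Rmx a i j *: mvec j.
Proof. by rewrite [LHS]mcoordK; apply: eq_bigr => j _; rewrite mxE. Qed.

Lemma fmul_Nmx a (i j : 'I_n) : fmul (Some a) (mvec i) (mvec j) = Nmx a i j *: gvec a.
Proof. by rewrite mxE gcoordK. Qed.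

Lemma mcoord_sum (f : 'I_n -> K) j : mcoord j (\sum_k f k *: mvec k) = f j.
Proof.
rewrite linear_sum (@sum_only _ _ _ j) => [|k /negPf kj].
  by rewrite linearZ /= mcoord_mvec eqxx; apply: mulr1.
by rewrite linearZ /= mcoord_mvec kj; apply: mulr0.
Qed.

Lemma fmul_mcoord (f : Ff None -> Ff None) (P : 'M[K]_n) (z : Ff None) :
    (forall i : 'I_n, f (mvec i) = \sum_j P i j *: mvec j) ->
    {morph f : x y / x + y} -> (forall c (x : Ff None), f (c *: x) = c *: f x) -> f 0 = 0 ->
  forall j, mcoord j (f z) = \sum_i mcoord i z * P i j.
Proof.
move=> fP fD fZ f0 j; rewrite {1}(mcoordK z) (big_morph f fD f0) linear_sum.
apply: eq_bigr => i _; rewrite fZ fP linearZ /=.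
by congr (_ * _); apply: mcoord_sum.
Qed.

Lemma mcoord_Lmx a z j : mcoord j (fmul None (gvec a) z) = \sum_i mcoord i z * Lmx a i j.
Proof.
apply: fmul_mcoord => [i|x y|c x|]; first exact: fmul_Lmx.
- exact: fmulDr.
- exact: fmulZr.
- by rewrite -[X in fmul _ _ X](scale0r 0) fmulZr scale0r.
Qed.

Lemma mcoord_Rmx a z j : mcoord j (fmul None z (gvec a)) = \sum_i mcoord i z * Rmx a i j.
Proof.
apply: (fmul_mcoord (f := fun z => fmul None z (gvec a))) => [i|x y|c x|]; first exact: fmul_Rmx.
- exact: fmulDl.
- exact: fmulZl.
- by rewrite -[X in fmul _ X _](scale0r 0) fmulZl scale0r.
Qed.

(** Phi_{m,m,m} is the only associator with several intermediate labels; in all other cases the sum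
    in [fmulA] has a single term. *)
Lemma fmulA1 s t u v y x0 a b c : ty_fusion t u y -> ty_fusion s y v ->
    (forall x, ty_fusion s t x -> ty_fusion x u v -> x = x0) ->
  @fmul s y v a (@fmul t u y b c) =
  ty_assoc_coef chi tau s t u v x0 y *: @fmul x0 u v (@fmul s t x0 a b) c.
Proof.
move=> fy fv x0P; rewrite fmulA // (bigD1 x0) //= big1 ?addr0 // => x xx0.
case: (boolP (ty_fusion s t x)) => [f1|/negbTE f1]; last first.
  by rewrite (fmul_nofusion _ _ f1) -[X in fmul _ X _](scale0r 0) fmulZl scale0r scaler0.
case: (boolP (ty_fusion x u v)) => [f2|/negbTE f2]; last first.
  by rewrite (fmul_nofusion _ _ f2) scaler0.
by rewrite (x0P x f1 f2) eqxx in xx0.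
Qed.

Lemma Lmx_mul a b : Lmx b *m Lmx a = gpsi a b *: Lmx (a + b).
Proof.
apply/matrixP => i j; rewrite !mxE.
transitivity (mcoord j (fmul None (gvec a) (fmul None (gvec b) (mvec i)))).
  by rewrite mcoord_Lmx; apply: eq_bigr => k _; rewrite [Lmx b i k]mxE.
rewrite (@fmulA1 _ _ _ _ _ (Some (a + b))) //; last by case=> [c|] // /eqP->.
by rewrite /= scale1r fmul_gvec fmulZl linearZ.
Qed.

Lemma Rmx_mul a b : Rmx a *m Rmx b = gpsi a b *: Rmx (a + b).
Proof.
apply/matrixP => i j; rewrite !mxE.
transitivity (mcoord j (fmul None (fmul None (mvec i) (gvec a)) (gvec b))).
  by rewrite mcoord_Rmx; apply: eq_bigr => k _; rewrite [Rmx a i k]mxE.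
have := @fmulA1 None (Some a) (Some b) None (Some (a + b)) None (mvec i) (gvec a) (gvec b).
rewrite /= scale1r => <- //; last by case.
  by rewrite fmul_gvec fmulZr linearZ.
by rewrite /ty_fusion eqxx.
Qed.

Lemma Rmx_Lmx a b : Rmx b *m Lmx a = chi a b *: (Lmx a *m Rmx b).
Proof.
apply/matrixP => i j; rewrite !mxE.
transitivity (mcoord j (fmul None (gvec a) (fmul None (mvec i) (gvec b)))).
  by rewrite mcoord_Lmx; apply: eq_bigr => k _; rewrite [Rmx b i k]mxE.
rewrite (@fmulA1 _ _ _ _ _ None) //; last by case.
rewrite linearZ /= mcoord_Rmx; congr (_ * _).
by apply: eq_bigr => k _; rewrite [Lmx a i k]mxE.
Qed.

Lemma Nmx_adjoint a : Nmx 0 *m (Lmx a)^T = Rmx a *m Nmx 0.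
Proof.
apply/matrixP => i j; rewrite !mxE.
have gsum (f : 'I_n -> K) : gcoord (\sum_k f k *: gvec 0) = \sum_k f k.
  by rewrite -scaler_suml gcoordZ.
transitivity (gcoord (fmul (Some 0) (mvec i) (fmul None (gvec a) (mvec j)))).
  rewrite fmul_Lmx fmul_sumr; under [X in _ = gcoord X]eq_bigr do rewrite fmulZr fmul_Nmx scalerA.
  by rewrite gsum; apply: eq_bigr => k _; rewrite [_^T _ _]mxE mulrC.
rewrite (@fmulA1 _ _ _ _ _ None) //=; last by case.
rewrite chi0 scale1r fmul_Rmx fmul_suml.
under [X in gcoord X]eq_bigr do rewrite fmulZl fmul_Nmx scalerA.
by rewrite gsum.
Qed.

(** The pairing into the fibre of a is determined by the one into the unit, up to L_a^-1. This is
    what brings all components of m ⊗ m back to [Nmx 0]. *)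
Lemma Lmx_Nmx a : Lmx a *m Nmx a = gunit^-1 *: Nmx 0.
Proof.
apply/matrixP => i j; rewrite [LHS]mxE [RHS]mxE.
apply: (can_inj (@gcoordZ a)).
transitivity (fmul (Some a) (fmul None (gvec a) (mvec i)) (mvec j)).
  rewrite fmul_Lmx fmul_suml scaler_suml; apply: eq_bigr => k _.
  by rewrite fmulZl fmul_Nmx scalerA.
have := @fmulA1 (Some a) None None (Some a) (Some 0) None (gvec a) (mvec i) (mvec j).
rewrite /= scale1r => <- //; last 1 first.
- by case.
- by rewrite fmul_Nmx fmulZr gvec0E fmulZr fmulr1 scalerA mulrC.
- by rewrite /ty_fusion addr0.
Qed.

Lemma Lmx0 : Lmx 0 = gunit^-1 *: 1%:M.
Proof.
apply/matrixP => i j; rewrite !mxE gvec0E fmulZl fmul1r linearZ /= mcoord_mvec.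
by [].
Qed.

Lemma Rmx0 : Rmx 0 = gunit^-1 *: 1%:M.
Proof.
apply/matrixP => i j; rewrite !mxE gvec0E fmulZr fmulr1 linearZ /= mcoord_mvec.
by [].
Qed.

Lemma scalar_unit c : c != 0 -> c *: 1%:M \in (unitmx : {pred 'M[K]_n}).
Proof. by move=> c0; rewrite unitmxZ ?unitfE // unitmx1. Qed.

Lemma Lmx_unit a : Lmx a \in unitmx.
Proof.
have := Lmx_mul a (- a); rewrite subrr Lmx0 scalerA => E.
have : Lmx (- a) *m Lmx a \in unitmx.
  by rewrite E scalar_unit // mulf_neq0 ?gpsi_neq0 ?invr_eq0 ?gunit_neq0.
by rewrite unitmx_mul => /andP[].
Qed.

Lemma Rmx_unit a : Rmx a \in unitmx.
Proof.
have := Rmx_mul a (- a); rewrite subrr Rmx0 scalerA => E.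
have : Rmx a *m Rmx (- a) \in unitmx.
  by rewrite E scalar_unit // mulf_neq0 ?gpsi_neq0 ?invr_eq0 ?gunit_neq0.
by rewrite unitmx_mul => /andP[].
Qed.

Lemma fmul_mmm (x y z : Ff None) : fmul None x (fmul (Some 0) y z) =
  tau%:C *: \sum_a fmul None (fmul (Some a) x y) z.
Proof.
rewrite fmulA // (bigD1 None) //= (fmul_nofusion (s := None) (t := None) (v := None)) //.
rewrite scaler0 add0r (reindex_omap Some id) => [|[a|] //=]; rewrite scaler_sumr.
by apply: eq_big => a; rewrite /= ?eqxx // chi0 invr1 mulr1.
Qed.

Lemma Nmx_assoc i j k l :
  Nmx 0 j k * (i == l)%:R = tau%:C * \sum_a (invmx (Lmx a) *m Nmx 0) i j * Lmx a k l.
Proof.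
have := congr1 (fun z => mcoord l z) (fmul_mmm (mvec i) (mvec j) (mvec k)).
rewrite fmul_Nmx fmulZr gvec0E fmulZr fmulr1 scalerA !linearZ /= mcoord_mvec linear_sum /=.
move=> E; apply: (mulfI (_ : gunit^-1 != 0)); first by rewrite invr_eq0 gunit_neq0.
rewrite mulrCA mulrA E [in RHS]mulrCA; congr (_ * _); rewrite mulr_sumr.
apply: eq_bigr => a _; rewrite fmul_Nmx fmulZl fmul_Lmx linearZ /= mcoord_sum.
rewrite mulrA; congr (_ * _).
by rewrite -[Nmx a](mulKmx (Lmx_unit a)) Lmx_Nmx -scalemxAr mxE.
Qed.

(** If z pairs to zero with every vector, associativity on the fibre of m gives \sum_a (x y)_a z = 0
    for all x and y. Pure tensors span, so x y may be replaced by a vector supported in the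
    component of the unit, whence z = 0. *)
Lemma Nmx_unit : Nmx 0 \in unitmx.
Proof.
rewrite -unitmx_tr -row_free_unit -kermx_eq0; apply/rowV0P => w /sub_kermxP wN.
pose z := \sum_k w 0 k *: mvec k.
have yz (y : Ff None) : fmul (Some 0) y z = 0.
  rewrite (mcoordK y) fmul_suml big1 // => j _; rewrite fmulZl /z fmul_sumr.
  under eq_bigr do rewrite fmulZr fmul_Nmx scalerA.
  rewrite -scaler_suml; have /matrixP/(_ 0 j) := wN; rewrite !mxE => E.
  rewrite (_ : \sum_k _ = 0) ?scale0r ?scaler0 // -[RHS]E.
  by apply: eq_bigr => k _; rewrite [_^T _ _]mxE.
have key l (w' : @fobj _ C F (ty_tens (simple None) (simple None))) :
    \sum_a gcoord (Fm _ _ (ty_proj R None None (Some a)) w') *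
    mcoord l (fmul None (gvec a) z) = 0.
  move: w'; apply: (@ftens_span (simple None) (simple None) (fun w' =>
    \sum_a gcoord (Fm (ty_tens (simple None) (simple None)) _
      (ty_proj R None None (Some a)) w') * mcoord l (fmul None (gvec a) z))).
    move=> c t1 t2; rewrite mulr_sumr -big_split /=; apply: eq_bigr => a _.
    by rewrite linearP gcoord_lin mulrDl mulrA.
  move=> x' y'; have := congr1 (fun z => mcoord l z) (fmul_mmm x' y' z).
  rewrite yz -[X in fmul _ _ X](scale0r 0) fmulZr scale0r linear0 linearZ /= linear_sum /=.
  move/esym/eqP; rewrite mulf_eq0 (negPf tau_neq0) /= => /eqP E; rewrite -[RHS]E.
  apply: eq_bigr => a _; rewrite -/(fmul (Some a) x' y') -{2}(gcoordK (fmul (Some a) x' y')).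
  by rewrite fmulZl linearZ.
apply/rowP => l; rewrite mxE.
have := key l (Fm _ _ (ty_inj R None None (Some 0)) (gvec 0)).
rewrite (@sum_only _ _ _ 0) => [|a a0]; last first.
  rewrite -fmap_comp_apply inj_proj_neq 1?eq_sym // linear0 zero_lfunE.
  by rewrite -[0](scale0r (gvec a)) gcoordZ mul0r.
rewrite -fmap_comp_apply inj_proj // fmap_id_apply gcoord_gvec mul1r.
rewrite gvec0E fmulZl fmul1r linearZ /= mcoord_sum => /eqP.
by rewrite mulf_eq0 invr_eq0 (negPf gunit_neq0) => /eqP.
Qed.

(** The unit is a retract of m ⊗ m, whose fibre would be zero if that of m were. *)
Lemma dim_m_gt0 : (0 < n)%N.
Proof.
rewrite lt0n; apply/eqP => n0.
have d0 : \dim {:@fobj _ C F (ty_tens (simple None) (simple None))} = 0%N.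
  by rewrite dim_ftens n0.
have z0 (z : @fobj _ C F (ty_tens (simple None) (simple None))) : z = 0.
  apply/eqP; rewrite -memv0; have /eqP := d0; rewrite dimv_eq0 => /eqP <-.
  exact: memvf.
have := gvec_neq0 0.
rewrite -(fmap_id_apply (gvec 0)) -(@inj_proj _ _ None None (Some 0)) // fmap_comp_apply.
by rewrite [X in Fm _ _ _ X]z0 linear0 eqxx.
Qed.

End FibreData.

(** * From a fibration to the Gauss sum *)

Section Necessity.
Variables (R : realType) (p l : nat) (p_prime : prime p) (p_odd : odd p).
Variables (B : {symmetric 'rV['F_p]_(2 * l)}) (B_nondeg : nondegenerate B).
Variables (tau : R) (tauE : tau = p%:R ^- l \/ tau = - p%:R ^- l).
Local Notation V := ('rV['F_p]_(2 * l) : finZmodType).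
Local Notation chi := (chi_form R B : V -> V -> R[i]).
Local Notation C := (TY chi tau).

Lemma fibration_gauss_sum :
  admits_fibration C -> 0 < tau /\ gauss_sum R B = p%:R ^+ l.
Proof.
case=> F.
have chi0 a : chi a 0 = 1 by rewrite -[chi a 0]/(add_char R (B a 0)) linear0r add_char0.
have p0 : p%:R != 0 :> R by rewrite pnatr_eq0 -lt0n prime_gt0.
have tauR2 : tau ^+ 2 * #|V|%:R = 1.
  have -> : tau ^+ 2 = (p%:R ^+ l) ^- 2.
    by case: tauE => ->; rewrite ?sqrrN exprVn.
  rewrite card_mx card_Fp // mul1n mulnC expnM !natrX mulVf //.
  by rewrite !expf_neq0.
have tau_sqr : tau%:C ^+ 2 * #|V|%:R = 1.
  by have /(congr1 (real_complex R)) := tauR2; rewrite rmorphM rmorphXn rmorph_nat rmorph1.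
have tau0 : tau%:C != 0.
  apply/eqP => t0; have /eqP := tau_sqr; rewrite t0 expr0n mul0r eq_sym.
  by rewrite oner_eq0.
pose n := \dim {:@fobj _ C F (ty_simple (None : ty_label V))}.
have n0 : (0 < n)%N := dim_m_gt0 F.
have hex := Nmx_assoc (F := F) chi0.
have Lu := Lmx_unit F; have Ru := Rmx_unit F; have Nu := Nmx_unit F chi0 tau0.
have n_pl : n = (p ^ l)%N.
  have := dim_sqr tau_sqr n0 Lu Nu hex.
  by rewrite card_mx card_Fp // mul1n mulnC expnM => /eqP; rewrite eqn_exp2r // => /eqP.
have n_odd : odd n by rewrite n_pl oddX p_odd orbT.
have tau_n : tau%:C * n%:R = 1 := tau_dim tau_sqr n0 Lu Nu hex n_odd.
have nE : n%:R = p%:R ^+ l :> R[i] by rewrite n_pl natrX.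
split.
  have : tau * n%:R = 1.
    by apply: (fmorph_inj (real_complex R)); rewrite rmorphM rmorph_nat rmorph1.
  move=> E; have : 0 < tau * n%:R by rewrite E ltr01.
  by rewrite pmulr_lgt0 // ltr0n.
have [c] := exists_gauss_bar (@half_quad0 R _ _ B) (half_quad_neq0 R p_prime B)
  (half_quadN R B) (half_quadD R p_prime p_odd B) (chi_form_add R p_prime B)
  (chi_form_orth R p_prime p_odd B_nondeg) tau_sqr n0 Lu Ru Nu (Lmx_mul F) (Rmx_mul F)
  (Rmx_Lmx F) (Nmx_adjoint F chi0) hex n_odd.
rewrite sum_half_quadV // nE => Ec.
have [G GE G1] := gauss_sumP R p_prime p_odd B_nondeg.
have d0 : p%:R ^+ l != 0 :> R[i] by rewrite expf_neq0 // pnatr_eq0 -lt0n prime_gt0.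
have Gh : G * half_quad R B c = 1.
  apply: (mulIf d0); rewrite mul1r -[RHS]Ec GE; ring.
have hp : half_quad R B c ^+ p = 1 by apply: add_char_exp_p.
rewrite GE; case/orP: G1 => /eqP G1; first by rewrite G1 mul1r.
have hc : half_quad R B c = -1 by rewrite -Gh G1 mulN1r opprK.
move: hp; rewrite hc -signr_odd p_odd expr1 => /eqP.
by rewrite eqNr oner_eq0.
Qed.

End Necessity.

(** * The fibre functor on a Lagrangian decomposition *)

Section FibreSpaces.
Variables (R : realType) (A W : finZmodType).
Implicit Types (X Y Z : ty_obj A) (s t : ty_label A).
Local Notation K := R[i].
Local Notation hom := (ty_hom R).

(* The fibre of m has a basis indexed by W; that of a group element is spanned by the vector of index 0. *)
Definition fib_ok s (w : W) : bool := (s == None) || (w == 0).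

Definition fib_basis X : finType := {p : summand X * W | fib_ok (tag p.1) p.2}.

Definition fib X : vectType K := {ffun fib_basis X -> K^o}.

Definition fval X (u : fib X) (i : summand X) (w : W) : K :=
  oapp (fun p => u p : K) 0 (insub (i, w)).

Definition fib_of X (f : summand X -> W -> K) : fib X := [ffun p => f (val p).1 (val p).2].

Lemma fval_of X (f : summand X -> W -> K) i w :
  fval (fib_of f) i w = if fib_ok (tag i) w then f i w else 0.
Proof.
rewrite /fval; case: insubP => [p /= -> pE|/= /negPf->] //=.
by rewrite ffunE /= [val p]pE.
Qed.

Lemma fval_bad X (u : fib X) i w : ~~ fib_ok (tag i) w -> fval u i w = 0.
Proof. by move=> iw; rewrite /fval insubF //=; apply: negPf. Qed.

Lemma fib_eqP X (u v : fib X) : (forall i w, fval u i w = fval v i w) -> u = v.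
Proof.
move=> uv; apply/ffunP => -[[i w] iw]; have := uv i w.
by rewrite /fval (insubT (fun p => fib_ok (tag p.1) p.2) iw).
Qed.

Lemma fvalD X (u v : fib X) i w : fval (u + v) i w = fval u i w + fval v i w.
Proof. by rewrite /fval; case: insubP => [p _ _|_] /=; rewrite ?ffunE ?addr0. Qed.

Lemma fvalZ X (c : K) (u : fib X) i w : fval (c *: u) i w = c * fval u i w.
Proof. by rewrite /fval; case: insubP => [p _ _|_] /=; rewrite ?ffunE ?mulr0. Qed.

Lemma fval0 X i w : fval (0 : fib X) i w = 0.
Proof. by rewrite /fval; case: insubP => [p _ _|_] /=; rewrite ?ffunE. Qed.

Lemma fval_lin X (c : K) (u v : fib X) i w :
  fval (c *: u + v) i w = c * fval u i w + fval v i w.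
Proof. by rewrite fvalD fvalZ. Qed.

Lemma fval_sum X (I : finType) (f : I -> fib X) i w :
  fval (\sum_k f k) i w = \sum_k fval (f k) i w.
Proof. by apply: (big_morph (fun f => fval f i w)) => [g h|]; rewrite ?fvalD ?fval0. Qed.

Definition fdelta X i w : fib X := fib_of (fun j w' => ((j == i) && (w' == w))%:R).

Lemma fval_delta X (i j : summand X) w w' : fib_ok (tag i) w ->
  fval (fdelta i w) j w' = ((j == i) && (w' == w))%:R.
Proof.
move=> ok; rewrite fval_of; case: ifP => // /negP bad; case: andP => // -[/eqP ji /eqP ww].
by case: bad; rewrite ji ww.
Qed.

Lemma fib_sum_delta X (u : fib X) : u = \sum_i \sum_w fval u i w *: fdelta i w.
Proof.
apply: fib_eqP => i w; rewrite fval_sum (@sum_only _ _ _ i) => [|j /negPf ji]; last first.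
  rewrite fval_sum big1 // => w' _; rewrite fvalZ fval_of eq_sym ji.
  by rewrite if_same mulr0.
rewrite fval_sum (@sum_only _ _ _ w) => [|w' /negPf ww]; last first.
  by rewrite fvalZ fval_of eqxx eq_sym ww if_same mulr0.
rewrite fvalZ fval_of !eqxx; case: ifP => [|/negbT bad]; first by rewrite mulr1.
by rewrite fval_bad ?mul0r.
Qed.

Lemma dim_fib X : \dim {:fib X} = #|fib_basis X|.
Proof. by rewrite dimvf /dim /= muln1. Qed.

Lemma fib_ok0 s : fib_ok s 0.
Proof. by rewrite /fib_ok eqxx orbT. Qed.

Definition fmor X Y (f : hom X Y) (u : fib X) : fib Y :=
  fib_of (fun j w => \sum_i entry f i j * fval u i w).

Lemma fval_fmor X Y (f : hom X Y) u j w :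
  fval (fmor f u) j w = \sum_i entry f i j * fval u i w.
Proof.
rewrite fval_of; case: ifP => // /negbT bad; apply/esym/big1 => i _.
case: (eqVneq (tag i) (tag j)) => [ij|ij]; last by rewrite entry_tag ?mul0r.
by rewrite fval_bad ?ij ?mulr0.
Qed.

Lemma fmor_is_linear X Y (f : hom X Y) : linear (fmor f).
Proof.
move=> c u v; apply: fib_eqP => j w; rewrite fval_lin !fval_fmor mulr_sumr -big_split /=.
by apply: eq_bigr => i _; rewrite fval_lin; ring.
Qed.

HB.instance Definition _ X Y (f : hom X Y) :=
  GRing.isLinear.Build K (fib X) (fib Y) *:%R (fmor f) (@fmor_is_linear X Y f).

Definition fhom X Y (f : hom X Y) : 'Hom(fib X, fib Y) := linfun (fmor f).

Lemma fhomE X Y (f : hom X Y) u : fhom f u = fmor f u.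
Proof. by rewrite lfunE. Qed.

Lemma fhom_is_linear X Y : linear (@fhom X Y).
Proof.
move=> c f g; apply/lfunP => u; rewrite add_lfunE scale_lfunE !fhomE.
apply: fib_eqP => j w; rewrite fval_lin !fval_fmor mulr_sumr -big_split /=.
by apply: eq_bigr => i _; rewrite entryD entryZ; ring.
Qed.

HB.instance Definition _ X Y :=
  GRing.isLinear.Build K (hom X Y) 'Hom(fib X, fib Y) *:%R (@fhom X Y) (@fhom_is_linear X Y).

Lemma fhom_id X : fhom (ty_id R X) = \1%VF.
Proof.
apply/lfunP => u; rewrite fhomE id_lfunE; apply: fib_eqP => j w; rewrite fval_fmor.
rewrite (@sum_only _ _ _ j) => [|i /negPf ij]; first by rewrite entry_id eqxx mul1r.
by rewrite entry_id ij mul0r.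
Qed.

Lemma fhom_comp X Y Z (f : hom X Y) (g : hom Y Z) :
  fhom (ty_comp f g) = (fhom g \o fhom f)%VF.
Proof.
apply/lfunP => u; rewrite comp_lfunE !fhomE; apply: fib_eqP => k w; rewrite !fval_fmor.
under eq_bigr do rewrite entry_comp mulr_suml.
rewrite exchange_big; apply: eq_bigr => j _ /=; rewrite fval_fmor mulr_sumr.
by apply: eq_bigr => i _; ring.
Qed.

Lemma fmor_delta X Y (f : hom X Y) i j w : fib_ok (tag i) w ->
  fval (fmor f (fdelta i w)) j w = entry f i j.
Proof.
move=> ok; rewrite fval_fmor (@sum_only _ _ _ i) => [|k /negPf ki].
  by rewrite fval_delta // !eqxx mulr1.
by rewrite fval_delta // ki mulr0.
Qed.

Lemma fhom_inj X Y : injective (@fhom X Y).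
Proof.
move=> f g fg; apply: hom_eqP => i j.
rewrite -(fmor_delta f j (fib_ok0 (tag i))) -(fmor_delta g j (fib_ok0 (tag i))).
by rewrite -!fhomE fg.
Qed.

(** * Exactness of the fibre functor *)

Section Exactness.
Variables (chi : A -> A -> K) (tau : R).
Local Notation C := (TY chi tau).

(** The coordinates of a fibre vector with index w, on summands of label s, read as a morphism from
    the simple object s. Kernel properties in the category thereby apply to vectors. *)
Definition slice X (u : fib X) s w : hom (ty_simple s) X := of_entries (fun _ i => fval u i w).

Lemma entry_slice X (u : fib X) s w o i :
  entry (slice u s w) o i = if tag i == s then fval u i w else 0.
Proof. by rewrite entry_of_entries tag_simple eq_sym. Qed.

Lemma slice_fmor X Y (f : hom X Y) u s w : ty_comp (slice u s w) f = slice (fmor f u) s w.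
Proof.
apply: hom_eqP => o j; rewrite entry_comp entry_slice fval_fmor.
case: eqP => [js|/eqP js].
  apply: eq_bigr => i _; rewrite entry_slice; case: eqP => [|/eqP is_]; first by rewrite mulrC.
  by rewrite (entry_tag f) ?mul0r ?mulr0 // js.
rewrite big1 // => i _; rewrite entry_slice; case: eqP => [is_|]; last by rewrite mul0r.
by rewrite (entry_tag f) ?mulr0 // is_ eq_sym.
Qed.

Lemma slice_eq0 X (u : fib X) : (forall s w, slice u s w = 0) -> u = 0.
Proof.
move=> u0; apply: fib_eqP => i w; have := congr1 (fun h => entry h (simple_summand (tag i)) i) (u0 (tag i) w).
by rewrite /= entry_slice eqxx entry0 fval0.
Qed.

Lemma slice0 X s w : slice (0 : fib X) s w = 0.
Proof. by apply: hom_eqP => o i; rewrite entry_slice fval0 entry0 if_same. Qed.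

Lemma fhom_exact X Y Z (f : hom X Y) (g : hom Y Z) :
  @short_exact _ C X Y Z f g -> vect_short_exact (fhom f) (fhom g).
Proof.
move=> [[/= fg0 kerP] [_ /= cokP]]; split.
- apply/eqP/lker0P => u u' /eqP; rewrite -subr_eq0 -linearB /= fhomE => /eqP fu0.
  apply/eqP; rewrite -subr_eq0; apply/eqP/slice_eq0 => s w.
  have h0 : ty_comp (0 : hom (ty_simple s) Y) g = 0.
    by apply: hom_eqP => o k; rewrite entry_comp entry0 big1 // => j _; rewrite entry0 mul0r.
  have [k [_ kuniq]] := kerP (ty_simple s) 0 h0.
  rewrite -(kuniq (slice (u - u') s w)); last by rewrite slice_fmor fu0 slice0.
  apply: kuniq; apply: hom_eqP => o j; rewrite entry_comp entry0 big1 // => i _.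
  by rewrite entry0 mul0r.
- apply/eqP; rewrite eqEsubv; apply/andP; split; apply/subvP => v.
    move/memv_imgP => [u _ ->]; rewrite memv_ker -comp_lfunE -fhom_comp.
    by rewrite [ty_comp f g]fg0 linear0 zero_lfunE.
  rewrite memv_ker fhomE => /eqP gv0.
  have H s w : exists k : hom (ty_simple s) X, ty_comp k f = slice v s w.
    have h0 : ty_comp (slice v s w) g = 0 by rewrite slice_fmor gv0 slice0.
    by have [k [kf _]] := kerP (ty_simple s) _ h0; exists k.
  (* The lifts of the slices may be chosen independently: morphisms act on each index w separately,
     so the chosen lifts assemble to a preimage. *)
  pose k s w := projT1 (cid (H s w)).
  have kP s w : ty_comp (k s w) f = slice v s w := projT2 (cid (H s w)).
  pose u : fib X := fib_of (fun i w => entry (k (tag i) w) (simple_summand (tag i)) i).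
  apply/memv_imgP; exists u; first exact: memvf.
  apply: fib_eqP => j w; rewrite fhomE fval_fmor.
  case: (boolP (fib_ok (tag j) w)) => [ok|bad]; last first.
    rewrite fval_bad // big1 // => i _; case: (eqVneq (tag i) (tag j)) => [ij|ij].
      by rewrite fval_bad ?ij // mulr0.
    by rewrite entry_tag // mul0r.
  have := congr1 (fun h => entry h (simple_summand (tag j)) j) (kP (tag j) w).
  rewrite /= entry_slice eqxx => <-; rewrite entry_comp; apply: eq_bigr => i _.
  case: (eqVneq (tag i) (tag j)) => [ij|ij]; last by rewrite (entry_tag f) // mul0r mulr0.
  by rewrite fval_of ij ok mulrC.
(* [P] kills the image of g, and surjectivity amounts to its vanishing. *)
- pose P : 'End(fib Z) := \1%VF - projv (limg (fhom g)).
  have P0 u : P (fhom g u) = 0.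
    by rewrite add_lfunE opp_lfunE id_lfunE projv_id ?memv_img ?memvf // subrr.
  suff PZ z : P z = 0.
    apply/vspaceP => z; rewrite memvf; have /eqP := PZ z.
    rewrite add_lfunE opp_lfunE id_lfunE subr_eq0 => /eqP->; exact: memv_proj.
  have PD i w : fib_ok (tag i) w -> P (fdelta i w) = 0.
    move=> ok; apply: fib_eqP => q x; rewrite fval0.
    (* One coordinate (q, x) of [P], restricted to index w and to the label of i, viewed as a
       morphism out of Z. It is annihilated by g, hence zero by the uniqueness in the cokernel
       property. *)
    pose h : hom Z (ty_simple (tag i)) := of_entries (fun k _ => fval (P (fdelta k w)) q x).
    have hE k o : entry h k o = if tag k == tag i then fval (P (fdelta k w)) q x else 0.
      by rewrite entry_of_entries tag_simple.
    have h0 : ty_comp g h = 0.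
      apply: hom_eqP => j o; rewrite entry_comp entry0.
      case: (eqVneq (tag j) (tag i)) => [ji|ji]; last first.
        apply: big1 => k _; rewrite hE; case: eqP => [ki|]; last by rewrite mulr0.
        by rewrite entry_tag ?mul0r // ki.
      have ok' : fib_ok (tag j) w by rewrite ji.
      have := congr1 (fun z => fval z q x) (P0 (fdelta j w)); rewrite fval0 => E; apply: etrans E.
      rewrite fhomE [fmor g _]fib_sum_delta linear_sum fval_sum; apply: eq_bigr => k _.
      rewrite linear_sum fval_sum (@sum_only _ _ _ w) => [|w' ww].
        rewrite linearZ fvalZ fmor_delta // hE.
        by case: eqP => // /eqP ki; rewrite entry_tag ?mul0r // ji eq_sym.
      rewrite linearZ fvalZ fval_fmor (@sum_only _ _ _ j) => [|j' /negPf jj].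
        by rewrite fval_delta // (negPf ww) andbF mulr0 mul0r.
      by rewrite fval_delta // jj mulr0.
    have f0 : ty_comp f (0 : hom Y (ty_simple (tag i))) = 0.
      by apply: hom_eqP => j o; rewrite entry_comp entry0 big1 // => k _; rewrite entry0 mulr0.
    have [k [_ kuniq]] := cokP (ty_simple (tag i)) 0 f0.
    have : h = 0.
      rewrite -(kuniq h) //; apply: kuniq; apply: hom_eqP => j o.
      by rewrite entry_comp entry0 big1 // => k' _; rewrite entry0 mulr0.
    move/(congr1 (fun h => entry h i (simple_summand (tag i)))).
    by rewrite /= hE eqxx entry0.
  rewrite (fib_sum_delta z) linear_sum big1 // => i _; rewrite linear_sum big1 // => w _.
  rewrite linearZZ; case: (boolP (fib_ok (tag i) w)) => [ok|bad].
    exact: etrans (congr1 (GRing.scale _) (PD i w ok)) (scaler0 _ _).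
  by rewrite fval_bad // scale0r.
Qed.

End Exactness.

(** * The monoidal constraint *)

Section Tensor.
(** The maps [x] and [f] are the two coordinates of an identification of A with W x W, with inverse
    [g]. By [chiE] both factors are isotropic for [chi], and [kappa] is the pairing between them. *)
Variables (chi : A -> A -> K) (tau : R) (kappa : W -> W -> K) (x f : A -> W).
Hypothesis kappaDl : forall u v w, kappa (u + v) w = kappa u w * kappa v w.
Hypothesis kappaDr : forall u v w, kappa u (v + w) = kappa u v * kappa u w.
Hypothesis kappa_neq0 : forall u v, kappa u v != 0.
Hypothesis kappa_orth_l : forall v, \sum_u kappa u v = if v == 0 then #|W|%:R else 0.
Hypothesis kappa_orth_r : forall u, \sum_v kappa u v = if u == 0 then #|W|%:R else 0.
Hypothesis xD : {morph x : a b / a + b}.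
Hypothesis fD : {morph f : a b / a + b}.
Variable g : W -> W -> A.
Hypothesis xg : forall u v, x (g u v) = u.
Hypothesis fg : forall u v, f (g u v) = v.
Hypothesis gK : forall a, g (x a) (f a) = a.
Hypothesis chiE : forall a b, chi a b = kappa (f a) (x b) * kappa (f b) (x a).
Hypothesis tauW : tau%:C * #|W|%:R = 1.
Local Notation C := (TY chi tau).

(* L_a e_w = kappa (f a) w e_(w + x a), R_a e_w = kappa (f a) (w + x a)^-1 e_(w + x a),
   and the component of e_u ⊗ e_w in a is kappa (f a) w if u + w = x a. *)
Definition fcoef s t v (w1 w2 w3 : W) : K :=
  match s, t, v with
  | Some a, Some b, Some c => ((c == a + b) && (w3 == 0))%:R * kappa (f a) (x b)
  | Some a, None, None => (w3 == w2 + x a)%:R * kappa (f a) w2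
  | None, Some a, None => (w3 == w1 + x a)%:R * (kappa (f a) w3)^-1
  | None, None, Some a => ((w1 + w2 == x a) && (w3 == 0))%:R * kappa (f a) w2
  | _, _, _ => 0
  end.

Lemma fcoef_nofusion s t v w1 w2 w3 : ty_fusion s t v = false -> fcoef s t v w1 w2 w3 = 0.
Proof.
by case: s t v => [a|] [b|] [c|] //=; rewrite /ty_fusion => ->; rewrite mul0r.
Qed.

Lemma fcoef_bad s t v w1 w2 w3 : ~~ fib_ok v w3 -> fcoef s t v w1 w2 w3 = 0.
Proof.
case: v => [c|] //; rewrite /fib_ok /= => /negPf w30.
by case: s t => [a|] [b|] //=; rewrite w30 andbF mul0r.
Qed.

Definition ften X Y (u : fib X) (v : fib Y) : fib (ty_tens X Y) :=
  fib_of (fun k w => \sum_w1 \sum_w2 fval u (factors k).1 w1 * fval v (factors k).2 w2 *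
    fcoef (tag (factors k).1) (tag (factors k).2) (tag k) w1 w2 w).

Lemma fval_ften X Y (u : fib X) (v : fib Y) k w : fval (ften u v) k w =
  \sum_w1 \sum_w2 fval u (factors k).1 w1 * fval v (factors k).2 w2 *
    fcoef (tag (factors k).1) (tag (factors k).2) (tag k) w1 w2 w.
Proof.
rewrite fval_of; case: ifP => // /negbT bad.
by rewrite big1 // => w1 _; rewrite big1 // => w2 _; rewrite fcoef_bad ?mulr0.
Qed.

Lemma ften_is_bilinear X Y :
  bilinear_for (GRing.Scale.Law.clone _ _ *:%R _) (GRing.Scale.Law.clone _ _ *:%R _) (@ften X Y).
Proof.
split=> u c v v'; apply: fib_eqP => k w; rewrite fval_lin !fval_ften mulr_sumr -big_split /=;
  apply: eq_bigr => w1 _; rewrite mulr_sumr -big_split /=; apply: eq_bigr => w2 _;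
  rewrite fval_lin; ring.
Qed.

HB.instance Definition _ X Y :=
  bilinear_isBilinear.Build K (fib X) (fib Y) (fib (ty_tens X Y)) *:%R *:%R (@ften X Y)
    (@ften_is_bilinear X Y).

Lemma ften_natural (X X' Y Y' : ty_obj A) (h : hom X X') (h' : hom Y Y') u v :
  fhom (ty_tensm h h') (ften u v) = ften (fhom h u) (fhom h' v).
Proof.
rewrite !fhomE; apply: fib_eqP => k w; rewrite fval_fmor fval_ften.
under eq_bigr do rewrite entry_tensm fval_ften.
apply: etrans.
  apply: (sum_tens (fun s p => (s == tag k)%:R * (entry h p.1 (factors k).1 * entry h' p.2 (factors k).2) *
    \sum_w1 \sum_w2 fval u p.1 w1 * fval v p.2 w2 * fcoef (tag p.1) (tag p.2) s w1 w2 w)).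
under [RHS]eq_bigr => w1 _.
  under eq_bigr => w2 _.
    rewrite !fval_fmor !mulr_suml.
    under eq_bigr => i _ do rewrite mulr_sumr mulr_suml.
    over.
  rewrite exchange_big /=; over.
rewrite [RHS]exchange_big /=; apply: eq_bigr => i _.
under [RHS]eq_bigr do rewrite exchange_big /=.
rewrite [RHS]exchange_big /=; apply: eq_bigr => j _.
rewrite (@sum_fusion1 _ _ _ _ (tag k)) /= => [|s /negPf sk]; last by rewrite sk !mul0r.
rewrite eqxx mul1r.
case: (eqVneq (tag i) (tag (factors k).1)) => [ik|ik]; last first.
  rewrite (entry_tag h) // !mul0r mulr0 big1 // => w1 _; rewrite big1 // => w2 _.
  by rewrite !mul0r.
case: (eqVneq (tag j) (tag (factors k).2)) => [jk|jk]; last first.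
  rewrite (entry_tag h') // !(mul0r, mulr0) big1 // => w1 _; rewrite big1 // => w2 _.
  by rewrite mul0r mulr0 mul0r.
rewrite ik jk factors_fusion mul1r mulr_sumr; apply: eq_bigr => w1 _.
by rewrite mulr_sumr; apply: eq_bigr => w2 _; ring.
Qed.

Lemma kappa0l v : kappa 0 v = 1.
Proof. by apply: (mulfI (kappa_neq0 0 v)); rewrite -kappaDl addr0 mulr1. Qed.

Lemma kappa0r u : kappa u 0 = 1.
Proof. by apply: (mulfI (kappa_neq0 u 0)); rewrite -kappaDr addr0 mulr1. Qed.

Lemma kappaNl u v : kappa (- u) v = (kappa u v)^-1.
Proof. by apply: (mulfI (kappa_neq0 u v)); rewrite -kappaDl subrr kappa0l divff. Qed.

Lemma kappaNr u v : kappa u (- v) = (kappa u v)^-1.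
Proof. by apply: (mulfI (kappa_neq0 u v)); rewrite -kappaDr subrr kappa0r divff. Qed.

Lemma sum_coords (F : A -> K) : \sum_a F a = \sum_u \sum_v F (g u v).
Proof.
rewrite pair_big /= (reindex (fun uv => g uv.1 uv.2)) //.
by exists (fun a => (x a, f a)) => [[u v] _|a _]; rewrite ?gK // xg fg.
Qed.

(** One identity for each of the eight types of associator. In seven of them at most one
    intermediate vector contributes and bilinearity of [kappa] suffices; for Phi_{m,m,m} a sum over
    A remains. *)
Lemma fcoef_assoc s t u v y w1 w2 w3 w :
  ty_fusion t u y -> ty_fusion s y v ->
  \sum_z ty_assoc_coef chi tau s t u v z y *
    (\sum_w' fcoef s t z w1 w2 w' * fcoef z u v w' w3 w) =
  \sum_w' fcoef t u y w2 w3 w' * fcoef s y v w1 w' w.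
Proof.
case: s t u => [a|] [b|] [c|]; rewrite /=.
- case: y => // y; rewrite {1}/ty_fusion => /eqP->.
  case: v => // v; rewrite {1}/ty_fusion => /eqP->.
  rewrite (@sum_only _ _ _ (Some (a + b))) => [|z zab]; last first.
    rewrite big1 ?mulr0 // => w' _; case: z zab => [z|] /=; last by rewrite mul0r.
    by rewrite [Some z == _]/eq_op /= => /negPf->; rewrite /= !mul0r.
  rewrite !(@sum_only _ _ _ 0) => [|w' /negPf ww|w' /negPf ww]; try by rewrite /= ww andbF !mul0r.
  by rewrite mul1r /= addrA !eqxx /= xD fD kappaDl kappaDr; ring.
- case: y => // _; case: v => // _.
  rewrite (@sum_only _ _ _ (Some (a + b))) => [|z zab]; last first.
    rewrite big1 ?mulr0 // => w' _; case: z zab => [z|] /=; last by rewrite mul0r.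
    by rewrite [Some z == _]/eq_op /= => /negPf->; rewrite /= !mul0r.
  rewrite (@sum_only _ _ _ 0) => [|w' /negPf ww]; last by rewrite /= ww andbF !mul0r.
  rewrite (@sum_only _ _ _ (w3 + x b)) => [|w' /negPf ww]; last by rewrite /= ww !mul0r.
  by rewrite mul1r /= !eqxx /= xD fD kappaDl kappaDr [x a + _]addrC addrA; ring.
- case: y => // _; case: v => // _.
  rewrite (@sum_only _ _ _ None) => [|[z|] // _]; last first.
    by rewrite big1 ?mulr0 // => w' _; rewrite /= mul0r.
  rewrite (@sum_only _ _ _ (w2 + x a)) => [|w' /negPf ww]; last by rewrite /= ww !mul0r.
  rewrite (@sum_only _ _ _ (w2 + x c)) => [|w' /negPf ww]; last by rewrite /= ww !mul0r.
  rewrite /= !eqxx /= addrAC; case: eqP => [->|_] /=; last by ring.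
  by rewrite chiE !kappaDr; field; rewrite !kappa_neq0.
- case: y => // b _; case: v => // v; rewrite {1}/ty_fusion => /eqP->.
  rewrite (@sum_only _ _ _ None) => [|[z|] // _]; last first.
    by rewrite big1 ?mulr0 // => w' _; rewrite /= mul0r.
  rewrite (@sum_only _ _ _ (w2 + x a)) => [|w' /negPf ww]; last by rewrite /= ww !mul0r.
  rewrite (@sum_only _ _ _ 0) => [|w' /negPf ww]; last by rewrite /= ww andbF !mul0r.
  rewrite /= !eqxx /= xD [w2 + x a]addrC -addrA (inj_eq (addrI _)) andbT.
  by case: eqP => [<-|_]; rewrite /= ?fD ?kappaDl ?kappaDr; ring.
- case: y => // y; rewrite {1}/ty_fusion => /eqP->; case: v => // _.
  rewrite (@sum_only _ _ _ None) => [|[z|] // _]; last first.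
    by rewrite big1 ?mulr0 // => w' _; rewrite /= mul0r.
  rewrite (@sum_only _ _ _ (w1 + x b)) => [|w' /negPf ww]; last by rewrite /= ww !mul0r.
  rewrite (@sum_only _ _ _ 0) => [|w' /negPf ww]; last by rewrite /= ww andbF !mul0r.
  rewrite /= !eqxx /= xD addrA; case: eqP => [->|_] /=; last by ring.
  by rewrite fD !(kappaDl, kappaDr); field; rewrite !kappa_neq0.
- case: y => // _; case: v => // d _.
  rewrite (@sum_only _ _ _ None) => [|[z|] // _]; last first.
    by rewrite big1 ?mulr0 // => w' _; rewrite /= mul0r.
  rewrite (@sum_only _ _ _ (w1 + x b)) => [|w' /negPf ww]; last by rewrite /= ww !mul0r.
  rewrite (@sum_only _ _ _ (w3 + x b)) => [|w' /negPf ww]; last by rewrite /= ww !mul0r.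
  rewrite /= !eqxx /= addrAC [w3 + _]addrC addrA addrAC; case: eqP => [E|_] /=; last by ring.
  by rewrite chiE -E !kappaDr; field; rewrite !kappa_neq0.
- case: y => // _; case: v => // d _.
  rewrite (@sum_only _ _ _ (Some (d - c))) => [|[z|] zdc]; last 2 first.
  + rewrite big1 ?mulr0 // => w' _; rewrite /= -subr_eq [d - c == z]eq_sym.
    by move: zdc; rewrite [Some z == _]/eq_op /= => /negPf->; rewrite /= mul0r mulr0.
  + by rewrite big1 ?mulr0 // => w' _; rewrite /= mul0r.
  rewrite (@sum_only _ _ _ 0) => [|w' /negPf ww]; last by rewrite /= ww andbF !mul0r.
  rewrite (@sum_only _ _ _ (w2 + x c)) => [|w' /negPf ww]; last by rewrite /= ww !mul0r.
  rewrite /= !eqxx subrK eqxx /= addrA.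
  have -> : (w1 + w2 == x (d - c)) = (w1 + w2 + x c == x d).
    have -> : x d = x (d - c) + x c by rewrite -xD subrK.
    by rewrite ![_ + x c]addrC (inj_eq (addrI _)).
  case: eqP => [_|_] /=; last by ring.
  have fdc : kappa (f d) =1 (fun v => kappa (f (d - c)) v * kappa (f c) v).
    by move=> v; rewrite -kappaDl -fD subrK.
  by rewrite !fdc !kappaDr; field; rewrite !kappa_neq0.
- case: y => // b _; case: v => // _.
  rewrite [RHS](@sum_only _ _ _ 0) => [|w' /negPf ww]; last by rewrite /= ww andbF !mul0r.
  rewrite sum_option big1 => [|w' _]; last by rewrite /= mul0r.
  rewrite mulr0 add0r sum_coords (@sum_only _ _ _ (w1 + w2)) => [|w' /negPf ww]; last first.
    rewrite big1 // => w'' _; rewrite big1 ?mulr0 // => w''' _.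
    by rewrite /= xg eq_sym ww !mul0r.
  (* The first coordinate of the intermediate group element must be w1 + w2. As a function of the
     second one, v, the terms are a constant times a character of W; its sum is |W| or 0, and tau
     |W| = 1. *)
  pose c := tau%:C * (kappa (f b) (w1 + w2))^-1 * (w == w1 + w2 + w3)%:R.
  transitivity (\sum_v c * kappa v (w2 + w3 - x b)).
    apply: eq_bigr => v _.
    rewrite (@sum_only _ _ _ 0) => [|w' /negPf ww]; last by rewrite /= ww andbF !mul0r.
    rewrite /= xg fg !eqxx /= chiE xg fg [w3 + _]addrC /c !kappaDr kappaNr.
    by field; rewrite !kappa_neq0.
  rewrite -mulr_sumr kappa_orth_l subr_eq0 /= eqxx andbT.
  case: eqP => [wb|_] /=; last by ring.
  rewrite /c mul1r -addrA wb; case: eqP => [->|_] /=; last by ring.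
  have -> : kappa (f b) w3 = kappa (f b) (w1 + x b) / kappa (f b) (w1 + w2).
    by rewrite -wb addrA [kappa _ (_ + w3)]kappaDr [_ * kappa _ w3]mulrC mulfK.
  rewrite mulr1 mulrAC tauW.
  by field; rewrite !kappa_neq0.
Qed.

Lemma ften_assoc X Y Z (u : fib X) (v : fib Y) (w : fib Z) :
  fhom (ty_assoc chi tau X Y Z) (ften (ften u v) w) = ften u (ften v w).
Proof.
rewrite fhomE; apply: fib_eqP => k om; rewrite fval_fmor fval_ften.
set jx := (factors k).1; set jyz := (factors k).2.
set jy := (factors jyz).1; set jz := (factors jyz).2.
(* [H] is a coefficient of the double product and [T] adds the associator entry. Labels and factors
   are independent arguments so that [sum_tens] applies twice; the deltas in [T] then leave only the
   factors of k. *)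
pose H o z p1 p2 q := \sum_w1 \sum_w3 (\sum_a \sum_b fval u p1 a * fval v p2 b *
  fcoef (tag p1) (tag p2) z a b w1) * fval w q w3 * fcoef z (tag q) o w1 w3 om.
pose T o z (p : summand X * summand Y) q := (p.1 == jx)%:R * ((p.2 == jy)%:R * (q == jz)%:R) *
  ty_assoc_coef chi tau (tag p.1) (tag p.2) (tag q) o z (tag jyz) * H o z p.1 p.2 q.
transitivity (\sum_i (tag i == tag k)%:R *
    T (tag i) (tag (factors i).1) (factors (factors i).1) (factors i).2).
  apply: eq_bigr => i _; rewrite entry_ty_assoc assoc_entryE fval_ften /T !mulrA; congr (_ * _).
  by apply: eq_bigr => w1 _; apply: eq_bigr => w3 _; rewrite fval_ften.
rewrite (sum_tens (fun o pq => (o == tag k)%:R * T o (tag pq.1) (factors pq.1) pq.2)) /=.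
transitivity (\sum_p T (tag k) (tag p) (factors p) jz).
  apply: eq_bigr => p _; rewrite (@sum_only _ _ _ jz) => [|q /negPf qj]; last first.
    by rewrite big1 // => o _; rewrite /T qj !(mulr0, mul0r).
  rewrite (@sum_fusion1 _ _ _ _ (tag k)) => [|o /negPf ok]; last by rewrite ok mul0r.
  rewrite eqxx mul1r; case E: ty_fusion; rewrite ?mul1r // mul0r.
  rewrite /T /H big1 ?mulr0 // => w1 _; rewrite big1 // => w3 _.
  by rewrite (fcoef_nofusion _ _ _ E) mulr0.
rewrite (sum_tens (fun z p => T (tag k) z p jz)).
rewrite (@sum_only _ _ _ jx) => [|i /negPf ij]; last first.
  by rewrite big1 // => j _; rewrite big1 // => z _; rewrite /T ij !mul0r.
rewrite (@sum_only _ _ _ jy) => [|j /negPf jj]; last first.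
  by rewrite big1 // => z _; rewrite /T jj !(mulr0, mul0r).
rewrite /T /= !eqxx !mul1r /H.
have fk : ty_fusion (tag jx) (tag jyz) (tag k) by apply: factors_fusion.
have fjk : ty_fusion (tag jy) (tag jz) (tag jyz) by apply: factors_fusion.
transitivity (\sum_a \sum_b \sum_c fval u jx a * fval v jy b * fval w jz c *
   \sum_z ty_assoc_coef chi tau (tag jx) (tag jy) (tag jz) (tag k) z (tag jyz) *
     (\sum_w' fcoef (tag jx) (tag jy) z a b w' * fcoef z (tag jz) (tag k) w' c om)).
  have HE z : ty_assoc_coef chi tau (tag jx) (tag jy) (tag jz) (tag k) z (tag jyz) *
      H (tag k) z jx jy jz = \sum_a \sum_b \sum_c fval u jx a * fval v jy b * fval w jz c *
      (ty_assoc_coef chi tau (tag jx) (tag jy) (tag jz) (tag k) z (tag jyz) *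
      \sum_w' fcoef (tag jx) (tag jy) z a b w' * fcoef z (tag jz) (tag k) w' c om).
    rewrite /H; under eq_bigr => w1 _.
      under eq_bigr => c _.
        rewrite !mulr_suml; under eq_bigr => a _ do rewrite !mulr_suml.
        over.
      rewrite exchange_big /=; under eq_bigr do rewrite exchange_big /=.
      over.
    rewrite exchange_big mulr_sumr; apply: eq_bigr => a _ /=.
    rewrite exchange_big mulr_sumr; apply: eq_bigr => b _ /=.
    rewrite exchange_big mulr_sumr; apply: eq_bigr => c _ /=; rewrite !mulr_sumr.
    by apply: eq_bigr => w' _; ring.
  (* Labels z outside the fusion rule may be included because [fcoef] vanishes there; [fcoef_assoc]
     needs the full sum. *)
  rewrite big_mkcond /=.
  transitivity (\sum_z ty_assoc_coef chi tau (tag jx) (tag jy) (tag jz) (tag k) z (tag jyz) *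
      H (tag k) z jx jy jz).
    apply: eq_bigr => z _; case: ifP => E; first by rewrite mul1r.
    rewrite HE big1 // => a _; rewrite big1 // => b _; rewrite big1 // => c _.
    by rewrite big1 ?mulr0 // => w' _; rewrite fcoef_nofusion // mul0r.
  rewrite (eq_bigr _ (fun z _ => HE z)).
  rewrite exchange_big; apply: eq_bigr => a _ /=.
  rewrite exchange_big; apply: eq_bigr => b _ /=.
  by rewrite exchange_big; apply: eq_bigr => c _ /=; rewrite mulr_sumr.
apply: eq_bigr => a _.
under [RHS]eq_bigr => w' _.
  rewrite fval_ften -/jy -/jz mulr_sumr mulr_suml.
  under eq_bigr => b _ do rewrite mulr_sumr mulr_suml.
  over.
rewrite [RHS]exchange_big; apply: eq_bigr => b _ /=.
rewrite [RHS]exchange_big; apply: eq_bigr => c _ /=.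
by rewrite fcoef_assoc // mulr_sumr; apply: eq_bigr => w' _; ring.
Qed.

Definition fib_unit : fib (@ty_unit A) := fdelta (simple_summand (Some 0)) 0.

Lemma fval_unit o w : fval fib_unit o w = (w == 0)%:R.
Proof. by rewrite (simple_summandP o) fval_delta ?fib_ok0 // eqxx. Qed.

Let x0 : x 0 = 0.
Proof. by apply: (addrI (x 0)); rewrite -xD !addr0. Qed.

Let f0 : f 0 = 0.
Proof. by apply: (addrI (f 0)); rewrite -fD !addr0. Qed.

Lemma fcoef_unitl s w1 w2 w : fib_ok s w2 -> fib_ok s w ->
  fcoef (Some 0) s s w1 w2 w = (w2 == w)%:R.
Proof.
case: s => [a|]; rewrite /fib_ok /=; first by move=> /eqP-> /eqP->; rewrite add0r !eqxx f0 kappa0l mulr1.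
by rewrite x0 f0 addr0 kappa0l mulr1 eq_sym.
Qed.

Lemma fcoef_unitr s w1 w2 w : fib_ok s w1 -> fib_ok s w ->
  fcoef s (Some 0) s w1 w2 w = (w1 == w)%:R.
Proof.
case: s => [a|]; rewrite /fib_ok /=; first by move=> /eqP-> /eqP->; rewrite addr0 !eqxx x0 kappa0r mulr1.
by rewrite x0 f0 addr0 kappa0l invr1 mulr1 eq_sym.
Qed.

Lemma ften_unitl X v : fhom (ty_lunit R X) (ften fib_unit v) = v.
Proof.
rewrite fhomE; apply: fib_eqP => k w.
case: (boolP (fib_ok (tag k) w)) => [okw|bad]; last by rewrite !fval_bad.
rewrite fval_fmor; under eq_bigr => i _ do rewrite entry_lunit fval_ften.
rewrite (sum_tens (fun t p => (t == tag k)%:R * (p.2 == k)%:R * \sum_w1 \sum_w2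
  fval fib_unit p.1 w1 * fval v p.2 w2 * fcoef (tag p.1) (tag p.2) t w1 w2 w)) /=.
rewrite sum_simple (@sum_only _ _ _ k) => [|j /negPf jk]; last first.
  by rewrite big1 // => t _; rewrite jk mulr0 mul0r.
rewrite (@sum_fusion1 _ _ _ _ (tag k)) => [|t /negPf tk]; last by rewrite tk !mul0r.
rewrite tag_simple fusion0l !eqxx !mul1r.
rewrite (@sum_only _ _ _ 0) => [|w' /negPf ww]; last first.
  by rewrite big1 // => w'' _; rewrite fval_unit ww !mul0r.
rewrite fval_unit eqxx (@sum_only _ _ _ w) => [|w' /negPf ww].
  by rewrite fcoef_unitl // eqxx mul1r mulr1.
case: (boolP (fib_ok (tag k) w')) => [ok'|bad]; last by rewrite fval_bad // mulr0 mul0r.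
by rewrite fcoef_unitl // ww mulr0.
Qed.

Lemma ften_unitr X v : fhom (ty_runit R X) (ften v fib_unit) = v.
Proof.
rewrite fhomE; apply: fib_eqP => k w.
case: (boolP (fib_ok (tag k) w)) => [okw|bad]; last by rewrite !fval_bad.
rewrite fval_fmor; under eq_bigr => i _ do rewrite entry_runit fval_ften.
rewrite (sum_tens (fun t p => (t == tag k)%:R * (p.1 == k)%:R * \sum_w1 \sum_w2
  fval v p.1 w1 * fval fib_unit p.2 w2 * fcoef (tag p.1) (tag p.2) t w1 w2 w)) /=.
rewrite (@sum_only _ _ _ k) => [|j /negPf jk]; last first.
  by rewrite big1 // => i _; rewrite big1 // => t _; rewrite jk mulr0 mul0r.
rewrite sum_simple.
rewrite (@sum_fusion1 _ _ _ _ (tag k)) => [|t /negPf tk]; last by rewrite tk !mul0r.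
rewrite tag_simple fusion0r !eqxx !mul1r exchange_big.
rewrite (@sum_only _ _ _ 0) => [|w' /negPf ww]; last first.
  by rewrite big1 // => w'' _; rewrite fval_unit ww mulr0 mul0r.
rewrite fval_unit eqxx (@sum_only _ _ _ w) => [|w' /negPf ww].
  by rewrite fcoef_unitr // eqxx !mulr1.
case: (boolP (fib_ok (tag k) w')) => [ok'|bad]; last by rewrite fval_bad // !mul0r.
by rewrite fcoef_unitr // ww mulr0.
Qed.

(** Up to a factor, the inverse of the matrix of structure constants consists of their reciprocals,
    where the convention 0^-1 = 0 keeps the support. For m ⊗ m this is orthogonality of the
    characters of W, which produces the factor |W|; otherwise at most one term is nonzero. *)
Lemma fcoef_dual s t v v' w w' :
  ty_fusion s t v -> ty_fusion s t v' -> fib_ok v w -> fib_ok v' w' ->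
  \sum_(w1 | fib_ok s w1) \sum_(w2 | fib_ok t w2) (fcoef s t v w1 w2 w)^-1 * fcoef s t v' w1 w2 w' =
  (if (s == None) && (t == None) then #|W|%:R else 1) * ((v' == v) && (w' == w))%:R.
Proof.
case: s t => [a|] [b|].
- case: v => // v /eqP->; case: v' => // v' /eqP->; rewrite /fib_ok /= => /eqP-> /eqP->.
  by rewrite !big_pred1_eq !eqxx /= !mul1r mulVf.
- case: v => // _; case: v' => // _ _ _; rewrite /fib_ok /= big_pred1_eq.
  rewrite (@sum_only _ _ _ (w - x a)) => [|w2 ww]; last first.
    by rewrite -subr_eq eq_sym (negPf ww) mul0r invr0 mul0r.
  rewrite !subrK !eqxx mul1r; case: eqP => _; rewrite /= ?mulr0 ?mul0r ?mulr0 // !mul1r mulVf //.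
- case: v => // _; case: v' => // _ _ _; rewrite /fib_ok /=.
  under eq_bigr do rewrite big_pred1_eq.
  rewrite (@sum_only _ _ _ (w - x b)) => [|w2 ww]; last first.
    by rewrite -subr_eq eq_sym (negPf ww) mul0r invr0 mul0r.
  rewrite !subrK !eqxx mul1r; case: eqP => [->|_]; rewrite /= ?mul0r ?mulr0 // !mul1r invrK divff //.
- case: v => // v _; case: v' => // v' _; rewrite /fib_ok /= => /eqP-> /eqP->.
  rewrite exchange_big /= !eqxx.
  transitivity (\sum_w2 (x v == x v')%:R * kappa (f v' - f v) w2).
    apply: eq_bigr => w2 _; rewrite (@sum_only _ _ _ (x v - w2)) => [|w1 ww]; last first.
      by rewrite -subr_eq0 -addrA -[w2 - _]opprB subr_eq0 (negPf ww) mul0r invr0 mul0r.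
    rewrite subrK eqxx /= !andbT !mul1r kappaDl kappaNl; ring.
  rewrite -mulr_sumr kappa_orth_r subr_eq0 andbT [Some _ == _]/eq_op /=.
  have -> : (v' == v) = (x v == x v') && (f v' == f v).
    by apply/eqP/andP => [->|[/eqP ex /eqP ef]]; rewrite ?eqxx // -[v']gK -[v]gK ex ef.
  by case: (x v == x v'); case: (f v' == f v); rewrite /= ?mulr0 ?mul0r ?mulr1 ?mul1r.
Qed.

Lemma fval_ften_delta X Y (i : summand X) (j : summand Y) w1 w2 k w :
  fib_ok (tag i) w1 -> fib_ok (tag j) w2 ->
  fval (ften (fdelta i w1) (fdelta j w2)) k w =
  (factors k == (i, j))%:R * fcoef (tag i) (tag j) (tag k) w1 w2 w.
Proof.
move=> ok1 ok2; rewrite fval_ften (@sum_only _ _ _ w1) => [|w' /negPf ww]; last first.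
  by rewrite big1 // => w'' _; rewrite fval_delta // ww andbF !mul0r.
rewrite (@sum_only _ _ _ w2) => [|w' /negPf ww]; last first.
  by rewrite !fval_delta // ww andbF mulr0 mul0r.
rewrite !fval_delta // !eqxx !andbT; case: (factors k) => i' j'; rewrite xpair_eqE /=.
by case: (i' =P i) => [->|_]; case: (j' =P j) => [->|_]; rewrite /= ?(mul0r, mulr0, mul1r).
Qed.

Lemma fdelta_span X Y (k : summand (ty_tens X Y)) w : fib_ok (tag k) w ->
  exists c : W -> W -> K, fdelta k w = \sum_w1 \sum_w2
    c w1 w2 *: ften (fdelta (factors k).1 w1) (fdelta (factors k).2 w2).
Proof.
move=> okw; set i := (factors k).1; set j := (factors k).2.
pose N : K := if (tag i == None) && (tag j == None) then #|W|%:R else 1.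
have N0 : N != 0.
  by rewrite /N; case: ifP => _; rewrite ?oner_eq0 // pnatr_eq0 -lt0n; apply/card_gt0P; exists 0.
pose c w1 w2 := if fib_ok (tag i) w1 && fib_ok (tag j) w2
  then N^-1 * (fcoef (tag i) (tag j) (tag k) w1 w2 w)^-1 else 0.
exists c; apply: fib_eqP => k' w'.
case: (boolP (fib_ok (tag k') w')) => [okw'|bad]; last by rewrite !fval_bad.
rewrite fval_delta // fval_sum.
under eq_bigr do rewrite fval_sum.
transitivity ((factors k' == (i, j))%:R * (N^-1 *
  \sum_(w1 | fib_ok (tag i) w1) \sum_(w2 | fib_ok (tag j) w2)
   (fcoef (tag i) (tag j) (tag k) w1 w2 w)^-1 * fcoef (tag i) (tag j) (tag k') w1 w2 w')).
  have fk : factors k = (i, j) by rewrite /i /j; case: (factors k).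
  rewrite eq_tens fk; case: (factors k' =P (i, j)) => [fk'|_]; last by rewrite andbF mul0r.
  have fus := factors_fusion k; rewrite -/i -/j in fus.
  have fus' := factors_fusion k'; rewrite fk' /= in fus'.
  by rewrite andbT mul1r fcoef_dual // mulrA mulVf // mul1r.
rewrite !mulr_sumr big_mkcond; apply: eq_bigr => w1 _.
case: (boolP (fib_ok (tag i) w1)) => [ok1|bad1]; last first.
  by rewrite big1 // => w2 _; rewrite fvalZ /c (negPf bad1) mul0r.
rewrite !mulr_sumr big_mkcond; apply: eq_bigr => w2 _; rewrite fvalZ /c ok1 /=.
case: ifP => ok2; last by rewrite mul0r.
by rewrite fval_ften_delta //; ring.
Qed.

Lemma natr_basis X : #|fib_basis X|%:R = \sum_(i : summand X) (if tag i == None then #|W|%:R else 1) :> K.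
Proof.
rewrite card_sig -sum1_card natr_sum big_mkcond /=.
rewrite -(pair_bigA _ (fun i w => if fib_ok (tag i) w then 1 else 0)) /=.
apply: eq_bigr => i _; rewrite -big_mkcond /= /fib_ok; case: (tag i) => [a|] /=.
  by rewrite big_pred1_eq.
by rewrite sumr_const.
Qed.

(** The only case with content is m ⊗ m, where |A| = |W|^2. *)
Lemma card_tens_basis X Y : #|fib_basis (ty_tens X Y)| = (#|fib_basis X| * #|fib_basis Y|)%N.
Proof.
apply/eqP; rewrite -(eqr_nat K) natrM !natr_basis; apply/eqP.
rewrite (sum_tens (fun t _ => if t == None then #|W|%:R else 1)) mulr_suml.
apply: eq_bigr => i _; rewrite mulr_sumr; apply: eq_bigr => j _.
case: (tag i) (tag j) => [a|] [b|]; rewrite big_mkcond sum_option /ty_fusion /=.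
- by rewrite -big_mkcond big_pred1_eq add0r mulr1.
- by rewrite big1 // addr0 mul1r.
- by rewrite big1 // addr0 mulr1.
- by rewrite sum_coords add0r !sumr_const mulr_natr.
Qed.

(** Pure tensors span by [fdelta_span], and their number is the dimension. *)
Lemma ften_iso X Y :
  basis_of fullv [seq ften u v | u <- vbasis {:fib X}, v <- vbasis {:fib Y}].
Proof.
rewrite basisEdim; apply/andP; split; last first.
  by rewrite size_allpairs !size_tuple !dim_fib card_tens_basis.
set S := (X in <<X>>%VS); have ftenS u v : ften u v \in <<S>>%VS.
  rewrite (coord_vbasis (memvf u)) linear_sumlz; apply: memv_suml => i _.
  rewrite linearZl_LR memvZ // (coord_vbasis (memvf v)) linear_sumr; apply: memv_suml => j _.
  rewrite linearZr_LR memvZ // memv_span //.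
  by apply: allpairs_f; apply: mem_nth; rewrite size_tuple.
apply/subvP => u _; rewrite (fib_sum_delta u); apply: memv_suml => k _; apply: memv_suml => w _.
case: (boolP (fib_ok (tag k) w)) => [ok|bad]; last by rewrite fval_bad // scale0r mem0v.
have [c ->] := fdelta_span ok.
by rewrite memvZ //; apply: memv_suml => w1 _; apply: memv_suml => w2 _; rewrite memvZ.
Qed.

Lemma fib_unit_iso : basis_of fullv [:: fib_unit].
Proof.
have u0 : fib_unit != 0.
  apply/eqP => /(congr1 (fun u => fval u (simple_summand (Some 0)) 0)).
  by rewrite fval0 fval_unit eqxx => /eqP; rewrite oner_eq0.
rewrite basisEfree seq1_free u0 subvf /= dim_fib.
rewrite -(ler_nat K) natr_basis sum_simple tag_simple //.
Qed.

Definition fib_fibration : fibration C :=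
  @Fibration K C fib (fun X Y => @fhom X Y) fhom_id fhom_comp fhom_inj (@fhom_exact chi tau)
    (fun X Y => @ften X Y) ften_iso ften_natural fib_unit fib_unit_iso ften_assoc ften_unitl ften_unitr.

End Tensor.
End FibreSpaces.

(** * From the Gauss sum to a fibration *)

Section FibreFunctor.
Variables (R : realType) (p l : nat) (p_prime : prime p) (p_odd : odd p).
Variables (B : {symmetric 'rV['F_p]_(2 * l)}) (B_nondeg : nondegenerate B).
Variables (tau : R) (tauE : tau = p%:R ^- l \/ tau = - p%:R ^- l).
Local Notation V := ('rV['F_p]_(2 * l) : finZmodType).
Local Notation W := ('rV['F_p]_l : finZmodType).
Local Notation C := (TY (chi_form R B : V -> V -> R[i]) tau).
Local Notation e := (@add_char R p).
Local Notation M := (form_mx B).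

Definition pairing (u v : W) : R[i] := e ((u *m v^T) 0 0).

Lemma pairingDl u v w : pairing (u + v) w = pairing u w * pairing v w.
Proof. by rewrite /pairing mulmxDl mxE add_charD. Qed.

Lemma pairingC u v : pairing u v = pairing v u.
Proof. by rewrite /pairing -[u *m _]trmxK trmx_mul trmxK mxE. Qed.

Lemma pairingDr u v w : pairing u (v + w) = pairing u v * pairing u w.
Proof. by rewrite pairingC pairingDl ![pairing _ u]pairingC. Qed.

Lemma sum_pairing u : \sum_v pairing u v = if u == 0 then #|W|%:R else 0.
Proof.
case: eqP => [->|/eqP u0].
  under eq_bigr do rewrite /pairing mul0mx mxE add_char0.
  by rewrite sumr_const.
apply: sum_nontrivial_char; first exact: pairingDr.
have [y ey] := add_char_nontrivial R p_prime p_odd.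
have /rV0Pn[j uj] := u0; exists (y / u 0 j *: delta_mx 0 j).
by rewrite /pairing linearZ /= -scalemxAr trmx_delta -colE [X in e X]mxE [X in _ * X]mxE divfK.
Qed.

Lemma gauss_sum_fibration : 0 < tau -> gauss_sum R B = p%:R ^+ l -> admits_fibration C.
Proof.
move=> tau_gt0 GE.
have symM := form_mx_sym B; have unitM := form_mx_unit B_nondeg.
have [|X [Y [XX YY XY]]] := exists_hyperbolic_basis (@add_char0 R p) (add_charD R p_prime)
  (add_char_nontrivial R p_prime p_odd) (Fp_two_neq0 p_prime p_odd) (erefl (2 * l)%N) symM unitM.
  by rewrite card_Fp.
have YX : Y *m M *m X^T = 1%:M.
  by apply: trmx_inj; rewrite !trmx_mul trmxK symM mulmxA XY trmx1.
(* The rows of [X] and of [Y] are dual bases of two Lagrangian subspaces, so pairing with [Y] gives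
   the coordinates along [X], and conversely. *)
pose x (a : V) : W := a *m M *m Y^T.
pose f (a : V) : W := a *m M *m X^T.
pose g (u v : W) : V := u *m X + v *m Y.
have xD : {morph x : a b / a + b} by move=> a b; rewrite /x !mulmxDl.
have fD : {morph f : a b / a + b} by move=> a b; rewrite /f !mulmxDl.
have xg u v : x (g u v) = u.
  by rewrite /x /g !mulmxDl -!mulmxA [X *m _]mulmxA [Y *m _]mulmxA XY YY mulmx0 mulmx1 addr0.
have fg u v : f (g u v) = v.
  by rewrite /f /g !mulmxDl -!mulmxA [X *m _]mulmxA [Y *m _]mulmxA XX YX mulmx0 mulmx1 add0r.
(* The map [g] is injective between sets of the same size, hence its left inverse is also a right
   inverse. *)
have gK a : g (x a) (f a) = a.
  have g_inj : injective (fun uv => g uv.1 uv.2).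
    by move=> [u v] [u' v'] /= E; rewrite -(xg u v) -{2}(fg u v) E xg fg.
  have [|h _ gh] := inj_card_bij g_inj.
    by rewrite card_prod !card_mx card_Fp // -expnD addnn -mul2n !mul1n.
  by rewrite -[a in RHS]gh -[a]gh /= xg fg.
have chiE a b : chi_form R B a b = pairing (f a) (x b) * pairing (f b) (x a).
  have E : a *m M *m b^T = f a *m (x b)^T + x a *m (f b)^T.
    by rewrite -{1}(gK b) linearD mulmxDr; congr (_ + _); rewrite /= trmx_mul mulmxA.
  have EB : B a b = (f a *m (x b)^T) 0 0 + (x a *m (f b)^T) 0 0 by rewrite form_mxE E mxE.
  by rewrite [pairing (f b) _]pairingC /pairing -add_charD // -EB.
have W0 : #|W|%:R != 0 :> R[i] by rewrite pnatr_eq0 -lt0n; apply/card_gt0P; exists 0.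
have tauW : tau%:C * #|W|%:R = 1 :> R[i].
  have -> : tau = p%:R ^- l.
    case: tauE tau_gt0 => // ->; rewrite oppr_gt0 ltNge invr_ge0 exprn_ge0 //.
  by rewrite card_mx card_Fp // mul1n -[_%:C]/(real_complex R _) fmorphV rmorphXn rmorph_nat
     natrX mulVf // expf_neq0 // pnatr_eq0 -lt0n prime_gt0.
apply: inhabits.
apply: (fib_fibration (kappa := pairing) pairingDl pairingDr _ _ sum_pairing xD fD xg fg gK chiE tauW).
  by move=> u v; apply: add_char_neq0.
by move=> v; under eq_bigr do rewrite pairingC; apply: sum_pairing.
Qed.

End FibreFunctor.

Theorem corollary5p6 (R : realType) (p l : nat) (hp : prime p) (hp_odd : odd p)
    (hl : (1 <= l)%N)
    (B : {symmetric 'rV['F_p]_(2 * l)}) (hB : nondegenerate B)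
    (tau : R) (htau : tau = p%:R ^- l \/ tau = - p%:R ^- l) :
  let V : finZmodType := 'rV['F_p]_(2 * l) in
  let C := TY (chi_form R B : V -> V -> R[i]) tau in
  admits_fibration C <->
  forall s : ty_label V,
    pivotal_dim (C := C) (ty_simple s) <= total_indicator (C := C) (ty_simple s).
Proof.
move=> V C; split=> [/(fibration_gauss_sum hp hp_odd hB htau)|].
  by move/(indicator_criterion hp hp_odd hl hB htau).
by case/(indicator_criterion hp hp_odd hl hB htau); apply: gauss_sum_fibration.
Qed.
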